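(* The isomorphism problem for automatic equivalence structures is $\Pi^0_1$-complete. That is, the set of pairs $(\mathcal P_1,\mathcal P_2)$ of automatic presentations such that $\mathcal S(\mathcal P_1)$ and $\mathcal S(\mathcal P_2)$ are equivalence structures and $\mathcal S(\mathcal P_1)\cong\mathcal S(\mathcal P_2)$ is $\Pi^0_1$-complete.
   Context: For words $w_1,\dots,w_n$ over an alphabet $\Sigma$, their convolution $w_1\otimes\cdots\otimes w_n$ is the word over $(\Sigma\cup\{\diamond\})^n$ ($\diamond\notin\Sigma$) of length $\max_i|w_i|$ whose $k$-th letter is $(\sigma_1,\dots,\sigma_n)$ with $\sigma_i$ the $k$-th letter of $w_i$ if $k\le|w_i|$ and $\sigma_i=\diamond$ otherwise. An $n$-ary relation on $\Sigma^*$ is FA recognizable if the set of convolutions of its tuples is regular. A structure is automatic if its domain is a regular subset of $\Sigma^*$ and each of its relations is FA recognizable; a tuple $\mathcal P$ of finite automata accepting the domain and the relations is an automatic presentation, and $\mathcal S(\mathcal P)$ denotes the structure it presents. An equivalence structure is a structure $(D;E)$ with $E$ an equivalence relation on $D$. For a class $\mathcal K$ of structures closed under isomorphism, the isomorphism problem for (automatic members of) $\mathcal K$ is the set of pairs $(\mathcal P_1,\mathcal P_2)$ of automatic presentations with $\mathcal S(\mathcal P_1)\cong\mathcal S(\mathcal P_2)\in\mathcal K$; $\Pi^0_n,\Sigma^0_n$ are the levels of the arithmetical hierarchy (via an effective encoding of presentations by natural numbers). *)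

(* Defs.v *)
From mathcomp Require Import all_boot.
Set Implicit Arguments.
Unset Strict Implicit.
Unset Printing Implicit Defensive.

(* The alphabet Sigma of size k is {0,...,k-1} (as nat).  A letter of   *)
(* (Sigma u {diamond})^n is a seq nat of length n, where 0 encodes the  *)
(* padding symbol diamond and i.+1 encodes the symbol i of Sigma.       *)

Definition word := seq nat.
Definition letter := seq nat.

Definition is_word (k : nat) (w : word) : bool := all (fun a => a < k) w.

Definition conv (ws : seq word) : seq letter :=
  [seq [seq (if i < size w then (nth 0 w i).+1 else 0) | w <- ws]
     | i <- iota 0 (\max_(w <- ws) size w)].

(* Nondeterministic finite automata over letters: start state, final   *)
(* states, and a finite list of transitions (q, a, q').  Every such     *)
(* datum is an NFA (finitely many states occur), and every regular      *)
(* language is recognized by one.                                       *)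

Definition nfa := (nat * seq nat * seq (nat * letter * nat))%type.

Definition nfa_start (A : nfa) : nat := A.1.1.
Definition nfa_final (A : nfa) : seq nat := A.1.2.
Definition nfa_delta (A : nfa) : seq (nat * letter * nat) := A.2.

Fixpoint nfa_run (fin : seq nat) (delta : seq (nat * letter * nat))
    (q : nat) (w : seq letter) : bool :=
  match w with
  | [::] => q \in fin
  | a :: w' => has (fun t : nat * letter * nat =>
                 [&& t.1.1 == q, t.1.2 == a & nfa_run fin delta t.2 w']) delta
  end.

Definition nfa_accepts (A : nfa) (w : seq letter) : bool :=
  nfa_run (nfa_final A) (nfa_delta A) (nfa_start A) w.

(* Automatic presentations for the signature of one binary relation:   *)
(* (k, A_D, A_E) with k the size of the alphabet, A_D an automaton for  *)
(* the domain and A_E an automaton for the relation.                    *)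

Definition presentation := (nat * nfa * nfa)%type.

Definition pres_dom (P : presentation) (w : word) : Prop :=
  is_word P.1.1 w /\ nfa_accepts P.1.2 (conv [:: w]).

Definition pres_rel (P : presentation) (u v : word) : Prop :=
  pres_dom P u /\ pres_dom P v /\ nfa_accepts P.2 (conv [:: u; v]).

Definition is_equiv_structure (P : presentation) : Prop :=
  (forall u, pres_dom P u -> pres_rel P u u) /\
  (forall u v, pres_rel P u v -> pres_rel P v u) /\
  (forall u v w, pres_rel P u v -> pres_rel P v w -> pres_rel P u w).

Definition pres_iso (P1 P2 : presentation) : Prop :=
  exists (f g : word -> word),
    (forall u, pres_dom P1 u -> pres_dom P2 (f u)) /\
    (forall v, pres_dom P2 v -> pres_dom P1 (g v)) /\
    (forall u, pres_dom P1 u -> g (f u) = u) /\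
    (forall v, pres_dom P2 v -> f (g v) = v) /\
    (forall u v, pres_dom P1 u -> pres_dom P1 v ->
       (pres_rel P1 u v <-> pres_rel P2 (f u) (f v))).

(* The isomorphism problem for automatic equivalence structures, as a set
   of natural numbers, via the effective encoding [pickle] of pairs of
   presentations (a countType) by natural numbers. *)
Definition EqIsoProblem (n : nat) : Prop :=
  match @pickle_inv (presentation * presentation)%type n with
  | Some PQ => is_equiv_structure PQ.1 /\ pres_iso PQ.1 PQ.2
  | None => False
  end.

Inductive prf : Type :=
  | PZero : prf
  | PSucc : prf
  | PProj : nat -> prf
  | PComp : prf -> list prf -> prf
  | PPrec : prf -> prf -> prf
  | PMu   : prf -> prf.

Inductive peval : prf -> seq nat -> nat -> Prop :=
  | ev_zero xs : peval PZero xs 0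
  | ev_succ x xs : peval PSucc (x :: xs) x.+1
  | ev_proj i xs : i < size xs -> peval (PProj i) xs (nth 0 xs i)
  | ev_comp f gs xs ys y :
      pevals gs xs ys -> peval f ys y -> peval (PComp f gs) xs y
  | ev_prec0 f g xs y : peval f xs y -> peval (PPrec f g) (0 :: xs) y
  | ev_precS f g n xs r y :
      peval (PPrec f g) (n :: xs) r -> peval g (n :: r :: xs) y ->
      peval (PPrec f g) (n.+1 :: xs) y
  | ev_mu f xs n :
      peval f (n :: xs) 0 ->
      (forall m, m < n -> exists v, peval f (m :: xs) v.+1) ->
      peval (PMu f) xs n
with pevals : list prf -> seq nat -> seq nat -> Prop :=
  | evs_nil xs : pevals nil xs [::]
  | evs_cons g gs xs y ys :
      peval g xs y -> pevals gs xs ys -> pevals (cons g gs) xs (y :: ys).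

Definition computable (h : nat -> nat) : Prop :=
  exists p : prf, forall n, peval p [:: n] (h n).

(* Pi^0_1 sets: A n <-> forall m, R n m, with R decidable (computable
   characteristic function, value 0 meaning "true") *)
Definition Pi01 (A : nat -> Prop) : Prop :=
  exists p : prf,
    (forall n m, exists v, peval p [:: n; m] v) /\
    (forall n, A n <-> forall m, peval p [:: n; m] 0).

Definition m_reducible (B A : nat -> Prop) : Prop :=
  exists h : nat -> nat, computable h /\ forall n, B n <-> A (h n).

Definition Pi01_complete (A : nat -> Prop) : Prop :=
  Pi01 A /\ forall B : nat -> Prop, Pi01 B -> m_reducible B A.

(* Main.v *)
Require Import Defs.
From mathcomp Require Import all_boot all_order all_algebra boolp zify.
Set Implicit Arguments.
Unset Strict Implicit.
Unset Printing Implicit Defensive.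
Import GRing.Theory.

(** Two automatic equivalence structures are isomorphic iff, for every [m] in [{1, 2, ..., oo}], they
    have the same number of classes of size [m]. For fixed [m], the words that are least in a class
    of size [m] form a regular language: a deterministic automaton reading [u] can maintain, capped
    at [m + 1], the number of words [v] that lead to each state of the presentation on [(u, v)].
    Pumping then decides whether this language is finite and computes its cardinality.

    For hardness, every N-rational series [F] is realized by class sizes: the elements are the runs
    of a weighted automaton, and runs with the same label [w] form a class with [F w] elements. A
    recursive function is compiled to a register program, given as a regular language of traces over
    increments, decrements and zero tests. A trace is a genuine computation iff, at each of its zero
    tests, the numbers [x] of increments and [y] of decrements of the tested register agree, i.e. iff
    the sum [U] of all [x^2 + y^2] equals the sum [V] of all [2xy]. Both sums are N-rational, hence
    so is [C(U, V)] for an injective polynomial [C]. Compare the structure that has infinitely many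
    classes of each size [C(a, b)], [a <> b], with the one that has in addition infinitely many
    classes of size [C(U, V)] for every trace: they are isomorphic iff there is no genuine halting
    trace. (Series over words thus take the place of Diophantine equations.) *)

(** Rational series have natural coefficients, so a failed zero test cannot be measured by a
    difference. Comparing [x^2 + y^2] with [2xy] replaces subtraction: each single comparison goes
    the same way, so equality of the two sums forces equality at every test. Nonnegativity before
    each decrement would not be such an equation; hence decrements are unguarded and registers hold
    integers. The reduction must be computable, although its automata and series are only shown to
    exist. They depend on the recursive function alone: the input is a block of leading zeros of the
    trace, and only the automaton for the domain, which counts these zeros, varies with it.
    Isomorphism compares class sizes with multiplicity, and the number of traces that produce a
    given size is out of control; a block of a neutral letter makes every size that occurs at all
    occur infinitely often, so only the set of sizes matters. In the upper bound, size [oo] is coded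
    by 0, and the class size [m] doubles as a bound for testing the axioms of equivalence
    relations. *)

(** * Induction, inversion and determinism for recursive functions *)

Section PrfInduction.
Variable P : prf -> Prop.
Hypotheses (Hzero : P PZero) (Hsucc : P PSucc) (Hproj : forall i, P (PProj i)).
Hypothesis Hcomp : forall f gs, P f -> (forall i, i < size gs -> P (nth PZero gs i)) -> P (PComp f gs).
Hypothesis Hprec : forall f g, P f -> P g -> P (PPrec f g).
Hypothesis Hmu : forall f, P f -> P (PMu f).

(** The list inside [PComp] is a nested occurrence of [prf]; the inner fixpoint supplies the
    induction hypotheses for its members. *)
Fixpoint prf_nested_ind (p : prf) : P p :=
  match p with
  | PZero => Hzero
  | PSucc => Hsucc
  | PProj i => Hproj i
  | PComp f gs => Hcomp (prf_nested_ind f)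
      ((fix all_ind (gs : seq prf) : forall i, i < size gs -> P (nth PZero gs i) :=
          match gs with
          | [::] => fun i lt => False_ind _ (notF lt)
          | g :: gs' => fun i => match i with
                                 | 0 => fun _ => prf_nested_ind g
                                 | i'.+1 => fun lt => all_ind gs' i' lt
                                 end
          end) gs)
  | PPrec f g => Hprec (prf_nested_ind f) (prf_nested_ind g)
  | PMu f => Hmu (prf_nested_ind f)
  end.
End PrfInduction.

Lemma pevalsP gs xs ys : pevals gs xs ys <->
  size ys = size gs /\ forall i, i < size gs -> peval (nth PZero gs i) xs (nth 0 ys i).
Proof.
elim: gs ys => [|g gs IH] ys; split.
- by move=> h; inversion h.
- by case: ys => [|y ys] [] // _ _; apply: evs_nil.
- move=> h; inversion h as [|g' gs' xs' y ys' hg hgs]; subst.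
  by have [s h'] := (IH ys').1 hgs; split=> /= [|[|i]]; rewrite ?s //; apply: h'.
- case: ys => [|y ys] [] //= [sz] h; apply: evs_cons; first exact: (h 0).
  by apply/IH; split=> // i /(h i.+1).
Qed.

Lemma peval_zeroP xs y : peval PZero xs y <-> y = 0.
Proof. by split=> [h|->]; [inversion h|apply: ev_zero]. Qed.

Lemma peval_succP xs y : peval PSucc xs y <-> 0 < size xs /\ y = (nth 0 xs 0).+1.
Proof.
split=> [h|[]]; first by inversion h.
by case: xs => // x xs _ ->; apply: ev_succ.
Qed.

Lemma peval_projP i xs y : peval (PProj i) xs y <-> i < size xs /\ y = nth 0 xs i.
Proof. by split=> [h|[ix ->]]; [inversion h|apply: ev_proj]. Qed.

Lemma peval_compP f gs xs y :
  peval (PComp f gs) xs y <-> exists2 ys, pevals gs xs ys & peval f ys y.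
Proof. by split=> [h|[ys h1 h2]]; [inversion h; exists ys|apply: ev_comp h1 h2]. Qed.

Lemma peval_prec0P f g xs y : peval (PPrec f g) (0 :: xs) y <-> peval f xs y.
Proof. by split=> [h|h]; [inversion h|apply: ev_prec0]. Qed.

Lemma peval_precSP f g n xs y : peval (PPrec f g) (n.+1 :: xs) y <->
  exists2 r, peval (PPrec f g) (n :: xs) r & peval g (n :: r :: xs) y.
Proof. by split=> [h|[r h1 h2]]; [inversion h; exists r|apply: ev_precS h1 h2]. Qed.

Lemma peval_prec_nil f g y : ~ peval (PPrec f g) [::] y.
Proof. by move=> h; inversion h. Qed.

Lemma peval_muP f xs n : peval (PMu f) xs n <->
  peval f (n :: xs) 0 /\ forall m, m < n -> exists v, peval f (m :: xs) v.+1.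
Proof. by split=> [h|[h1 h2]]; [inversion h|apply: ev_mu]. Qed.

Lemma peval_det p xs y y' : peval p xs y -> peval p xs y' -> y = y'.
Proof.
elim/prf_nested_ind: p xs y y' => [||i|f gs IHf IHg|f g IHf IHg|f IHf] xs y y'.
- by move=> /peval_zeroP -> /peval_zeroP.
- by move=> /peval_succP[_ ->] /peval_succP[].
- by move=> /peval_projP[_ ->] /peval_projP[].
- move=> /peval_compP[ys /pevalsP[s1 e1] h1] /peval_compP[ys' /pevalsP[s2 e2] h2].
  have e : ys = ys'.
    apply: (@eq_from_nth _ 0); first by rewrite s1 s2.
    by move=> i; rewrite s1 => ig; apply: (IHg i ig xs); [apply: e1|apply: e2].
  by move: h1 h2; rewrite e; apply: IHf.
- case: xs => [|n xs]; first by move/peval_prec_nil.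
  elim: n y y' => [|n IHn] y y'.
    by move=> /peval_prec0P h /peval_prec0P; apply: IHf.
  move=> /peval_precSP[r h1 h2] /peval_precSP[r' h1' h2'].
  by move: h2 h2'; rewrite (IHn _ _ h1 h1'); apply: IHg.
(* At the smaller of two distinct results, [f] would have both the value 0 and a positive value. *)
- move=> /peval_muP[h1 h2] /peval_muP[h1' h2']; case: (ltngtP y y') => // lt.
    by have [v hv] := h2' _ lt; have := IHf _ _ _ h1 hv.
  by have [v hv] := h2 _ lt; have := IHf _ _ _ h1' hv.
Qed.

(** * Cardinalities of countable sets and isomorphism of equivalence structures *)

Section Cardinality.
Variable T : countType.
Implicit Types (A B : T -> Prop) (s : seq T).

Definition size_ge A (k : nat) : Prop :=
  exists s, [/\ uniq s, size s = k & forall x, x \in s -> A x].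

(** Finite lower bounds determine the cardinality because [T] is countable: all infinite subsets are
    equinumerous. *)
Definition equinum A B : Prop := forall k, size_ge A k <-> size_ge B k.

Lemma equinum_refl A : equinum A A. Proof. by []. Qed.

Lemma equinum_sym A B : equinum A B -> equinum B A.
Proof. by move=> h k; split=> /h. Qed.

Lemma equinum_trans A B C : equinum A B -> equinum B C -> equinum A C.
Proof. by move=> h1 h2 k; split=> [/h1/h2|/h2/h1]. Qed.

Lemma size_ge_le A k l : l <= k -> size_ge A k -> size_ge A l.
Proof.
move=> lk [s [us ss sA]]; exists (take l s); split.
- exact: take_uniq.
- by rewrite size_takel ?ss.
- by move=> x /mem_take /sA.
Qed.

Lemma size_ge_seq A s k : uniq s -> (forall x, x \in s <-> A x) ->
  size_ge A k <-> k <= size s.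
Proof.
move=> us sA; split=> [[s' [us' <- s'A]]|h].
  by apply: uniq_leq_size => // x /s'A /sA.
apply: (size_ge_le h); exists s; split=> // x /sA //.
Qed.

Lemma equinum_seq A B s s' : uniq s -> (forall x, x \in s <-> A x) ->
  uniq s' -> (forall x, x \in s' <-> B x) -> equinum A B <-> size s = size s'.
Proof.
move=> us sA us' sB; split=> [h|h k]; last first.
  by rewrite (size_ge_seq _ us sA) (size_ge_seq _ us' sB) h.
apply/eqP; rewrite eqn_leq; apply/andP; split.
  by apply/(size_ge_seq _ us' sB)/h/(size_ge_seq _ us sA).
by apply/(size_ge_seq _ us sA)/h/(size_ge_seq _ us' sB).
Qed.

Lemma size_ge_inj A B (f : T -> T) k :
  (forall x, A x -> B (f x)) -> (forall x y, A x -> A y -> f x = f y -> x = y) ->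
  size_ge A k -> size_ge B k.
Proof.
move=> fAB finj [s [us <- sA]]; exists (map f s); split.
- by rewrite map_inj_in_uniq // => x y /sA ax /sA ay; apply: finj.
- by rewrite size_map.
- by move=> _ /mapP[x /sA /fAB bx ->].
Qed.

Definition below A (n : nat) : seq T :=
  pmap (fun i => if @pickle_inv T i is Some x then
                   if `[<A x>] then Some x else None else None) (iota 0 n).

Lemma mem_below A n x : x \in below A n <-> A x /\ pickle x < n.
Proof.
rewrite /below mem_pmap; split=> [/mapP[i]|[ax xn]].
  rewrite mem_iota /= add0n; have := @pickle_invK T i.
  by case: (pickle_inv i) => //= y yi ii; case: asboolP => // ay [->]; rewrite yi.
apply/mapP; exists (pickle x); first by rewrite mem_iota.
by rewrite pickleK_inv asboolT.
Qed.

Lemma below_uniq A n : uniq (below A n).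
Proof.
apply: (@pmap_uniq _ _ _ pickle); last exact: iota_uniq.
move=> i /=; have := @pickle_invK T i.
by case: (pickle_inv i) => //= y yi; case: asboolP.
Qed.

Definition rank A (x : T) : nat := size (below A (pickle x)).

Lemma rank_lt A x y : A x -> pickle x < pickle y -> rank A x < rank A y.
Proof.
move=> ax xy; rewrite /rank -/(size (x :: below A (pickle x))).
apply: uniq_leq_size.
  rewrite /= below_uniq andbT; apply/negP => /mem_below[_].
  by rewrite ltnn.
move=> z; rewrite inE => /orP[/eqP->|/mem_below[az zx]].
  exact/mem_below.
by apply/mem_below; split=> //; apply: ltn_trans xy.
Qed.

Lemma rank_inj A x y : A x -> A y -> rank A x = rank A y -> x = y.
Proof.
move=> ax ay e; apply: (pcan_inj pickleK); apply/eqP.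
case: ltngtP => // h; first by have := rank_lt ax h; rewrite e ltnn.
by have := rank_lt ay h; rewrite e ltnn.
Qed.

Lemma rank_size_ge A x : A x -> size_ge A (rank A x).+1.
Proof.
move=> ax; exists (x :: below A (pickle x)); split=> //=.
  rewrite below_uniq andbT; apply/negP => /mem_below[_].
  by rewrite ltnn.
by move=> z; rewrite inE => /orP[/eqP->|/mem_below[]].
Qed.

Lemma size_ge_rank A k : size_ge A k.+1 -> exists2 x, A x & rank A x = k.
Proof.
move=> [s [us ss sA]].
have [n kn]: exists n, k < size (below A n).
  exists (\max_(x <- s) pickle x).+1; rewrite -ss.
  apply: uniq_leq_size => // x xs; apply/mem_below; split; first exact: sA.
  by rewrite ltnS (big_rem x) //= leq_maxl.
(* The least bound below which more than [k] elements lie is the successor of the code of the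
   element of rank [k]. *)
have [n' n'P n'min] := ex_minnP (ex_intro (fun n => k < size (below A n)) n kn).
case: n' n'P n'min => [//|m] mP mmin.
have lt : size (below A m) <= k.
  by rewrite leqNgt; apply/negP => /mmin; rewrite ltnn.
have eio : iota 0 m.+1 = iota 0 m ++ [:: m] by rewrite -addn1 iotaD.
move: mP; rewrite /below eio pmap_cat size_cat -/(below A m) /=.
case E: (pickle_inv m) => [x|] /=; last by rewrite addn0 ltnNge lt.
case: asboolP => ax /=; last by rewrite addn0 ltnNge lt.
have <- : pickle x = m by have := @pickle_invK T m; rewrite E.
rewrite addn1 ltnS => h; exists x => //; apply/eqP; rewrite eqn_leq h andbT.
by have := @pickle_invK T m; rewrite E /= /rank => ->.
Qed.

(** Preserving the rank determines the image uniquely, so the transport back is the inverse without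
    any coordination of choices. *)
Definition transport A B (x : T) : T :=
  if pselect (exists2 y, B y & rank B y = rank A x) is left h
  then projT1 (cid2 h) else x.

Lemma transportP A B x : equinum A B -> A x ->
  B (transport A B x) /\ rank B (transport A B x) = rank A x.
Proof.
move=> h ax; rewrite /transport; case: pselect => [e|[]].
  by case: cid2 => y /= by_ e'.
by apply/size_ge_rank/h/rank_size_ge.
Qed.

Lemma transportK A B x : equinum A B -> A x -> transport B A (transport A B x) = x.
Proof.
move=> h ax; have [b1 r1] := transportP h ax.
have [a2 r2] := transportP (equinum_sym h) b1.
by apply: (rank_inj a2 ax); rewrite r2.
Qed.

End Cardinality.

Section EquivIso.
Variable T : countType.

Record equiv_on (D : T -> Prop) (E : T -> T -> Prop) : Prop := EquivOn {
  eq_dom : forall x y, E x y -> D x /\ D y;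
  eq_refl_on : forall x, D x -> E x x;
  eq_sym_on : forall x y, E x y -> E y x;
  eq_trans_on : forall x y z, E x y -> E y z -> E x z }.

Definition transversal_of (D : T -> Prop) (E : T -> T -> Prop) (R : T -> Prop) : Prop :=
  [/\ forall x, R x -> D x,
      forall x, D x -> exists2 r, R r & E x r
    & forall r r', R r -> R r' -> E r r' -> r = r'].

Definition iso_on (D1 D2 : T -> Prop) (E1 E2 : T -> T -> Prop) : Prop :=
  exists (f g : T -> T),
    (forall u, D1 u -> D2 (f u)) /\
    (forall v, D2 v -> D1 (g v)) /\
    (forall u, D1 u -> g (f u) = u) /\
    (forall v, D2 v -> f (g v) = v) /\
    (forall u v, D1 u -> D1 v -> (E1 u v <-> E2 (f u) (f v))).

(** A cardinality is represented by any set [K] that has it, which treats finite and infinite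
    classes alike. *)
Definition reps_like (E : T -> T -> Prop) (R : T -> Prop) (K : T -> Prop) (r : T) : Prop :=
  R r /\ equinum (E r) K.

(** An equality of predicates, not an equivalence, so that it rewrites inside [transport]: the way
    back in [iso_rep_inv] is indexed by the class of the image instead of the class of [r]. *)
Lemma reps_like_eq E R K K' : equinum K K' -> reps_like E R K = reps_like E R K'.
Proof.
move=> h; apply/funext => r; apply/propext; rewrite /reps_like.
split=> -[? h2]; split=> //; first exact: equinum_trans h2 h.
exact: equinum_trans h2 (equinum_sym h).
Qed.

Definition rep_of (E : T -> T -> Prop) (R : T -> Prop) (x : T) : T :=
  if pselect (exists2 r, R r & E x r) is left h then projT1 (cid2 h) else x.

Lemma rep_ofP D E R x : transversal_of D E R -> D x ->
  R (rep_of E R x) /\ E x (rep_of E R x).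
Proof.
move=> [_ h _] /h; rewrite /rep_of; case: pselect => // h' _.
by case: cid2.
Qed.

Lemma rep_of_eq D E R x r : equiv_on D E -> transversal_of D E R -> R r -> E x r ->
  rep_of E R x = r.
Proof.
move=> eqE tr Rr xr; have dx := (eq_dom eqE xr).1.
have [Rr' xr'] := rep_ofP tr dx; case: tr => _ _; apply=> //.
exact: (eq_trans_on eqE (eq_sym_on eqE xr')).
Qed.

Section Build.
Variables (D1 D2 : T -> Prop) (E1 E2 : T -> T -> Prop) (R1 R2 : T -> Prop).
Hypotheses (eq1 : equiv_on D1 E1) (eq2 : equiv_on D2 E2).
Hypotheses (tr1 : transversal_of D1 E1 R1) (tr2 : transversal_of D2 E2 R2).
Hypothesis (cnt : forall K, equinum (reps_like E1 R1 K) (reps_like E2 R2 K)).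

Definition iso_rep r := transport (reps_like E1 R1 (E1 r)) (reps_like E2 R2 (E1 r)) r.

(** Two transports by rank: the class goes to the class whose representative has the same rank among
    those of equal class size, and then its elements are matched by rank. *)
Definition iso_map u :=
  let r := rep_of E1 R1 u in transport (E1 r) (E2 (iso_rep r)) u.

Lemma iso_repP r : R1 r -> R2 (iso_rep r) /\ equinum (E2 (iso_rep r)) (E1 r).
Proof. by move=> rr; have [[]] := transportP (cnt (E1 r)) (conj rr (equinum_refl _)). Qed.

Lemma iso_map_spec u : D1 u -> E2 (iso_rep (rep_of E1 R1 u)) (iso_map u).
Proof.
move=> du; have [rr ur] := rep_ofP tr1 du; have [r2 e2] := iso_repP rr.
by have [] := transportP (equinum_sym e2) (eq_sym_on eq1 ur).
Qed.

End Build.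

Lemma iso_rep_inv D1 D2 E1 E2 R1 R2 r :
  (forall K, equinum (reps_like E1 R1 K) (reps_like E2 R2 K)) ->
  transversal_of D1 E1 R1 -> transversal_of D2 E2 R2 ->
  R1 r -> iso_rep E2 E1 R2 R1 (iso_rep E1 E2 R1 R2 r) = r.
Proof.
move=> cnt tr1 tr2 rr; have [r2 e2] := iso_repP cnt rr.
rewrite {1}/iso_rep (reps_like_eq _ _ e2) (reps_like_eq _ _ e2).
by rewrite /iso_rep transportK //; split.
Qed.

Lemma iso_map_inv D1 D2 E1 E2 R1 R2 u :
  equiv_on D1 E1 -> equiv_on D2 E2 -> transversal_of D1 E1 R1 -> transversal_of D2 E2 R2 ->
  (forall K, equinum (reps_like E1 R1 K) (reps_like E2 R2 K)) ->
  D1 u -> iso_map E2 E1 R2 R1 (iso_map E1 E2 R1 R2 u) = u.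
Proof.
move=> eq1 eq2 tr1 tr2 cnt du.
have h := iso_map_spec eq1 tr1 cnt du; have [rr ur] := rep_ofP tr1 du.
have [r2 e2] := iso_repP cnt rr.
rewrite {1}/iso_map (rep_of_eq eq2 tr2 r2 (eq_sym_on eq2 h)).
rewrite (iso_rep_inv cnt tr1 tr2 rr) /iso_map transportK //.
  exact: equinum_sym.
exact: (eq_sym_on eq1 ur).
Qed.

Lemma iso_of_equinum D1 D2 E1 E2 R1 R2 :
  equiv_on D1 E1 -> equiv_on D2 E2 -> transversal_of D1 E1 R1 -> transversal_of D2 E2 R2 ->
  (forall K, equinum (reps_like E1 R1 K) (reps_like E2 R2 K)) ->
  iso_on D1 D2 E1 E2.
Proof.
move=> eq1 eq2 tr1 tr2 cnt.
have cnt' K : equinum (reps_like E2 R2 K) (reps_like E1 R1 K) by apply: equinum_sym.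
exists (iso_map E1 E2 R1 R2), (iso_map E2 E1 R2 R1).
have fD u : D1 u -> D2 (iso_map E1 E2 R1 R2 u).
  by move=> /(iso_map_spec eq1 tr1 cnt)/(eq_dom eq2)[].
have gD u : D2 u -> D1 (iso_map E2 E1 R2 R1 u).
  by move=> /(iso_map_spec eq2 tr2 cnt')/(eq_dom eq1)[].
split=> //; split=> //.
split; first by move=> u; apply: (iso_map_inv eq1 eq2).
split; first by move=> u; apply: (iso_map_inv eq2 eq1).
move=> u v du dv.
have hu := iso_map_spec eq1 tr1 cnt du; have [rru ur] := rep_ofP tr1 du.
have hv := iso_map_spec eq1 tr1 cnt dv; have [rrv vr] := rep_ofP tr1 dv.
split=> [uv|fuv].
  have e : rep_of E1 R1 u = rep_of E1 R1 v.
    apply: (rep_of_eq eq1 tr1 rrv).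
    exact: (eq_trans_on eq1 uv vr).
  by rewrite e in hu; apply: (eq_trans_on eq2 (eq_sym_on eq2 hu)).
have e : iso_rep E1 E2 R1 R2 (rep_of E1 R1 u) = iso_rep E1 E2 R1 R2 (rep_of E1 R1 v).
  case: (tr2) => _ _; apply; [by case: (iso_repP cnt rru)|by case: (iso_repP cnt rrv)|].
  exact: (eq_trans_on eq2 hu (eq_trans_on eq2 fuv (eq_sym_on eq2 hv))).
have := congr1 (iso_rep E2 E1 R2 R1) e.
rewrite !(iso_rep_inv cnt tr1 tr2) // => e'.
rewrite e' in ur; exact: (eq_trans_on eq1 ur (eq_sym_on eq1 vr)).
Qed.

Lemma equinum_of_iso D1 D2 E1 E2 R1 R2 :
  equiv_on D1 E1 -> equiv_on D2 E2 -> transversal_of D1 E1 R1 -> transversal_of D2 E2 R2 ->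
  iso_on D1 D2 E1 E2 -> forall K, equinum (reps_like E1 R1 K) (reps_like E2 R2 K).
Proof.
have half : forall D1 D2 E1 E2 R1 R2,
  equiv_on D1 E1 -> equiv_on D2 E2 -> transversal_of D1 E1 R1 -> transversal_of D2 E2 R2 ->
  iso_on D1 D2 E1 E2 -> forall K k,
  size_ge (reps_like E1 R1 K) k -> size_ge (reps_like E2 R2 K) k.
  move=> {}D1 {}D2 {}E1 {}E2 {}R1 {}R2 eq1 eq2 tr1 tr2 [f [g [fD [gD [gf [fg fE]]]]]] K k.
  have R1D : forall r, R1 r -> D1 r by case: tr1.
  have R2D : forall r, R2 r -> D2 r by case: tr2.
  (* An isomorphism may miss the chosen representatives, so [f] is followed by the passage to the
     representative of the class. *)
  apply: (@size_ge_inj _ _ _ (fun r => rep_of E2 R2 (f r))).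
    move=> r [Rr rK]; have dr := R1D _ Rr.
    have [rr' e'] := rep_ofP tr2 (fD _ dr); split=> //.
    apply: equinum_trans rK => j; split.
      apply: (@size_ge_inj _ _ _ g) => [x ex|x y ex ey].
        have dx := (eq_dom eq2 ex).2; apply/fE => //; first exact: gD.
        by rewrite fg //; apply: (eq_trans_on eq2 e' ex).
      move=> /(congr1 f); rewrite !fg //; [exact: (eq_dom eq2 ey).2|exact: (eq_dom eq2 ex).2].
    apply: (@size_ge_inj _ _ _ f) => [x ex|x y ex ey].
      have dx := (eq_dom eq1 ex).2.
      by apply: (eq_trans_on eq2 (eq_sym_on eq2 e')); apply/fE.
    move=> /(congr1 g); rewrite !gf //; [exact: (eq_dom eq1 ey).2|exact: (eq_dom eq1 ex).2].
  move=> r r' [Rr _] [Rr' _] e.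
  have dr := R1D _ Rr; have dr' := R1D _ Rr'.
  have [_ e1] := rep_ofP tr2 (fD _ dr); have [_ e2] := rep_ofP tr2 (fD _ dr').
  case: tr1 => _ _; apply=> //; apply/fE => //.
  by rewrite e in e1; apply: (eq_trans_on eq2 e1 (eq_sym_on eq2 e2)).
move=> eq1 eq2 tr1 tr2 iso K k; split; first exact: (half D1 D2 E1 E2).
apply: (half D2 D1 E2 E1) => //.
case: iso => [f [g [fD [gD [gf [fg fE]]]]]]; exists g, f.
split=> //; split=> //; split=> //; split=> // u v du dv.
by have := fE _ _ (gD u du) (gD v dv); rewrite !fg // => h; split=> /h.
Qed.

End EquivIso.

(** * Computable functions on coded data *)

Section Total.
Implicit Types (F G H : seq nat -> nat) (xs : seq nat).

Definition totk (k : nat) F : Prop :=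
  exists p, forall xs, size xs = k -> peval p xs (F xs).

Lemma totk_ext k F G : (forall xs, size xs = k -> F xs = G xs) -> totk k F -> totk k G.
Proof. by move=> e [p hp]; exists p => xs s; rewrite -e //; apply: hp. Qed.

Lemma totk_proj k i : i < k -> totk k (fun xs => nth 0 xs i).
Proof. by move=> ik; exists (PProj i) => xs s; apply: ev_proj; rewrite s. Qed.

Lemma totk_head : totk 1 (nth 0 ^~ 0).
Proof. exact: totk_proj. Qed.

(** [PComp] evaluates all its arguments on the same input list, so composition of total functions
    stays within a fixed arity [k]. *)
Lemma totk_comp1 k F G : totk 1 F -> totk k G -> totk k (fun xs => F [:: G xs]).
Proof.
move=> [p hp] [q hq]; exists (PComp p [:: q]) => xs s.
apply: ev_comp; last exact: hp.
by do 1!(apply: evs_cons; first by [exact: hq]); apply: evs_nil.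
Qed.

Lemma totk_comp2 k F G H : totk 2 F -> totk k G -> totk k H ->
  totk k (fun xs => F [:: G xs; H xs]).
Proof.
move=> [p hp] [q hq] [r hr]; exists (PComp p [:: q; r]) => xs s.
apply: ev_comp; last exact: hp.
by do 2!(apply: evs_cons; first by [exact: hq|exact: hr]); apply: evs_nil.
Qed.

Lemma totk_zero k : totk k (fun=> 0).
Proof. by exists PZero => xs _; apply: ev_zero. Qed.

Lemma totk_succ : totk 1 (fun xs => (nth 0 xs 0).+1).
Proof. by exists PSucc => [[|x []]] // _; apply: ev_succ. Qed.

Lemma totk_const k c : totk k (fun=> c).
Proof.
elim: c => [|c IH]; first exact: totk_zero.
exact: (totk_comp1 totk_succ IH).
Qed.

Lemma totk_prec k F G : totk k F -> totk k.+2 G ->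
  totk k.+1 (fun xs => nat_rect (fun=> nat) (F (behead xs))
               (fun n r => G (n :: r :: behead xs)) (head 0 xs)).
Proof.
move=> [p hp] [q hq]; exists (PPrec p q) => [[|n xs]] // [s] /=.
elim: n => [|n IH] /=; first by apply: ev_prec0; apply: hp.
by apply: ev_precS; [exact: IH | apply: hq; rewrite /= s].
Qed.

Definition tot1 (F : nat -> nat) := totk 1 (fun xs => F (nth 0 xs 0)).
Definition tot2 (F : nat -> nat -> nat) := totk 2 (fun xs => F (nth 0 xs 0) (nth 0 xs 1)).
Definition tot3 (F : nat -> nat -> nat -> nat) :=
  totk 3 (fun xs => F (nth 0 xs 0) (nth 0 xs 1) (nth 0 xs 2)).

Lemma totk_tot1 k f G : tot1 f -> totk k G -> totk k (fun xs => f (G xs)).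
Proof. by move=> hf hG; have := totk_comp1 hf hG. Qed.

Lemma totk_tot2 k f G H : tot2 f -> totk k G -> totk k H -> totk k (fun xs => f (G xs) (H xs)).
Proof. by move=> hf hG hH; have := totk_comp2 hf hG hH. Qed.

Lemma tot2_prec f g : tot1 f -> tot3 g ->
  tot2 (fun n x => nat_rect (fun=> nat) (f x) (fun n r => g n r x) n).
Proof.
by move=> hf hg; apply: totk_ext (totk_prec hf hg) => -[|n [|x []]].
Qed.

End Total.

(** * Coding of lists by numbers *)

Definition stepo (c : nat) : nat := if odd c then c else c./2.
Definition oddpart_iter (i c : nat) : nat := nat_rect (fun=> nat) c (fun _ r => stepo r) i.
(** The exponent of 2 in [c], found by counting the even iterates of [stepo]; [c] iterations suffice
    because the exponent is smaller than [c]. *)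
Definition hd (c : nat) : nat :=
  nat_rect (fun=> nat) 0 (fun n r => r + (1 - odd (oddpart_iter n c))) c.
Definition tl (c : nat) : nat := (oddpart_iter c c)./2.
(** The same coding as [CodeSeq.code], with 0 for the empty list; this is what makes the codes below
    agree with [pickle]. *)
Definition cns (x c : nat) : nat := 2 ^ x * c.*2.+1.

Ltac totk_tac := rewrite ?/tot1 ?/tot3; repeat first
  [ exact: totk_const | by apply: totk_proj
  | match goal with H : tot2 ?f |- totk _ (fun xs => ?f _ _) => apply: (totk_tot2 H) end
  | match goal with H : tot1 ?f |- totk _ (fun xs => ?f _) => apply: (totk_tot1 H) end ].

Lemma tot_succ : tot1 S. Proof. exact: totk_succ. Qed.

Lemma tot_add : tot2 addn.
Proof.
have s := tot_succ.
have h := @tot2_prec id (fun n r x => r.+1); apply: totk_ext (h _ _).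
- by move=> [|n [|x []]] //= _; elim: n => //= n ->.
- by totk_tac.
- by rewrite /tot3; apply: (totk_tot1 s); totk_tac.
Qed.

Lemma tot_pred : tot1 predn.
Proof.
have h : tot2 (fun n x => nat_rect (fun=> nat) 0 (fun n r => n) n).
  by apply: (@tot2_prec (fun=> 0) (fun n r x => n)); totk_tac.
by apply: totk_ext (totk_tot2 h totk_head totk_head) => -[|[|n] []].
Qed.

Lemma tot_swap F : tot2 F -> tot2 (fun x y => F y x).
Proof. by move=> h; apply: (totk_tot2 h); totk_tac. Qed.

Lemma tot_sub : tot2 subn.
Proof.
have s := tot_pred.
apply: (tot_swap (F := fun x y => y - x)).
have h := @tot2_prec id (fun n r x => r.-1); apply: totk_ext (h _ _).
- by move=> [|n [|x []]] //= _; elim: n => [|n IH] /=; [rewrite subn0|rewrite IH subnS].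
- by totk_tac.
- by rewrite /tot3; apply: (totk_tot1 s); totk_tac.
Qed.

Lemma tot_mul : tot2 muln.
Proof.
have s := tot_add.
have h := @tot2_prec (fun=> 0) (fun n r x => x + r); apply: totk_ext (h _ _).
- by move=> [|n [|x []]] //= _; elim: n => [|n IH] //=; rewrite IH mulSn.
- by totk_tac.
- by rewrite /tot3; totk_tac.
Qed.

Lemma tot_exp : tot2 expn.
Proof.
have s := tot_mul; apply: (tot_swap (F := fun x y => y ^ x)).
have h := @tot2_prec (fun=> 1) (fun n r x => x * r); apply: totk_ext (h _ _).
- by move=> [|n [|x []]] //= _; elim: n => [|n IH] //=; rewrite IH expnS.
- by totk_tac.
- by rewrite /tot3; totk_tac.
Qed.

Lemma tot_odd : tot1 (fun n => odd n : nat).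
Proof.
have s := tot_sub.
have h : tot2 (fun n x => nat_rect (fun=> nat) 0 (fun n r => 1 - r) n).
  by apply: (@tot2_prec (fun=> 0) (fun n r x => 1 - r)); totk_tac.
apply: totk_ext (totk_tot2 h totk_head totk_head) => -[|n []] //= _.
by elim: n => //= n ->; case: odd.
Qed.

Lemma tot_half : tot1 half.
Proof.
have s := tot_add; have o := tot_odd.
have h : tot2 (fun n x => nat_rect (fun=> nat) 0 (fun n r => r + odd n) n).
  apply: (@tot2_prec (fun=> 0) (fun n r x => r + odd n)); first by totk_tac.
  by apply: (totk_tot2 s); [totk_tac | apply: (totk_tot1 o); totk_tac].
apply: totk_ext (totk_tot2 h totk_head totk_head) => -[|n []] //= _.
by elim: n => //= n ->; rewrite uphalf_half addnC.
Qed.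

Lemma tot_if0 : tot3 (fun b x y => if b == 0 then y else x).
Proof.
have s := tot_add; have m := tot_mul; have sb := tot_sub.
have h : tot3 (fun b x y => (1 - b) * y + (1 - (1 - b)) * x) by rewrite /tot3; totk_tac.
apply: totk_ext h => xs _; case: (nth 0 xs 0) => [|b]; first by rewrite /= mul1n addn0.
by rewrite subSS sub0n mul0n mul1n.
Qed.

Lemma totk_tot3 k f G H I : tot3 f -> totk k G -> totk k H -> totk k I ->
  totk k (fun xs => f (G xs) (H xs) (I xs)).
Proof.
move=> [p hp] [q hq] [r hr] [t ht]; exists (PComp p [:: q; r; t]) => xs s.
apply: ev_comp; last by have := hp [:: G xs; H xs; I xs]; apply.
by do 3!(apply: evs_cons; first by [exact: hq|exact: hr|exact: ht]); apply: evs_nil.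
Qed.

Lemma tot_oddpart : tot2 oddpart_iter.
Proof.
apply: (@tot2_prec id (fun n r x => stepo r)); first by totk_tac.
rewrite /tot3; have h : tot1 stepo.
  have i := tot_if0; have o := tot_odd; have hf := tot_half.
    apply: totk_ext (totk_tot3 i (totk_tot1 o totk_head) totk_head (totk_tot1 hf totk_head)) => xs _.
  by rewrite /stepo; case: odd.
by apply: (totk_tot1 h); totk_tac.
Qed.

Lemma tot_hd : tot1 hd.
Proof.
have s := tot_add; have o := tot_odd; have sb := tot_sub; have op := tot_oddpart.
have h : tot2 (fun n x => nat_rect (fun=> nat) 0 (fun n r => r + (1 - odd (oddpart_iter n x))) n).
  apply: (@tot2_prec (fun=> 0) (fun n r x => r + (1 - odd (oddpart_iter n x)))).
    by totk_tac.
  rewrite /tot3; apply: (totk_tot2 s); first by totk_tac.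
  apply: (totk_tot2 sb); first by totk_tac.
  by apply: (totk_tot1 o); totk_tac.
exact: (totk_tot2 h totk_head totk_head).
Qed.

Lemma tot_tl : tot1 tl.
Proof.
have h := tot_half; have op := tot_oddpart; rewrite /tot1 /tl.
by apply: (totk_tot1 h); totk_tac.
Qed.

Lemma tot_cns : tot2 cns.
Proof.
have s := tot_succ; have m := tot_mul; have e := tot_exp.
have h : tot2 (fun x c => 2 ^ x * (2 * c).+1).
  rewrite /tot2; apply: (totk_tot2 m); first by totk_tac.
  by apply: (totk_tot1 s); totk_tac.
by apply: totk_ext h => xs _; rewrite mul2n.
Qed.

Lemma oddpart_iterE i x c : oddpart_iter i (cns x c) = 2 ^ (x - i) * c.*2.+1.
Proof.
elim: i => [|i IH] /=; first by rewrite subn0.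
rewrite {}IH subnS /stepo; case: (x - i) => [|m]; first by rewrite expn0 mul1n oddS odd_double.
by rewrite expnS -mulnA oddM /= mul2n doubleK.
Qed.

Lemma ltn_cns x c : x < cns x c.
Proof. by apply: leq_trans (ltn_expl x (ltnSn 1)) _; rewrite leq_pmulr. Qed.

Lemma hd_cns x c : hd (cns x c) = x.
Proof.
rewrite /hd; have: forall n, nat_rect (fun=> nat) 0
   (fun n r => r + (1 - odd (oddpart_iter n (cns x c)))) n = minn n x.
  elim=> [|n IH] /=; first by rewrite min0n.
  rewrite IH oddpart_iterE; case: (ltnP n x) => h.
    have -> : x - n = (x - n).-1.+1 by lia.
    rewrite expnS -mulnA oddM /=; lia.
  by rewrite (eqP h) mul1n /= odd_double /=; lia.
by move->; apply/minn_idPr/ltnW/ltn_cns.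
Qed.

Lemma tl_cns x c : tl (cns x c) = c.
Proof.
rewrite /tl oddpart_iterE; have := ltn_cns x c; move=> /ltnW/eqP ->.
by rewrite mul1n /= uphalf_double.
Qed.

(** * Computable functions between coded types *)

Class code (T : Type) := Code { cd : T -> nat; cd_inj : injective cd }.

#[export] Instance code_nat : code nat := {| cd := id; cd_inj := @inj_id nat |}.

Lemma cd_bool_inj : injective nat_of_bool. Proof. by case=> [] []. Qed.
#[export] Instance code_bool : code bool := {| cd := nat_of_bool; cd_inj := cd_bool_inj |}.

Section CodeTypes.
Context {A B : Type} {cA : code A} {cB : code B}.

Definition cd_prod (x : A * B) : nat := cns (cd x.1) (cns (cd x.2) 0).
Lemma cd_prod_inj : injective cd_prod.
Proof.
move=> [a b] [a' b'] /= e; have e1 := congr1 hd e; have e2 := congr1 (hd \o tl) e.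
move: e1 e2; rewrite /cd_prod /= !(tl_cns, hd_cns) => e1 e2.
by rewrite (@cd_inj A _ _ _ e1) (@cd_inj B _ _ _ e2).
Qed.

Definition cd_seq (s : seq A) : nat := foldr (fun x c => cns (cd x) c) 0 s.
Lemma cns_neq0 x c : cns x c = (cns x c).-1.+1.
Proof. by rewrite prednK // (leq_ltn_trans _ (ltn_cns x c)). Qed.
Lemma cd_seq_inj : injective cd_seq.
Proof.
elim=> [|x s IH] [|y t] //=; [by rewrite cns_neq0|by rewrite cns_neq0|].
move=> e; have := congr1 hd e; have := congr1 tl e.
by rewrite !(tl_cns, hd_cns) => /IH-> /(@cd_inj A)->.
Qed.
End CodeTypes.

#[export] Instance code_prod A B (cA : code A) (cB : code B) : code (A * B)%type :=
  {| cd := cd_prod; cd_inj := cd_prod_inj |}.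
#[export] Instance code_seq A (cA : code A) : code (seq A) :=
  {| cd := cd_seq; cd_inj := cd_seq_inj |}.

(* The tracking function is total on all numbers, including those that code nothing, so that
   branching can be strict. *)
Definition cmp {A B : Type} {cA : code A} {cB : code B} (f : A -> B) : Prop :=
  exists2 F, tot1 F & forall a, F (cd a) = cd (f a).

Section Closure.
Context {X : Type} {cX : code X}.

Lemma cmp_ext A (cA : code A) (f g : X -> A) : f =1 g -> cmp f -> cmp g.
Proof. by move=> e [F tF hF]; exists F => // x; rewrite hF e. Qed.

Lemma tot1_comp F G : tot1 F -> tot1 G -> tot1 (fun x => F (G x)).
Proof. by move=> h1 h2; apply: (totk_tot1 h1). Qed.

Lemma tot1_comp2 F G H : tot2 F -> tot1 G -> tot1 H -> tot1 (fun x => F (G x) (H x)).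
Proof. by move=> h1 h2 h3; apply: (totk_tot2 h1). Qed.

Lemma cmp_comp A B (cA : code A) (cB : code B) (f : A -> B) (g : X -> A) :
  cmp f -> cmp g -> cmp (fun x => f (g x)).
Proof.
move=> [F tF hF] [G tG hG]; exists (fun n => F (G n)); first exact: tot1_comp.
by move=> x; rewrite hG hF.
Qed.

Lemma cmp_id : cmp (fun x : X => x).
Proof. by exists id => //; rewrite /tot1; totk_tac. Qed.

Lemma cmp_const A (cA : code A) (c : A) : cmp (fun _ : X => c).
Proof. by exists (fun=> cd c) => //; rewrite /tot1; totk_tac. Qed.

Lemma cmp_pair A B (cA : code A) (cB : code B) (f : X -> A) (g : X -> B) :
  cmp f -> cmp g -> cmp (fun x => (f x, g x)).
Proof.
move=> [F tF hF] [G tG hG]; exists (fun n => cns (F n) (cns (G n) 0)).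
  apply: (tot1_comp2 tot_cns tF); apply: (tot1_comp2 tot_cns tG).
  by totk_tac.
by move=> x; rewrite hF hG.
Qed.

Lemma cmp_fst A B (cA : code A) (cB : code B) (f : X -> A * B) :
  cmp f -> cmp (fun x => (f x).1).
Proof.
move=> [F tF hF]; exists (fun n => hd (F n)); first exact: (tot1_comp tot_hd).
by move=> x; rewrite hF hd_cns.
Qed.

Lemma cmp_snd A B (cA : code A) (cB : code B) (f : X -> A * B) :
  cmp f -> cmp (fun x => (f x).2).
Proof.
move=> [F tF hF]; exists (fun n => hd (tl (F n))).
  exact: (tot1_comp tot_hd (tot1_comp tot_tl tF)).
by move=> x; rewrite hF tl_cns hd_cns.
Qed.

Lemma cmp_nat2 F (f g : X -> nat) : tot2 F -> cmp f -> cmp g -> cmp (fun x => F (f x) (g x)).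
Proof.
move=> tF [G tG hG] [H tH hH]; exists (fun n => F (G n) (H n)); first exact: tot1_comp2.
by move=> x; rewrite hG hH.
Qed.

Lemma cmp_succ (f : X -> nat) : cmp f -> cmp (fun x => (f x).+1).
Proof.
move=> [G tG hG]; exists (fun n => (G n).+1); first exact: (tot1_comp tot_succ).
by move=> x; rewrite hG.
Qed.
Definition cmp_add f g := @cmp_nat2 addn f g tot_add.
Definition cmp_sub f g := @cmp_nat2 subn f g tot_sub.
Definition cmp_mul f g := @cmp_nat2 muln f g tot_mul.
Definition cmp_exp f g := @cmp_nat2 expn f g tot_exp.

Lemma cmp_if A (cA : code A) (b : X -> bool) (f g : X -> A) :
  cmp b -> cmp f -> cmp g -> cmp (fun x => if b x then f x else g x).
Proof.
move=> [B tB hB] [F tF hF] [G tG hG]; exists (fun n => if B n == 0 then G n else F n).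
  exact: (totk_tot3 tot_if0 tB tF tG).
by move=> x; rewrite hB hF hG; case: (b x).
Qed.

Lemma cmp_eq0 (f : X -> nat) : cmp f -> cmp (fun x => f x == 0).
Proof.
move=> [F tF hF]; exists (fun n => 1 - F n).
  by apply: (tot1_comp2 tot_sub) => //; rewrite /tot1; totk_tac.
by move=> x; rewrite hF; case: (f x).
Qed.

Lemma cmp_leq (f g : X -> nat) : cmp f -> cmp g -> cmp (fun x => f x <= g x).
Proof. by move=> hf hg; apply/cmp_eq0/cmp_sub. Qed.

Lemma cmp_and (f g : X -> bool) : cmp f -> cmp g -> cmp (fun x => f x && g x).
Proof. by move=> hf hg; apply: cmp_if => //; apply: cmp_const. Qed.

Lemma cmp_or (f g : X -> bool) : cmp f -> cmp g -> cmp (fun x => f x || g x).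
Proof. by move=> hf hg; apply: cmp_if => //; apply: cmp_const. Qed.

Lemma cmp_imp (f g : X -> bool) : cmp f -> cmp g -> cmp (fun x => f x ==> g x).
Proof. by move=> hf hg; apply: cmp_if => //; apply: cmp_const. Qed.

Lemma cmp_eq (A : eqType) (cA : code A) (f g : X -> A) :
  cmp f -> cmp g -> cmp (fun x => f x == g x).
Proof.
move=> [F tF hF] [G tG hG].
have hc (h : X -> A) H : tot1 H -> (forall x, H (cd x) = cd (h x)) -> cmp (fun x => cd (h x)).
  by move=> tH hH; exists H.
apply: (@cmp_ext _ _ (fun x => (cd (f x) <= cd (g x)) && (cd (g x) <= cd (f x)))).
  by move=> x; rewrite -eqn_leq; apply/eqP/eqP => [/(@cd_inj A)|->].
have cf := hc f F tF hF; have cg := hc g G tG hG.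
by apply: cmp_and; apply: cmp_leq.
Qed.

Lemma cmp_max (f g : X -> nat) : cmp f -> cmp g -> cmp (fun x => maxn (f x) (g x)).
Proof.
move=> hf hg; apply: (@cmp_ext _ _ (fun x => f x + (g x - f x))) => [x|].
  by rewrite maxnE.
by apply: cmp_add => //; apply: cmp_sub.
Qed.

Lemma cmp_cons A (cA : code A) (f : X -> A) (g : X -> seq A) :
  cmp f -> cmp g -> cmp (fun x => f x :: g x).
Proof.
move=> [F tF hF] [G tG hG]; exists (fun n => cns (F n) (G n)).
  exact: (tot1_comp2 tot_cns tF tG).
by move=> x; rewrite hF hG.
Qed.

Lemma cmp_behead A (cA : code A) (f : X -> seq A) : cmp f -> cmp (fun x => behead (f x)).
Proof.
move=> [F tF hF]; exists (fun n => tl (F n)); first exact: (tot1_comp tot_tl).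
by move=> x; rewrite hF; case: (f x) => //= y s; rewrite tl_cns.
Qed.

Lemma cmp_iter B (cB : code B) (g : X -> B -> B) (n : X -> nat) (z : X -> B) :
  cmp (fun p : X * B => g p.1 p.2) -> cmp n -> cmp z ->
  cmp (fun x => iter (n x) (g x) (z x)).
Proof.
move=> [G tG hG] [N tN hN] [Z tZ hZ].
pose it m y := nat_rect (fun=> nat) (Z y) (fun _ r => G (cns y (cns r 0))) m.
exists (fun y => it (N y) y).
  apply: (tot1_comp2 _ tN); last by totk_tac.
  apply: (@tot2_prec Z (fun _ r y => G (cns y (cns r 0)))) => //.
  rewrite /tot3; apply: (totk_tot1 tG); have c := tot_cns; by totk_tac.
move=> x; rewrite hN /=; elim: (n x) => [|m IH] /=; first by rewrite hZ.
by rewrite IH; apply: (hG (x, iter m (g x) (z x))).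
Qed.

Lemma cmp_foldl A B (cA : code A) (cB : code B) (g : X -> B -> A -> B) (z : X -> B)
    (s : X -> seq A) :
  cmp (fun p : X * (B * A) => g p.1 p.2.1 p.2.2) -> cmp z -> cmp s ->
  cmp (fun x => foldl (g x) (z x) (s x)).
Proof.
move=> [G tG hG] [Z tZ hZ] [S tS hS].
(* the state is the pair (remaining list, accumulator); a code bounds the length of its list *)
pose st y r := if hd r == 0 then r
  else cns (tl (hd r)) (cns (G (cns y (cns (cns (hd (tl r)) (cns (hd (hd r)) 0)) 0))) 0).
pose it m y := nat_rect (fun=> nat) (cns (S y) (cns (Z y) 0)) (fun _ r => st y r) m.
exists (fun y => hd (tl (it (S y) y))).
  apply/(tot1_comp tot_hd)/(tot1_comp tot_tl)/(tot1_comp2 _ tS); last by totk_tac.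
  have c := tot_cns; have h := tot_hd; have t := tot_tl.
  apply: (@tot2_prec (fun y => cns (S y) (cns (Z y) 0)) (fun _ r y => st y r)).
    rewrite /tot1; apply: (totk_tot2 c) => //; apply: (totk_tot2 c) => //; exact: totk_const.
  pose next y r := cns (tl (hd r)) (cns (G (cns y (cns (cns (hd (tl r)) (cns (hd (hd r)) 0)) 0))) 0).
  rewrite /tot3 /st; apply: (@totk_tot3 3 (fun b x y => if b == 0 then y else x)
     (fun xs => hd (nth 0 xs 1)) (fun xs => next (nth 0 xs 2) (nth 0 xs 1)) (nth 0 ^~ 1) tot_if0).
  - by totk_tac.
  - apply: (totk_tot2 c); first by totk_tac.
    apply: (totk_tot2 c); last by totk_tac.
    apply: (totk_tot1 tG); apply: (totk_tot2 c); first by totk_tac.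
    by totk_tac.
  - by totk_tac.
move=> x; rewrite hS.
have st0 b : st (cd x) (cns 0 (cns b 0)) = cns 0 (cns b 0) by rewrite /st hd_cns.
(* Once the list is exhausted the state is fixed by [st0], so iterating more often than the length
   of the list does no harm. *)
have itE n m (l : seq A) (b : B) : it n (cd x) = cns (cd l) (cns (cd b) 0) -> size l <= m ->
    it (n + m) (cd x) = cns 0 (cns (cd (foldl (g x) b l)) 0).
  elim: m l b n => [|m IH] [|a l] b n e //= lm.
  - by rewrite addn0 e.
  - rewrite addnS /= (IH [::] b n e) //.
  - rewrite addnS -addSn; apply: IH lm; rewrite /= e /st hd_cns.
    rewrite [cd (a :: l)]/= (cns_neq0 (cd a)) /= -(cns_neq0 (cd a)).
    rewrite !(tl_cns, hd_cns).
    by have := hG (x, (b, a)) => /= <-.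
rewrite -[X in it X _]add0n (itE _ _ (s x) (z x)) ?tl_cns ?hd_cns //; first by rewrite /= hS hZ.
elim: (s x) => //= a l IH; apply: leq_trans (_ : cd l < _) => //.
rewrite /cns -[(cd l).+1]mul1n; apply: leq_mul; first by rewrite expn_gt0.
by rewrite ltnS -addnn leq_addr.
Qed.

Lemma cmp_case A B (cA : code A) (cB : code B) (s : X -> seq A) (f : X -> B) (g : X -> A -> seq A -> B) :
  cmp s -> cmp f -> cmp (fun p : X * (A * seq A) => g p.1 p.2.1 p.2.2) ->
  cmp (fun x => if s x is a :: l then g x a l else f x).
Proof.
move=> [S tS hS] [F tF hF] [G tG hG].
exists (fun n => if S n == 0 then F n
                 else G (cns n (cns (cns (hd (S n)) (cns (tl (S n)) 0)) 0))).
  pose next n := G (cns n (cns (cns (hd (S n)) (cns (tl (S n)) 0)) 0)).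
  apply: (@totk_tot3 1 (fun b x y => if b == 0 then y else x) _
    (fun xs => next (nth 0 xs 0)) _ tot_if0) => //.
  have c := tot_cns; have h := tot_hd; have t := tot_tl.
  apply: (totk_tot1 tG); apply: (totk_tot2 c); first by totk_tac.
  by totk_tac.
move=> x; rewrite hS hF; case: (s x) => [|a l] //=.
rewrite (cns_neq0 (cd a)) /= -(cns_neq0 (cd a)) hd_cns tl_cns.
by have := hG (x, (a, l)).
Qed.

End Closure.

Section ListClosure.
Context {X : Type} {cX : code X}.
Context {A B : Type} {cA : code A} {cB : code B}.

Lemma cmp_rev (s : X -> seq A) : cmp s -> cmp (fun x => rev (s x)).
Proof.
move=> hs; apply: (@cmp_ext _ _ _ _ (fun x => foldl (fun l a => a :: l) [::] (s x))).
  move=> x; rewrite /rev; elim: (s x) [::] => //=.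
apply: (@cmp_foldl _ _ _ _ _ _ (fun _ l a => a :: l)) => //; last exact: cmp_const.
by apply: cmp_cons; [apply: cmp_snd; apply: cmp_snd|apply: cmp_fst; apply: cmp_snd];
  apply: cmp_id.
Qed.

Lemma cmp_foldr (g : X -> A -> B -> B) (z : X -> B) (s : X -> seq A) :
  cmp (fun p : X * (A * B) => g p.1 p.2.1 p.2.2) -> cmp z -> cmp s ->
  cmp (fun x => foldr (g x) (z x) (s x)).
Proof.
move=> hg hz hs; apply: (@cmp_ext _ _ _ _ (fun x => foldl (fun b a => g x a b) (z x) (rev (s x)))).
  by move=> x; rewrite foldl_rev.
apply: (@cmp_foldl _ _ _ _ _ _ (fun x b a => g x a b)) => //; last exact: cmp_rev.
apply: (@cmp_comp _ _ _ _ _ _ (fun p : X * (A * B) => g p.1 p.2.1 p.2.2)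
          (fun p : X * (B * A) => (p.1, (p.2.2, p.2.1)))) => //.
have i := @cmp_id (X * (B * A))%type _.
apply: cmp_pair; first exact: cmp_fst.
by apply: cmp_pair; [apply: cmp_snd|apply: cmp_fst]; apply: cmp_snd.
Qed.

End ListClosure.

Section ListOps.
Context {X : Type} {cX : code X}.
Context {A B : Type} {cA : code A} {cB : code B}.

Lemma cmp_p1 (C : Type) (cC : code C) : cmp (fun p : X * C => p.1).
Proof. by apply: cmp_fst; apply: cmp_id. Qed.
Lemma cmp_p21 (C D : Type) (cC : code C) (cD : code D) : cmp (fun p : X * (C * D) => p.2.1).
Proof. by do 1!(apply: cmp_fst; apply: cmp_snd); apply: cmp_id. Qed.
Lemma cmp_p22 (C D : Type) (cC : code C) (cD : code D) : cmp (fun p : X * (C * D) => p.2.2).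
Proof. by do 2!apply: cmp_snd; apply: cmp_id. Qed.
Lemma cmp_w (D E : Type) (cD : code D) (cE : code E) (f : X -> A -> E) :
  cmp (fun p : X * A => f p.1 p.2) -> cmp (fun p : X * (A * D) => f p.1 p.2.1).
Proof.
move=> hf; apply: (@cmp_comp _ _ _ _ _ _ (fun p : X * A => f p.1 p.2)
   (fun p : X * (A * D) => (p.1, p.2.1))) => //.
by apply: cmp_pair; [exact: cmp_p1|exact: cmp_p21].
Qed.

Lemma cmp_map (f : X -> A -> B) (s : X -> seq A) :
  cmp (fun p : X * A => f p.1 p.2) -> cmp s -> cmp (fun x => map (f x) (s x)).
Proof.
move=> hf hs; apply: (@cmp_ext _ _ _ _ (fun x => foldr (fun a l => f x a :: l) [::] (s x))).
  by move=> x; elim: (s x) => //= a l ->.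
apply: (@cmp_foldr _ _ _ _ _ _ (fun x a l => f x a :: l)) => //; last exact: cmp_const.
by apply: cmp_cons; [exact: (cmp_w _ hf)|exact: cmp_p22].
Qed.

Lemma cmp_filter (f : X -> A -> bool) (s : X -> seq A) :
  cmp (fun p : X * A => f p.1 p.2) -> cmp s -> cmp (fun x => filter (f x) (s x)).
Proof.
move=> hf hs; apply: (@cmp_ext _ _ _ _ (fun x => foldr (fun a l => if f x a then a :: l else l) [::] (s x))).
  by move=> x; elim: (s x) => //= a l ->.
apply: (@cmp_foldr _ _ _ _ _ _ (fun x a l => if f x a then a :: l else l)) => //; last exact: cmp_const.
apply: cmp_if; first exact: (cmp_w _ hf); last exact: cmp_p22.
by apply: cmp_cons; [exact: cmp_p21|exact: cmp_p22].
Qed.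

Lemma cmp_has (f : X -> A -> bool) (s : X -> seq A) :
  cmp (fun p : X * A => f p.1 p.2) -> cmp s -> cmp (fun x => has (f x) (s x)).
Proof.
move=> hf hs; apply: (@cmp_ext _ _ _ _ (fun x => foldr (fun a l => f x a || l) false (s x))).
  by move=> x; elim: (s x) => //= a l ->.
apply: (@cmp_foldr _ _ _ _ _ _ (fun x a l => f x a || l)) => //; last exact: cmp_const.
by apply: cmp_or; [exact: (cmp_w _ hf)|exact: cmp_p22].
Qed.

Lemma cmp_all (f : X -> A -> bool) (s : X -> seq A) :
  cmp (fun p : X * A => f p.1 p.2) -> cmp s -> cmp (fun x => all (f x) (s x)).
Proof.
move=> hf hs; apply: (@cmp_ext _ _ _ _ (fun x => foldr (fun a l => f x a && l) true (s x))).
  by move=> x; elim: (s x) => //= a l ->.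
apply: (@cmp_foldr _ _ _ _ _ _ (fun x a l => f x a && l)) => //; last exact: cmp_const.
by apply: cmp_and; [exact: (cmp_w _ hf)|exact: cmp_p22].
Qed.

Lemma cmp_cat (s t : X -> seq A) : cmp s -> cmp t -> cmp (fun x => s x ++ t x).
Proof.
move=> hs ht; apply: (@cmp_ext _ _ _ _ (fun x => foldr cons (t x) (s x))).
  by move=> x; elim: (s x) => //= a l ->.
apply: (@cmp_foldr _ _ _ _ _ _ (fun x a l => a :: l)) => //.
by apply: cmp_cons; [exact: cmp_p21|exact: cmp_p22].
Qed.

Lemma cmp_rcons (s : X -> seq A) (t : X -> A) : cmp s -> cmp t -> cmp (fun x => rcons (s x) (t x)).
Proof.
move=> hs ht; apply: (@cmp_ext _ _ _ _ (fun x => s x ++ [:: t x])).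
  by move=> x; rewrite cats1.
by apply: cmp_cat => //; apply: cmp_cons => //; apply: cmp_const.
Qed.

Lemma cmp_size (s : X -> seq A) : cmp s -> cmp (fun x => size (s x)).
Proof.
move=> hs; apply: (@cmp_ext _ _ _ _ (fun x => foldr (fun _ n => n.+1) 0 (s x))).
  by move=> x; elim: (s x) => //= a l ->.
apply: (@cmp_foldr _ _ _ _ _ _ (fun x a l => l.+1)) => //; last exact: cmp_const.
by apply: cmp_succ; exact: cmp_p22.
Qed.

Lemma cmp_head (z : X -> A) (s : X -> seq A) : cmp z -> cmp s -> cmp (fun x => head (z x) (s x)).
Proof.
move=> hz hs; apply: (@cmp_case _ _ _ _ _ _ s z (fun _ a _ => a)) => //.
exact: cmp_p21.
Qed.

Lemma cmp_nth (z : X -> A) (s : X -> seq A) (n : X -> nat) :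
  cmp z -> cmp s -> cmp n -> cmp (fun x => nth (z x) (s x) (n x)).
Proof.
move=> hz hs hn; apply: (@cmp_ext _ _ _ _ (fun x => head (z x) (iter (n x) behead (s x)))).
  by move=> x; rewrite -nth0; elim: (n x) (s x) => // m IH [|a l];
     rewrite iterSr /= IH ?nth_nil.
apply: cmp_head => //; apply: (@cmp_iter _ _ _ _ (fun _ => behead)) => //.
by apply: cmp_behead; apply: cmp_snd; apply: cmp_id.
Qed.

End ListOps.

Section MoreOps.
Context {X : Type} {cX : code X}.

Lemma cmp_flatten (A : Type) (cA : code A) (s : X -> seq (seq A)) : cmp s -> cmp (fun x => flatten (s x)).
Proof.
move=> hs; apply: (@cmp_foldr _ _ _ _ _ _ (fun x a l => a ++ l)) => //; last exact: cmp_const.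
by apply: cmp_cat; [exact: (@cmp_p21 X)|exact: (@cmp_p22 X)].
Qed.

Lemma cmp_iota (m n : X -> nat) : cmp m -> cmp n -> cmp (fun x => iota (m x) (n x)).
Proof.
move=> hm hn; apply: (@cmp_ext _ _ _ _ (fun x =>
  map (addn (m x)) (iter (n x) (fun s => rcons s (size s)) [::]))).
  move=> x; have -> : forall k, iter k (fun s => rcons s (size s)) [::] = iota 0 k.
    by elim=> // k IH; rewrite iterS IH size_iota -cats1 -addn1 iotaD.
  by rewrite -iotaDl addn0.
apply: (@cmp_map _ _ _ _ _ _ (fun x => addn (m x))).
  apply: cmp_add; last by apply: cmp_snd; apply: cmp_id.
  by apply: (cmp_comp hm); apply: cmp_p1.
apply: (@cmp_iter _ _ _ _ (fun x (s : seq nat) => rcons s (size s))) => //; last exact: cmp_const.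
have h := @cmp_snd _ _ _ _ _ _ _ (@cmp_id (X * seq nat)%type _).
by apply: cmp_rcons => //; apply: cmp_size.
Qed.

Lemma cmp_mem (A : eqType) (cA : code A) (a : X -> A) (s : X -> seq A) :
  cmp a -> cmp s -> cmp (fun x => a x \in s x).
Proof.
move=> ha hs; apply: (@cmp_ext _ _ _ _ (fun x => has (fun b => b == a x) (s x))).
  by move=> x; rewrite -has_pred1; apply: eq_has => b.
apply: (@cmp_has _ _ _ _ (fun x b => b == a x)) => //.
apply: cmp_eq; first by apply: cmp_snd; apply: cmp_id.
by apply: (cmp_comp ha); apply: cmp_p1.
Qed.

Lemma cmp_fun2 (A B C : Type) (cA : code A) (cB : code B) (cC : code C) (f : A -> B -> C)
    (g : X -> A) (h : X -> B) :
  cmp (fun p : A * B => f p.1 p.2) -> cmp g -> cmp h -> cmp (fun x => f (g x) (h x)).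
Proof.
move=> hf hg hh; apply: (@cmp_comp _ _ _ _ _ _ (fun p : A * B => f p.1 p.2) (fun x => (g x, h x))) => //.
exact: cmp_pair.
Qed.

Lemma cmp_fun3 (A B C D : Type) (cA : code A) (cB : code B) (cC : code C) (cD : code D)
    (f : A -> B -> C -> D) (g : X -> A) (h : X -> B) (k : X -> C) :
  cmp (fun p : A * (B * C) => f p.1 p.2.1 p.2.2) -> cmp g -> cmp h -> cmp k ->
  cmp (fun x => f (g x) (h x) (k x)).
Proof.
move=> hf hg hh hk; apply: (@cmp_comp _ _ _ _ _ _ (fun p : A * (B * C) => f p.1 p.2.1 p.2.2)
  (fun x => (g x, (h x, k x)))) => //.
by do 2!apply: cmp_pair => //.
Qed.

End MoreOps.

Ltac cmp_step :=
  lazymatch goal with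
  | |- cmp (fun x => x) => apply: cmp_id
  | |- cmp fst => apply: (cmp_fst cmp_id)
  | |- cmp snd => apply: (cmp_snd cmp_id)
  | |- cmp (fun _ => ?c) => exact: cmp_const
  | |- cmp (fun x => fst _) => apply: cmp_fst
  | |- cmp (fun x => snd _) => apply: cmp_snd
  | |- cmp (fun x => (_, _)) => apply: cmp_pair
  | |- cmp (fun x => S _) => apply: cmp_succ
  | |- cmp (fun x => addn _ _) => apply: cmp_add
  | |- cmp (fun x => subn _ _) => apply: cmp_sub
  | |- cmp (fun x => muln _ _) => apply: cmp_mul
  | |- cmp (fun x => expn _ _) => apply: cmp_exp
  | |- cmp (fun x => maxn _ _) => apply: cmp_max
  | |- cmp (fun x => leq _ _) => apply: cmp_leq
  | |- cmp (fun x => _ && _) => apply: cmp_and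
  | |- cmp (fun x => _ || _) => apply: cmp_or
  | |- cmp (fun x => _ ==> _) => apply: cmp_imp
  | |- cmp (fun x => if _ then _ else _) => apply: cmp_if
  | |- cmp (fun x => _ == _) => apply: cmp_eq
  | |- cmp (fun x => cons _ _) => apply: cmp_cons
  | |- cmp (fun x => cat _ _) => apply: cmp_cat
  | |- cmp (fun x => rcons _ _) => apply: cmp_rcons
  | |- cmp (fun x => behead _) => apply: cmp_behead
  | |- cmp (fun x => head _ _) => apply: cmp_head
  | |- cmp (fun x => nth _ _ _) => apply: cmp_nth
  | |- cmp (fun x => size _) => apply: cmp_size
  | |- cmp (fun x => flatten _) => apply: cmp_flatten
  | |- cmp (fun x => iota _ _) => apply: cmp_iota
  | |- cmp (fun x => in_mem _ _) => apply: cmp_mem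
  | |- cmp (fun x => map (fun y => @?f x y) (@?s x)) =>
      apply: (@cmp_map _ _ _ _ _ _ f s); cbv beta
  | |- cmp (fun x => filter (fun y => @?f x y) (@?s x)) =>
      apply: (@cmp_filter _ _ _ _ f s); cbv beta
  | |- cmp (fun x => has (fun y => @?f x y) (@?s x)) =>
      apply: (@cmp_has _ _ _ _ f s); cbv beta
  | |- cmp (fun x => all (fun y => @?f x y) (@?s x)) =>
      apply: (@cmp_all _ _ _ _ f s); cbv beta
  | |- cmp (fun x => foldl (fun y z => @?f x y z) (@?z0 x) (@?s x)) =>
      apply: (@cmp_foldl _ _ _ _ _ _ f z0 s); cbv beta
  | |- cmp (fun x => foldr (fun y z => @?f x y z) (@?z0 x) (@?s x)) =>
      apply: (@cmp_foldr _ _ _ _ _ _ f z0 s); cbv beta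
  | |- cmp (fun x => iter (@?n x) (fun y => @?f x y) (@?z x)) =>
      apply: (@cmp_iter _ _ _ _ f n z); cbv beta
  end.
Ltac cmp_tac := repeat (cmp_step; try exact _).

(** * Pumping and enumeration of words *)

Section Pumping.
Variables (A : eqType) (Q : finType) (st : seq A -> Q) (G : pred Q) (p : pred A) (N : nat).
Hypothesis st_rcons : forall u v a, st u = st v -> st (rcons u a) = st (rcons v a).
Hypothesis leN : #|Q| <= N.

Let L w := all p w && G (st w).

(** The automaton enters only as a right congruence [st] with finitely many values. This suits the
    counting profiles below, whose successor is known to be determined but is never written as a
    transition function. *)
Lemma st_cat u v w : st u = st v -> st (u ++ w) = st (v ++ w).
Proof.
elim/last_ind: w => [|w a IH] e; first by rewrite !cats0.
by rewrite -!rcons_cat; apply/st_rcons/IH.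
Qed.

Lemma pump_split w : N <= size w ->
  exists x y z, [/\ w = x ++ y ++ z, 0 < size y, size y <= N & st x = st (x ++ y)].
Proof.
move=> wN; have /injectivePn[i [j ij e]] : ~~ injectiveb (fun i : 'I_N.+1 => st (take i w)).
  apply/negP => /injectiveP/leq_card; rewrite card_ord => h.
  by have := leq_trans h leN; rewrite ltnn.
wlog lt_ij : i j ij e / i < j.
  move=> h; case: (ltngtP i j) => [|lt|/val_inj/eqP]; first exact: h.
    by apply: (h j i) => //; rewrite eq_sym.
  by rewrite (negbTE ij).
have jN : j <= N by rewrite -ltnS; apply: ltn_ord.
have jw : j <= size w by apply: leq_trans wN.
have sz : size (take (j - i) (drop i w)) = j - i by rewrite size_takel // size_drop leq_sub2r.
exists (take i w), (take (j - i) (drop i w)), (drop j w); split.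
- have -> : drop j w = drop (j - i) (drop i w) by rewrite drop_drop subnK // ltnW.
  by rewrite !cat_take_drop.
- by rewrite sz subn_gt0.
- by rewrite sz (leq_trans (leq_subr i j)).
- by rewrite e; congr st; rewrite -takeD subnKC // ltnW.
Qed.

Lemma pump_up w j : L w -> N <= size w -> exists2 w', L w' & j <= size w'.
Proof.
move=> Lw wN; elim: j => [|j [v Lv vj]]; first by exists w.
have [vN|] := leqP N (size v); last by move=> lt; exists w => //; apply: leq_trans wN; lia.
have [x [y [z [e y0 yN exy]]]] := pump_split vN.
exists (x ++ y ++ y ++ z); last by move: vj; rewrite e !size_cat; lia.
move: Lv; rewrite e /L !all_cat => /andP[/and3P[-> -> ->]] /=.
by rewrite (st_cat (y ++ z) exy) -catA.
Qed.

(** Each removed factor has length at most [N], so the descent cannot jump over a window of width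
    [N]. *)
Lemma pump_down w : L w -> N <= size w -> exists2 w', L w' & N <= size w' < N + N.
Proof.
have [n] := ubnP (size w); elim: n w => // n IH w sn Lw wN.
have [lt|ge] := ltnP (size w) (N + N); first by exists w => //; rewrite wN.
have [x [y [z [e y0 yN exy]]]] := pump_split wN.
apply: (IH (x ++ z)).
- by move: sn; rewrite e !size_cat; lia.
- move: Lw; rewrite e /L !all_cat => /andP[/and3P[-> _ ->]] /=.
  by rewrite catA (st_cat z exy).
- by move: ge; rewrite e !size_cat; lia.
Qed.

End Pumping.

Definition exact_words (k n : nat) : seq word :=
  iter n (fun W => flatten (map (fun w => map (fun a => rcons w a) (iota 0 k)) W)) [:: [::]].
Definition words (k n : nat) : seq word := flatten (map (fun i => exact_words k i) (iota 0 n.+1)).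

Lemma mem_exact k n w : (w \in exact_words k n) = is_word k w && (size w == n).
Proof.
elim: n w => [|n IH] w; first by case: w => //= a w; rewrite andbF.
rewrite /exact_words iterS -/(exact_words k n).
apply/flatten_mapP/andP => [[v]|].
  rewrite IH => /andP[kv /eqP <-] /mapP[a]; rewrite mem_iota => ak ->.
  by rewrite /is_word all_rcons size_rcons eqxx; split => //; apply/andP.
case/lastP: w => [|v a] [] //; rewrite /is_word all_rcons size_rcons eqSS => /andP[ak kv] vn.
by exists v; [rewrite IH; apply/andP|apply/mapP; exists a => //; rewrite mem_iota].
Qed.

Lemma exact_uniq k n : uniq (exact_words k n).
Proof.
elim: n => // n IH; rewrite /exact_words iterS -/(exact_words k n).
apply: allpairs_uniq => //; first exact: iota_uniq.
by move=> [v a] [v' a'] _ _ /= /rcons_inj[-> ->].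
Qed.

Lemma words_S k n : words k n.+1 = words k n ++ exact_words k n.+1.
Proof.
rewrite /words -[n.+2]addn1 iotaD map_cat flatten_cat; congr (_ ++ _).
exact: cats0.
Qed.

Lemma mem_words k n w : (w \in words k n) = is_word k w && (size w <= n).
Proof.
elim: n => [|n IH]; first by have -> : words k 0 = exact_words k 0 by []; rewrite mem_exact leqn0.
rewrite words_S mem_cat IH mem_exact -andb_orr; congr (_ && _).
by rewrite [RHS]leq_eqVlt ltnS orbC.
Qed.

Lemma words_uniq k n : uniq (words k n).
Proof.
elim: n => // n IH; rewrite words_S cat_uniq IH exact_uniq andbT.
apply/hasPn => w; rewrite mem_exact mem_words negb_and => /andP[_ /eqP->].
by rewrite ltnn orbT.
Qed.

(* Bijective base-k numeration: it orders words by length first, and injectively. *)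
Definition numeral (k : nat) (w : word) : nat := foldl (fun n a => n * k + a.+1) 0 w.

Lemma numeral_rcons k w a : numeral k (rcons w a) = numeral k w * k + a.+1.
Proof. by rewrite /numeral foldl_rcons. Qed.

Lemma numeral_lt k v w : is_word k v -> is_word k w -> size v < size w ->
  numeral k v < numeral k w.
Proof.
elim/last_ind: w v => // w a IH; case/lastP => [|v b] //.
  by rewrite numeral_rcons addnS.
rewrite /is_word !all_rcons !size_rcons ltnS !numeral_rcons => /andP[bk kv] /andP[ak kw] s.
have := IH v kv kw s; nia.
Qed.

Lemma numeral_inj k v w : is_word k v -> is_word k w -> numeral k v = numeral k w -> v = w.
Proof.
have [lt kv kw e|lt kv kw e|] := ltngtP (size v) (size w).
- by have := numeral_lt kv kw lt; rewrite e ltnn.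
- by have := numeral_lt kw kv lt; rewrite e ltnn.
elim/last_ind: w v => [|w a IH] v; first by move=> /size0nil.
case/lastP: v => [|v b]; rewrite !size_rcons // => -[s].
rewrite /is_word !all_rcons !numeral_rcons => /andP[bk kv] /andP[ak kw] e.
have e1 : numeral k v = numeral k w by nia.
have e2 : b = a by move: e; rewrite e1; lia.
by rewrite (IH v s kv kw e1) e2.
Qed.

(** * Subset automata *)

Section Subsets.
Variables (s : nat) (A : nfa).

Definition sstep (S : {set 'I_s}) (l : letter) : {set 'I_s} :=
  [set q' | has (fun t : nat * letter * nat =>
     [&& [exists q in S, val q == t.1.1], t.1.2 == l & t.2 == val q']) (nfa_delta A)].

Definition sinit : {set 'I_s} := [set q | val q == nfa_start A].
Definition sfin (S : {set 'I_s}) : bool := [exists q in S, val q \in nfa_final A].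
Definition fwd (w : seq letter) : {set 'I_s} := foldl sstep sinit w.

Hypothesis start_s : nfa_start A < s.
Hypothesis target_s : forall t : nat * letter * nat, t \in nfa_delta A -> t.2 < s.

Lemma accepts_fwd w : nfa_accepts A w = sfin (fwd w).
Proof.
have gen (S : {set 'I_s}) :
    [exists q in S, nfa_run (nfa_final A) (nfa_delta A) (val q) w] = sfin (foldl sstep S w).
  elim: w S => [|l w IH] S //=; rewrite -IH; apply/exists_inP/exists_inP => -[q].
    move=> qS /hasP[t td /and3P[/eqP t1 t2 t3]].
    exists (Ordinal (target_s td)) => //; rewrite inE; apply/hasP; exists t => //.
    by rewrite t2 /= eqxx andbT; apply/exists_inP; exists q => //; apply/eqP.
  rewrite inE => /hasP[t td /and3P[/exists_inP[q' q'S /eqP e] t2 /eqP e2]] r.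
  by exists q' => //; apply/hasP; exists t => //; rewrite t2 e2 r e eqxx.
rewrite -gen; apply/idP/exists_inP => [h|[q]].
  by exists (Ordinal start_s) => //; rewrite inE.
by rewrite inE => /eqP ->.
Qed.

Lemma fwd_rcons u l : fwd (rcons u l) = sstep (fwd u) l.
Proof. by rewrite /fwd foldl_rcons. Qed.

End Subsets.

Lemma conv1E (u : word) : conv [:: u] = map (fun a => [:: a.+1]) u.
Proof.
rewrite /conv big_seq1 /=; apply: (@eq_from_nth _ [::]); rewrite !size_map size_iota // => i iu.
by rewrite (nth_map 0) ?size_iota // nth_iota // add0n iu (nth_map 0).
Qed.

Definition conv2 (u v : word) : seq letter :=
  map (fun i => [:: if i < size u then (nth 0 u i).+1 else 0; if i < size v then (nth 0 v i).+1 else 0])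
      (iota 0 (maxn (size u) (size v))).

Lemma conv2E (u v : word) : conv [:: u; v] = conv2 u v.
Proof. by rewrite /conv /conv2 !big_cons big_nil maxn0. Qed.

Lemma conv2_cat u v x : size v = size u ->
  conv2 u (v ++ x) = conv2 u v ++ map (fun a => [:: 0; a.+1]) x.
Proof.
move=> e; have lu : size u <= size (v ++ x) by rewrite size_cat e leq_addr.
rewrite /conv2 e maxnn (maxn_idPr lu) size_cat e iotaD map_cat; congr (_ ++ _).
  apply/eq_in_map => i; rewrite mem_iota add0n => /andP[_ iu].
  by rewrite iu ltn_addr // nth_cat e iu.
rewrite add0n -[size u in LHS]addn0 iotaDl -map_comp; apply: (@eq_from_nth _ [::]).
  by rewrite !size_map size_iota.
move=> i; rewrite size_map size_iota => ix; rewrite (nth_map 0) ?size_iota // nth_iota //= add0n.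
by rewrite addn0 ltnNge leq_addr /= ltn_add2l ix nth_cat e ltnNge leq_addr /= addKn (nth_map 0).
Qed.

(** * Capped counting *)

(** Truncation at [c] is a congruence for addition and multiplication of naturals; hence capped
    counts evolve deterministically under linear recurrences with natural coefficients. *)
Lemma minn_add2 c x y x' y' : minn c x = minn c x' -> minn c y = minn c y' ->
  minn c (x + y) = minn c (x' + y').
Proof. lia. Qed.

Lemma minn_mul2 c x x' m : minn c x = minn c x' -> minn c (x * m) = minn c (x' * m).
Proof. by move=> e; elim: m => [|m IH]; rewrite ?muln0 // !mulnS; apply: minn_add2. Qed.

Lemma minn_sum c (I : finType) (P : pred I) (f g m : I -> nat) :
  (forall i, minn c (f i) = minn c (g i)) ->
  minn c (\sum_(i | P i) f i * m i) = minn c (\sum_(i | P i) g i * m i).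
Proof.
move=> e; apply: (big_ind2 (fun x y => minn c x = minn c y)) => // [x y x' y'|i _].
  exact: minn_add2.
exact: minn_mul2.
Qed.

Lemma capped_ffunP c (I : finType) (f g : I -> nat) :
  [ffun i => inord (minn c (f i)) : 'I_c.+1] = [ffun i => inord (minn c (g i))] <->
  forall i, minn c (f i) = minn c (g i).
Proof.
split=> [/ffunP e i|e]; last by apply/ffunP => i; rewrite !ffunE e.
by have /(congr1 val) := e i; rewrite !ffunE /= !inordK // ltnS geq_minl.
Qed.

Section Counting.
Variables (k : nat) (T : finType) (next : T -> nat * nat -> T) (ended : T -> bool).
Variable tau : seq nat -> word -> T.
Hypothesis tau_stay : forall h v a, size v <= size h -> tau (rcons h a) v = next (tau h v) (a, 0).
Hypothesis tau_ext : forall h v a b, size v = size h ->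
  tau (rcons h a) (rcons v b) = next (tau h v) (a, b.+1).
Hypothesis ended_tau : forall h v, size v <= size h -> ended (tau h v) = (size v < size h).

Definition count_state (t : T) (h : seq nat) : nat :=
  \sum_(v <- words k (size h)) (tau h v == t).

Lemma sum_tau (g : T -> nat) h :
  \sum_(v <- words k (size h)) g (tau h v) = \sum_t count_state t h * g t.
Proof.
under [RHS]eq_bigr do rewrite big_distrl.
rewrite exchange_big; apply: eq_bigr => v _ /=.
rewrite (bigD1 (tau h v)) //= eqxx mul1n big1 ?addn0 // => t.
by rewrite eq_sym => /negbTE ->.
Qed.

Lemma exact_filter n : perm_eq (exact_words k n) [seq v <- words k n | size v == n].
Proof.
apply: uniq_perm; rewrite ?filter_uniq ?words_uniq ?exact_uniq // => v.
by rewrite mem_filter mem_exact mem_words; case: eqP => [->|]; rewrite ?andbF // leqnn andbT.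
Qed.

(** The number of ways from [t] to [t'] while [u] reads [a]: either [v] reads padding, or it grows
    by a letter, which requires that it has not ended before. *)
Definition pmult (a : nat) (t t' : T) : nat :=
  (next t (a, 0) == t') + ~~ ended t * \sum_(b <- iota 0 k) (next t (a, b.+1) == t').

Lemma count_state_rcons t' h a :
  count_state t' (rcons h a) = \sum_t count_state t h * pmult a t t'.
Proof.
rewrite -(sum_tau (fun t => pmult a t t')) /count_state size_rcons words_S big_cat.
rewrite /pmult big_split; congr (_ + _).
  rewrite !big_seq; apply: eq_bigr => v; rewrite mem_words => /andP[_ vh].
  by rewrite tau_stay.
rewrite /exact_words iterS -/(exact_words k (size h)) big_allpairs_dep.
rewrite (perm_big _ (exact_filter _)) big_filter big_mkcond !big_seq; apply: eq_bigr => v.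
rewrite mem_words => /andP[_ vh]; rewrite ended_tau // -leqNgt eqn_leq vh /=.
case: leqP => hv; last by rewrite mul0n.
by rewrite mul1n; apply: eq_bigr => b _; rewrite tau_ext //; apply/eqP; rewrite eqn_leq vh.
Qed.

Definition count_profile (c : nat) (h : seq nat) : {ffun T -> 'I_c.+1} :=
  [ffun t => inord (minn c (count_state t h))].

Lemma count_profileP c h h' :
  count_profile c h = count_profile c h' <-> forall t, minn c (count_state t h) = minn c (count_state t h').
Proof.
exact: capped_ffunP.
Qed.

Lemma count_profile_rcons c h h' a :
  count_profile c h = count_profile c h' -> count_profile c (rcons h a) = count_profile c (rcons h' a).
Proof.
move=> /count_profileP e; apply/count_profileP => t.
by rewrite !count_state_rcons; apply: minn_sum.
Qed.

Lemma count_state_gt0 t h : 0 < count_state t h <-> exists2 v, v \in words k (size h) & tau h v = t.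
Proof.
rewrite /count_state lt0n sum_nat_seq_neq0; split=> [/hasP[v vh]|[v vh <-]].
  by rewrite /= eqb0 negbK => /eqP; exists v.
by apply/hasP; exists v => //=; rewrite eqxx.
Qed.

Lemma count_profile_gt0 c h h' t : 0 < c -> count_profile c h = count_profile c h' ->
  (0 < count_state t h) = (0 < count_state t h').
Proof. by move=> c0 /count_profileP/(_ t); lia. Qed.

End Counting.

(** * The automaton on pairs of words and its counting profile *)

Section Profile.
Variables (k s : nat) (AD AE : nfa).

(* A state records the two subset automata, whether [v] has ended, and how [v] compares with [u]
   in the numeration order (None for equal, Some true for less). *)
Definition pstate : Type := ({set 'I_s} * {set 'I_s} * bool * option bool)%type.

(** Symbols are shifted by one and 0 is padding. Where both words have ended their convolution has
    no letter, so [SE] stands still. As the longer word has the larger numeral, padding in just one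
    of the words overrides the comparison made so far. *)
Definition pnext (t : pstate) (l : nat * nat) : pstate :=
  let: (SE, SD, _, c) := t in let: (a, b) := l in
  (if (a == 0) && (b == 0) then SE else sstep AE SE [:: a; b],
   if b == 0 then SD else sstep AD SD [:: b],
   b == 0,
   if b == 0 then (if a == 0 then c else Some true) else if a == 0 then Some false
   else if c is None then (if b < a then Some true else if a < b then Some false else None) else c).

Definition pinit : pstate := (sinit s AE, sinit s AD, false, None).

Definition zp (h : seq nat) (v : word) : seq (nat * nat) :=
  [seq (nth 0 h i, nth 0 (map S v) i) | i <- iota 0 (size h)].

Definition tau h v : pstate := foldl pnext pinit (zp h v).

Lemma iota_rcons n : iota 0 n.+1 = rcons (iota 0 n) n.
Proof. by rewrite -addn1 iotaD cats1. Qed.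

Lemma tau_stay h v a : size v <= size h -> tau (rcons h a) v = pnext (tau h v) (a, 0).
Proof.
move=> vh; rewrite /tau /zp size_rcons iota_rcons map_rcons foldl_rcons.
rewrite nth_rcons ltnn eqxx (nth_default _ (_ : size (map S v) <= _)) ?size_map //.
congr (pnext (foldl _ _ _) _); apply/eq_in_map => i; rewrite mem_iota => /andP[_ ih].
by rewrite nth_rcons ih.
Qed.

Lemma tau_ext h v a b : size v = size h ->
  tau (rcons h a) (rcons v b) = pnext (tau h v) (a, b.+1).
Proof.
move=> vh; rewrite /tau /zp size_rcons iota_rcons map_rcons foldl_rcons.
rewrite map_rcons !nth_rcons size_map vh ltnn eqxx.
congr (pnext (foldl _ _ _) _); apply/eq_in_map => i; rewrite mem_iota => /andP[_ ih].
by rewrite !nth_rcons size_map vh ih.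
Qed.

Definition ended (t : pstate) : bool := t.1.2.

Lemma ended_tau h v : size v <= size h -> ended (tau h v) = (size v < size h).
Proof.
elim/last_ind: h v => [|h a IH] v.
  by rewrite /= leqn0 => /eqP ->; rewrite /tau.
case/lastP: v => [|v b]; first by rewrite tau_stay // size_rcons; case: (tau h [::]) => [[[]]].
rewrite size_rcons leq_eqVlt => /orP[/eqP e|].
  rewrite -e ltnn; move: e; rewrite !size_rcons => -[e].
  by rewrite tau_ext //; case: (tau h v) => [[[]]].
rewrite !size_rcons => vh.
by rewrite tau_stay ?size_rcons //; case: (tau h _) => [[[]]] //= *; lia.
Qed.

Lemma tauE_SE h v : (tau h v).1.1.1 =
  foldl (fun S l => if (l.1 == 0) && (l.2 == 0) then S else sstep AE S [:: l.1; l.2]) (sinit s AE) (zp h v).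
Proof.
rewrite /tau -[sinit s AE in RHS]/(pinit.1.1.1).
by elim: (zp h v) pinit => //= -[a b] l IH [[[SE SD] e] c]; rewrite IH.
Qed.

Lemma tauE_SD h v : (tau h v).1.1.2 =
  foldl (fun S l => if l.2 == 0 then S else sstep AD S [:: l.2]) (sinit s AD) (zp h v).
Proof.
rewrite /tau -[sinit s AD in RHS]/(pinit.1.1.2).
by elim: (zp h v) pinit => //= -[a b] l IH [[[SE SD] e] c]; rewrite IH.
Qed.

(** Padding symbols after [u] make room for words [v] that are longer than [u] by up to [p]. *)
Definition pad (u : word) (p : nat) : seq nat := map S u ++ nseq p 0.

Lemma size_pad u p : size (pad u p) = size u + p.
Proof. by rewrite size_cat size_map size_nseq. Qed.

Lemma nth_symb (u : word) i : nth 0 (map S u) i = if i < size u then (nth 0 u i).+1 else 0.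
Proof. by case: ltnP => h; [rewrite (nth_map 0)|rewrite nth_default ?size_map]. Qed.

Lemma nth_pad u p i : nth 0 (pad u p) i = nth 0 (map S u) i.
Proof.
rewrite nth_cat size_map nth_symb; case: ltnP => // _; rewrite nth_nseq.
by case: ifP.
Qed.

Lemma foldl_skip (B : Type) (f g : B -> nat -> B) (z : B) m n :
  m <= n -> (forall S i, i < m -> f S i = g S i) -> (forall S i, m <= i -> f S i = S) ->
  foldl f z (iota 0 n) = foldl g z (iota 0 m).
Proof.
move=> mn fg fS; rewrite -(subnKC mn) iotaD foldl_cat.
have -> : foldl f z (iota 0 m) = foldl g z (iota 0 m).
  move: fg; elim: m {mn fS} => // m IH fg; rewrite iota_rcons !foldl_rcons fg // IH //.
  by move=> S i im; apply: fg; apply: ltnW.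
rewrite add0n; have : m <= m by [].
elim: (n - m) {2 3}m (foldl g z _) => //= d IH j y mj.
by rewrite fS // IH // ltnW.
Qed.

Definition pacc (t : pstate) : bool := sfin AE t.1.1.1 && sfin AD t.1.1.2.

Hypothesis startD : nfa_start AD < s.
Hypothesis targetD : forall t : nat * letter * nat, t \in nfa_delta AD -> t.2 < s.
Hypothesis startE : nfa_start AE < s.
Hypothesis targetE : forall t : nat * letter * nat, t \in nfa_delta AE -> t.2 < s.

Lemma foldl_map (B C D : Type) (f : B -> D -> B) (g : C -> D) z l :
  foldl f z (map g l) = foldl (fun b c => f b (g c)) z l.
Proof. by elim: l z => /=. Qed.

Lemma pacc_tau u v p : size v <= size u + p ->
  pacc (tau (pad u p) v) = nfa_accepts AE (conv [:: u; v]) && nfa_accepts AD (conv [:: v]).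
Proof.
move=> vh; rewrite (accepts_fwd startE targetE) (accepts_fwd startD targetD).
rewrite /pacc tauE_SE tauE_SD conv2E conv1E /zp size_pad !foldl_map; congr (_ && _); apply: congr1.
  rewrite (@foldl_skip _ _ (fun S i => sstep AE S [:: nth 0 (map succn u) i; nth 0 (map succn v) i]) _
    (maxn (size u) (size v))).
  - by rewrite /fwd /conv2 foldl_map; congr foldl; apply/funext => S; apply/funext => i; rewrite !nth_symb.
  - lia.
  - by move=> S i im /=; rewrite nth_pad !nth_symb; do 2!case: ltnP => // ?; exfalso; lia.
  - by move=> S i im /=; rewrite nth_pad !nth_symb; do 2!case: ltnP => // ?; exfalso; lia.
rewrite (@foldl_skip _ _ (fun S i => sstep AD S [:: nth 0 (map succn v) i]) _ (size v)) //.
- have -> : map (fun a => [:: a.+1]) v = map (fun i => [:: nth 0 (map succn v) i]) (iota 0 (size v)).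
    apply: (@eq_from_nth _ [::]); rewrite !size_map ?size_iota // => i iv.
    by rewrite (nth_map 0) // (nth_map 0) ?size_iota // nth_iota // nth_symb add0n iv.
  by rewrite /fwd foldl_map.
- by move=> S i iv /=; rewrite nth_symb iv.
- by move=> S i iv /=; rewrite nth_symb ltnNge iv.
Qed.

Lemma tau_order u v : is_word k u -> is_word k v -> size v <= size u ->
  (tau (map S u) v).2 = if numeral k v < numeral k u then Some true
    else if numeral k u < numeral k v then Some false else None.
Proof.
elim/last_ind: u v => [|u a IH] v; first by rewrite leqn0 => _ _ /nilP ->.
case/lastP: v => [|v b]; rewrite /is_word !all_rcons ?size_rcons.
  move=> /andP[ak ku] _ _; rewrite map_rcons tau_stay // numeral_rcons addnS.
  by case: (tau _ _) => [[[]]].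
move=> /andP[ak ku] /andP[bk kv]; rewrite ltnS leq_eqVlt => /orP[/eqP e|lt].
  rewrite map_rcons tau_ext ?size_map //; have {IH} := IH v ku kv; rewrite e => /(_ (leqnn _)).
  case: (tau _ _) => [[[SE SD] en] c] /= ->; rewrite !numeral_rcons.
  have lt (x y e1 e2 : nat) : x < y -> e1 < k -> x * k + e1.+1 < y * k + e2.+1.
    move=> xy ck; apply: (@leq_ltn_trans (x.+1 * k)); first by rewrite mulSn addnC leq_add2r.
    by rewrite addnS ltnS (leq_trans _ (leq_addr _ _)) // leq_mul2r xy orbT.
  case: (ltngtP (numeral k v) (numeral k u)) => h.
  - by rewrite (lt _ _ _ a h bk).
  - by have h' := lt _ _ _ b h ak; rewrite h' ltnNge (ltnW h').
  - by rewrite h !ltn_add2l !ltnS.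
rewrite map_rcons tau_stay ?size_rcons ?size_map //.
have -> : numeral k (rcons v b) < numeral k (rcons u a).
  by apply: numeral_lt; rewrite ?size_rcons /is_word ?all_rcons ?ak ?bk.
by case: (tau _ _) => [[[]]].
Qed.

Definition cnt_state := count_state k tau.
Definition profile := count_profile k tau.

Lemma profile_rcons c h h' a :
  profile c h = profile c h' -> profile c (rcons h a) = profile c (rcons h' a).
Proof. apply: (count_profile_rcons tau_stay tau_ext ended_tau). Qed.

Lemma profile_pad c u u' p :
  profile c (map S u) = profile c (map S u') -> profile c (pad u p) = profile c (pad u' p).
Proof. by move=> e; apply: st_cat e => h h' a; apply: profile_rcons. Qed.

End Profile.

(** * Deciding the number of classes of a given size *)

Definition state_bound (A : nfa) : nat :=
  (foldr (fun (t : nat * letter * nat) n => t.2 + n) (nfa_start A) (nfa_delta A)).+1.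

Lemma state_bound_start A : nfa_start A < state_bound A.
Proof. by rewrite ltnS; elim: (nfa_delta A) => //= t l; lia. Qed.

Lemma state_bound_target A (t : nat * letter * nat) : t \in nfa_delta A -> t.2 < state_bound A.
Proof.
rewrite ltnS; elim: (nfa_delta A) => //= t' l IH; rewrite inE => /orP[/eqP->|/IH]; lia.
Qed.

Section Presentation.
Variable P : presentation.

Definition num_states : nat := state_bound P.1.2 + state_bound P.2.
Definition domb (u : word) : bool := is_word P.1.1 u && nfa_accepts P.1.2 (conv [:: u]).
Definition relb (u v : word) : bool := [&& domb u, domb v & nfa_accepts P.2 (conv [:: u; v])].

(** The number of pairs of subset states, one for each automaton of the presentation. *)
Definition gap : nat := 2 ^ num_states * 2 ^ num_states.
(* By pumping, an infinite class has a member in this window of lengths, and a finite one has none. *)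
Definition infb (u : word) : bool :=
  has (fun v => (size u + gap <= size v) && relb u v) (words P.1.1 (size u + (gap + gap))).
Definition csize (u : word) : nat :=
  size (filter (fun v => relb u v) (words P.1.1 (size u + gap))).
(* The size of the class of [u], with 0 standing for infinite. *)
Definition cls (u : word) : nat := if infb u then 0 else csize u.
Definition repb (u : word) : bool :=
  all (fun v => relb u v ==> (numeral P.1.1 u <= numeral P.1.1 v)) (words P.1.1 (size u)).
Definition class_rep (m : nat) (u : word) : bool := [&& domb u, repb u & cls u == m].
(** The number of pairs of a subset state for the domain and a profile capped at [m.+1]. A profile
    has [m.+2] possible values at each [pstate]; the factors 2 and 3 in the number of these come
    from the end flag and the comparison. *)
Definition rep_bound (m : nat) : nat :=
  2 ^ num_states * m.+2 ^ (2 ^ num_states * 2 ^ num_states * 2 * 3).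
(* The number of classes of size [m]; the boolean tells that there are infinitely many. *)
Definition count_classes (m : nat) : bool * nat :=
  let l := filter (fun u => class_rep m u) (words P.1.1 (rep_bound m + rep_bound m)) in
  if has (fun u => rep_bound m <= size u) l then (true, 0) else (false, size l).

Lemma pres_domP u : pres_dom P u <-> domb u.
Proof. by split=> [[h1 h2]|/andP[]]; first by apply/andP. Qed.

Lemma pres_relP u v : pres_rel P u v <-> relb u v.
Proof.
split=> [[/pres_domP du [/pres_domP dv e]]|/and3P[du dv e]]; first exact/and3P.
by split; [exact/pres_domP|split; [exact/pres_domP|]].
Qed.

Lemma domb_word u : domb u -> is_word P.1.1 u. Proof. by case/andP. Qed.

Lemma relb_word u v : relb u v -> is_word P.1.1 v. Proof. by case/and3P => _ /domb_word. Qed.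

Local Notation k := P.1.1.
Local Notation s := num_states.
Local Notation AD := P.1.2.
Local Notation AE := P.2.

Let startD : nfa_start AD < s.
Proof. by rewrite ltn_addr // state_bound_start. Qed.
Let startE : nfa_start AE < s.
Proof. by rewrite ltn_addl // state_bound_start. Qed.
Let targetD (t : nat * letter * nat) : t \in nfa_delta AD -> t.2 < s.
Proof. by move=> /state_bound_target h; rewrite ltn_addr. Qed.
Let targetE (t : nat * letter * nat) : t \in nfa_delta AE -> t.2 < s.
Proof. by move=> /state_bound_target h; rewrite ltn_addl. Qed.

Section ClassPumping.
Variables (u v1 : word).
Hypotheses (du : domb u) (wv1 : is_word k v1) (sv1 : size v1 = size u).

Let st (x : word) : {set 'I_s} * {set 'I_s} :=
  (fwd s AE (conv2 u v1 ++ map (fun a => [:: 0; a.+1]) x),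
   fwd s AD (map (fun a => [:: a.+1]) (v1 ++ x))).
Let G (q : {set 'I_s} * {set 'I_s}) : bool := sfin AE q.1 && sfin AD q.2.

Let st_rcons x y a : st x = st y -> st (rcons x a) = st (rcons y a).
Proof. by case=> e1 e2; rewrite /st !map_rcons -!rcons_cat !map_rcons !fwd_rcons e1 e2. Qed.

Let cardQ : #|{: {set 'I_s} * {set 'I_s}}| <= gap.
Proof. by rewrite card_prod -!cardsT -!powersetT !card_powerset cardsT card_ord. Qed.

Let L x : relb u (v1 ++ x) = all (fun a => a < k) x && G (st x).
Proof.
rewrite /relb du /domb /= /G /st /= conv2E conv1E conv2_cat //.
rewrite -(accepts_fwd startE targetE) -(accepts_fwd startD targetD).
by rewrite /is_word all_cat -/(is_word k v1) wv1 /= -!andbA; congr (_ && _); rewrite andbC.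
Qed.

(** Beyond the length of [u] only padding is read for [u], so with [u] and the prefix [v1] of that
    length fixed, the rest of [v] is governed by two subset states and can be pumped. *)
Lemma class_pump x : relb u (v1 ++ x) -> gap <= size x ->
  (forall j, exists2 y, relb u y & j <= size y) /\
  (exists2 y, relb u y & size u + gap <= size y < size u + (gap + gap)).
Proof.
rewrite L => Lx sx; split=> [j|].
  have [y Ly sy] := pump_up st_rcons cardQ j Lx sx; exists (v1 ++ y); first by rewrite L.
  by rewrite size_cat (leq_trans sy) ?leq_addl.
have [y Ly sy] := pump_down st_rcons cardQ Lx sx; exists (v1 ++ y); first by rewrite L.
by rewrite size_cat sv1 !leq_add2l ltn_add2l.
Qed.

End ClassPumping.

Lemma class_pumping u v : relb u v -> size u + gap <= size v ->
  (forall j, exists2 y, relb u y & j <= size y) /\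
  (exists2 y, relb u y & size u + gap <= size y < size u + (gap + gap)).
Proof.
move=> uv sv; have [du _ _] := and3P uv; have wv := relb_word uv.
have suv : size u <= size v by lia.
apply: (@class_pump u (take (size u) v) du _ _ (drop (size u) v)).
- by move: wv; rewrite /is_word -{1}(cat_take_drop (size u) v) all_cat => /andP[].
- by rewrite size_takel.
- by rewrite cat_take_drop.
- by rewrite size_drop; lia.
Qed.

Lemma infbP u : infb u <-> forall j, exists2 v, relb u v & j <= size v.
Proof.
split=> [/hasP[v _ /andP[sv uv]]|h]; first by have [] := class_pumping uv sv.
have [v uv sv] := h (size u + gap).
have [_ [y uy /andP[s1 s2]]] := class_pumping uv sv.
by apply/hasP; exists y; [rewrite mem_words (relb_word uy) ltnW|rewrite s1].
Qed.

Lemma infbPn u v : ~~ infb u -> relb u v -> size v < size u + gap.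
Proof.
move=> /negP ni uv; rewrite ltnNge; apply/negP => sv; apply: ni; apply/infbP.
by have [] := class_pumping uv sv.
Qed.

Lemma csizeP u : ~~ infb u ->
  exists2 l, uniq l & (size l = csize u) /\ (forall v, v \in l <-> relb u v).
Proof.
move=> ni; exists (filter (fun v => relb u v) (words k (size u + gap))).
  by rewrite filter_uniq ?words_uniq.
split=> // v; rewrite mem_filter; split=> [/andP[]//|uv]; rewrite uv mem_words (relb_word uv) /=.
exact/ltnW/infbPn.
Qed.

Lemma infb_size_ge u : infb u <-> forall j, size_ge (fun v => relb u v) j.
Proof.
split=> [/infbP h|h].
  elim=> [|j [l [ul sl lu]]]; first by exists [::].
  have [v uv sv] := h (\max_(x <- l) size x).+1.
  exists (v :: l); split=> /=; [|by rewrite sl|].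
    rewrite ul andbT; apply/negP => vl; move: sv.
    by rewrite ltnNge (big_rem v) //= leq_maxl.
  by move=> x; rewrite inE => /orP[/eqP->|/lu].
apply/negPn/negP => /csizeP[l ul [_ le]].
have [l' [ul' sl' le']] := h (size l).+1.
have := uniq_leq_size ul' (s2 := l); rewrite sl' ltnn => H; suff : false by [].
by apply: H => x /le' /le.
Qed.

Local Notation c m := (m.+1).
(** The cap [m.+1] is the least one that tells a class of size [m] from a larger one. *)
Definition qst (m : nat) (u : word) :=
  (fwd s AD (conv [:: u]), profile k s AD AE (c m) (map S u) : {ffun pstate s -> 'I_(c m).+1}).

Lemma qst_rcons m u u' a : qst m u = qst m u' -> qst m (rcons u a) = qst m (rcons u' a).
Proof.
rewrite /qst => e; have e1 := congr1 fst e; have e2 := congr1 snd e; cbn in e1, e2.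
apply/pair_equal_spec; split; last by rewrite !map_rcons; apply: profile_rcons.
by move: e1; rewrite !conv1E !map_rcons !fwd_rcons => ->.
Qed.

Lemma card_qst m : #|{: {set 'I_s} * {ffun pstate s -> 'I_(c m).+1}}| <= rep_bound m.
Proof.
rewrite card_prod card_ffun !card_prod card_bool card_option card_bool card_ord.
by rewrite -!cardsT -!powersetT !card_powerset cardsT card_ord.
Qed.

Lemma relb_pacc w v p : domb w -> is_word k v -> size v <= size w + p ->
  relb w v = pacc AD AE (tau s AD AE (pad w p) v).
Proof.
move=> dw wv sv; rewrite (pacc_tau startD targetD startE targetE) // /relb dw /domb wv /=.
by rewrite andbC.
Qed.

(** After [p] padding symbols, the words that have not ended are those of length exactly
    [size w + p]; this expresses the window of lengths in [infb] by positivity of counts. *)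
Lemma infb_tau w : domb w -> infb w <->
  exists p t, [/\ gap <= p <= gap + gap, 0 < @cnt_state k s AD AE t (pad w p), ~~ ended t & @pacc s AD AE t].
Proof.
move=> dw; split=> [/hasP[v]|[p [t [/andP[p1 p2] /(@count_state_gt0 k _ (tau s AD AE))[v vh <-] en ac]]]].
  rewrite mem_words => /andP[wv vh] /andP[vh' wv'].
  have sv : size v = size w + (size v - size w).
    by rewrite subnKC // (leq_trans (leq_addr _ _) vh').
  exists (size v - size w), (tau s AD AE (pad w (size v - size w)) v); split.
  - by rewrite leq_subLR vh andbT -(leq_add2l (size w)) -sv.
  - by apply/(@count_state_gt0 k _ (tau s AD AE)); exists v => //; rewrite mem_words wv size_pad -sv leqnn.
  - by rewrite ended_tau ?size_pad -?sv ?ltnn.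
  - by rewrite -relb_pacc // -sv.
move: vh; rewrite mem_words size_pad => /andP[wv vh].
apply/hasP; exists v; first by rewrite mem_words wv (leq_trans vh) ?leq_add2l.
move: en; rewrite ended_tau ?size_pad // -leqNgt => vh'.
by rewrite (@relb_pacc _ _ p) // ac andbT (leq_trans _ vh') ?leq_add2l.
Qed.

Lemma csize_tau w : domb w ->
  csize w = \sum_t @cnt_state k s AD AE t (pad w gap) * (@pacc s AD AE t : nat).
Proof.
move=> dw; rewrite -(@sum_tau k _ (tau s AD AE) (fun t => (@pacc s AD AE t : nat))).
rewrite size_pad /csize -sum1_size big_filter big_mkcond !big_seq.
apply: eq_bigr => v; rewrite mem_words => /andP[wv sv].
by rewrite (@relb_pacc _ _ gap) //; case: pacc.
Qed.

Lemma repb_tau w : domb w ->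
  repb w <-> forall t, 0 < @cnt_state k s AD AE t (map S w) -> @pacc s AD AE t -> t.2 <> Some true.
Proof.
move=> dw; have ww := domb_word dw.
have e0 : map S w = pad w 0 by rewrite /pad cats0.
split=> [/allP h t /(@count_state_gt0 k _ (tau s AD AE))[v vh <-] ac|h].
  move: vh; rewrite size_map mem_words => /andP[wv vh].
  rewrite (tau_order s AD AE ww wv vh).
  have := h v; rewrite mem_words wv vh => /(_ isT).
  by rewrite (@relb_pacc _ _ 0) ?addn0 // -e0 ac /= leqNgt => /negbTE ->; case: ifP.
apply/allP => v; rewrite mem_words => /andP[wv vh]; apply/implyP.
rewrite (@relb_pacc _ _ 0) ?addn0 // -e0 => ac; rewrite leqNgt; apply/negP => lt.
have := h (tau s AD AE (map S w) v) _ ac; rewrite (tau_order s AD AE ww wv vh) lt; apply=> //.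
by apply/(@count_state_gt0 k _ (tau s AD AE)); exists v => //; rewrite size_map mem_words wv.
Qed.

Section Determined.
Variables (m : nat) (u u' : word).
Hypotheses (wu : is_word k u) (wu' : is_word k u').
Hypothesis eD : fwd s AD (conv [:: u]) = fwd s AD (conv [:: u']).

Lemma fwd_domb : domb u = domb u'.
Proof. by rewrite /domb wu wu' !(accepts_fwd startD targetD) eD. Qed.

Hypothesis du : domb u.
Hypothesis eP : profile k s AD AE (c m) (map S u) = profile k s AD AE (c m) (map S u').

Lemma qst_class_rep : class_rep m u = class_rep m u'.
Proof.
have du' : domb u' by rewrite -fwd_domb.
have pg p t : (0 < @cnt_state k s AD AE t (pad u p)) = (0 < @cnt_state k s AD AE t (pad u' p)).
  exact (@count_profile_gt0 k _ (tau s AD AE) (c m) (pad u p) (pad u' p) t isT (profile_pad p eP)).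
have pg0 t : (0 < @cnt_state k s AD AE t (map S u)) = (0 < @cnt_state k s AD AE t (map S u')).
  exact (@count_profile_gt0 k _ (tau s AD AE) (c m) (map S u) (map S u') t isT eP).
have pm t : minn (c m) (@cnt_state k s AD AE t (pad u gap)) =
    minn (c m) (@cnt_state k s AD AE t (pad u' gap)).
  exact (iffLR (@count_profileP k _ (tau s AD AE) (c m) _ _) (profile_pad gap eP) t).
clear eP.
have eI : infb u = infb u'.
  apply/idP/idP.
    move=> /(infb_tau du)[p [t [p1 p2 p3 p4]]]; apply/(infb_tau du'); exists p, t.
    by rewrite pg in p2.
  move=> /(infb_tau du')[p [t [p1 p2 p3 p4]]]; apply/(infb_tau du); exists p, t.
  by rewrite -pg in p2.
have eR : repb u = repb u'.
  apply/idP/idP.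
    by move=> /(repb_tau du) h; apply/(repb_tau du') => t; rewrite -pg0; apply: h.
  by move=> /(repb_tau du') h; apply/(repb_tau du) => t; rewrite pg0; apply: h.
rewrite /class_rep -fwd_domb du eR /=; congr (_ && _); rewrite /cls -eI; case: ifP => // _.
(* Sizes that agree up to the cap [m.+1] are both equal to [m] or both different from it. *)
have : minn (c m) (csize u) = minn (c m) (csize u').
  rewrite (csize_tau du) (csize_tau du').
  exact (minn_sum _ _ pm).
clear; move=> ec; apply/eqP/eqP; lia.
Qed.

End Determined.

Lemma class_rep_det m u u' : is_word k u -> is_word k u' -> qst m u = qst m u' ->
  class_rep m u = class_rep m u'.
Proof.
rewrite /qst => wu wu' e; have e1 := congr1 fst e; have e2 := congr1 snd e; cbn in e1, e2.
clear e; have ed := fwd_domb wu wu' e1.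
case du : (domb u); first exact: qst_class_rep.
by rewrite /class_rep -ed du.
Qed.

Lemma class_rep_word m u : class_rep m u -> is_word k u.
Proof. by case/and3P => /domb_word. Qed.

Lemma count_classesP m :
  ((count_classes m).1 -> forall j, size_ge (fun u => class_rep m u) j) /\
  (~~ (count_classes m).1 -> exists2 l, uniq l &
     size l = (count_classes m).2 /\ forall u, u \in l <-> class_rep m u).
Proof.
(* Pumping needs a predicate on states; [class_rep_det] makes the existential one faithful. *)
pose G q := `[< exists2 w, is_word k w & qst m w = q /\ class_rep m w >].
have L w : class_rep m w = all (fun a => a < k) w && G (qst m w).
  apply/idP/andP => [cw|[ww /asboolP[w' ww' [e cw']]]].
    by have ww := class_rep_word cw; split=> //; apply/asboolP; exists w.
  by rewrite -(class_rep_det ww' ww e).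
rewrite /count_classes; set l := filter _ _; case: ifP => /= h; split=> // _.
  have /hasP[w] := h; rewrite mem_filter => /andP[cw _] sw j.
  elim: j => [|j [l' [ul' sl' lu']]]; first by exists [::].
  move: (cw); rewrite L => Lw.
  have [v Lv sv] := pump_up (@qst_rcons m) (card_qst m) (\max_(x <- l') size x).+1 Lw sw.
  exists (v :: l'); split=> /=; [|by rewrite sl'|].
    rewrite ul' andbT; apply/negP => vl; move: sv.
    by rewrite ltnNge (big_rem v) //= leq_maxl.
  by move=> x; rewrite inE => /orP[/eqP->|/lu' //]; rewrite L.
exists l; first by rewrite filter_uniq ?words_uniq.
split=> // u; rewrite mem_filter; split=> [/andP[]//|cu]; rewrite cu mem_words (class_rep_word cu) /=.
rewrite leqNgt; apply/negP => su; move: (cu); rewrite L => Lu.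
have su' : rep_bound m <= size u by rewrite (leq_trans (leq_addr _ _) (ltnW su)).
have [v Lv /andP[sv1 sv2]] := pump_down (@qst_rcons m) (card_qst m) Lu su'.
have : has (fun u => rep_bound m <= size u) l.
  apply/hasP; exists v => //.
  by rewrite mem_filter L Lv mem_words (ltnW sv2) andbT; case/andP: Lv.
by rewrite h.
Qed.

End Presentation.

(** * Isomorphism as equality of class counts *)

Definition relP (P : presentation) (u v : word) : Prop := relb P u v.
Definition domP (P : presentation) (u : word) : Prop := domb P u.
Definition repP (P : presentation) (u : word) : Prop := domb P u && repb P u.

Lemma equiv_onP P : is_equiv_structure P <-> equiv_on (domP P) (relP P).
Proof.
split=> [[r [s t]]|[d r s t]].
  split=> [x y /and3P[]//|x /pres_domP/r/pres_relP//|x y /pres_relP/s/pres_relP//|].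
  by move=> x y z /pres_relP xy /pres_relP yz; apply/pres_relP/t/yz.
split=> [u /pres_domP/r/pres_relP//|]; split=> [u v /pres_relP/s/pres_relP//|].
by move=> x y z /pres_relP xy /pres_relP yz; apply/pres_relP/t/yz.
Qed.

(** Words longer than [u] have larger numerals, so [repb] may look only at words of length at most
    [size u] and still single out the least element of the class. *)
Lemma repP_transversal P : equiv_on (domP P) (relP P) -> transversal_of (domP P) (relP P) (repP P).
Proof.
move=> [d r s t]; split=> [x /andP[]//|x dx|u v /andP[du ru] /andP[dv rv] uv].
  have ex : exists n, `[< exists2 v, relP P x v & numeral P.1.1 v = n >].
    by exists (numeral P.1.1 x); apply/asboolP; exists x => //; apply: r.
  case: (ex_minnP ex) => n /asboolP[v xv <-] vmin; exists v => //.
  apply/andP; split; first by case: (d _ _ xv).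
  apply/allP => y _; apply/implyP => vy; apply: vmin; apply/asboolP; exists y => //.
  exact: t xv vy.
have wu := domb_word du; have wv := domb_word dv.
have le x y : repb P x -> relP P x y -> numeral P.1.1 x <= numeral P.1.1 y.
  move=> /allP h xy; have [dx dy] := d _ _ xy.
  have [sy|sy] := leqP (size y) (size x); last first.
    exact/ltnW/(numeral_lt (domb_word dx) (domb_word dy)).
  by have := h y; rewrite mem_words (domb_word dy) sy xy => /(_ isT).
apply: (@numeral_inj P.1.1) => //; apply/eqP; rewrite eqn_leq le //=.
exact: le (s _ _ uv).
Qed.

(** Reflexivity keeps finite classes nonempty, so the value 0 is free to mean infinite. *)
Lemma equinum_cls P Q u v : relP P u u -> relP Q v v ->
  equinum (relP P u) (relP Q v) <-> cls P u = cls Q v.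
Proof.
move=> uu vv; rewrite /cls; case: ifP => iu; case: ifP => iv.
- by split=> // _ j; split=> _; [move/infb_size_ge: iv|move/infb_size_ge: iu]; apply.
- have [l ul [<- le]] := csizeP (negbT iv); split=> [h|e].
    suff : infb Q v by rewrite iv.
    by apply/infb_size_ge => j; apply/h; move/infb_size_ge: iu; apply.
  by have := (le v).2 vv; rewrite (size0nil (esym e)).
- have [l ul [<- le]] := csizeP (negbT iu); split=> [h|e].
    suff : infb P u by rewrite iu.
    by apply/infb_size_ge => j; apply/h; move/infb_size_ge: iv; apply.
  by have := (le u).2 uu; rewrite (size0nil e).
- have [l ul [<- le]] := csizeP (negbT iu); have [l' ul' [<- le']] := csizeP (negbT iv).
  exact: equinum_seq.
Qed.

Lemma equinum_count P Q m :
  equinum (fun u : word => class_rep P m u) (fun u => class_rep Q m u) <->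
  count_classes P m = count_classes Q m.
Proof.
have [P1 P2] := count_classesP P m; have [Q1 Q2] := count_classesP Q m.
(* The second component is 0 in the infinite case, which makes the pair a canonical name of the
   cardinality. *)
have z R : (count_classes R m).1 -> (count_classes R m).2 = 0.
  by rewrite /count_classes; case: ifP.
case: (count_classes P m) P1 P2 (z P) => bP nP /= P1 P2 /= zP.
case: (count_classes Q m) Q1 Q2 (z Q) => bQ nQ /= Q1 Q2 /= zQ.
case: bP P1 P2 zP => [P1 _ -> //|_ /(_ isT)[l ul [<- le]] _];
case: bQ Q1 Q2 zQ => [Q1 _ -> //|_ /(_ isT)[l' ul' [<- le']] _].
- by split=> // _ j; split=> _; [apply: Q1|apply: P1].
- split=> // h; have [s [us ss sP]] := P1 isT (size l').+1.
  have /h : size_ge (fun u => class_rep P m u) (size l').+1 by exists s.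
  by move/(size_ge_seq _ ul' le'); rewrite ltnn.
- split=> // h; have [s [us ss sP]] := Q1 isT (size l).+1.
  have /h : size_ge (fun u => class_rep Q m u) (size l).+1 by exists s.
  by move/(size_ge_seq _ ul le); rewrite ltnn.
- by rewrite (equinum_seq ul le ul' le'); split=> [->|[->]].
Qed.

Lemma pres_iso_on P Q : pres_iso P Q <-> iso_on (domP P) (domP Q) (relP P) (relP Q).
Proof.
have eD R : pres_dom R = domP R by apply/funext => u; apply/propext/pres_domP.
have eR R : pres_rel R = relP R by apply/funext => u; apply/funext => v; apply/propext/pres_relP.
by rewrite /pres_iso /iso_on !eD !eR.
Qed.

Lemma reps_like_cls P Q u : equiv_on (domP P) (relP P) -> equiv_on (domP Q) (relP Q) ->
  domb P u -> reps_like (relP Q) (repP Q) (relP P u) = (fun v => class_rep Q (cls P u) v) :> (word -> Prop).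
Proof.
move=> eP eQ du; apply/funext => v; apply/propext; rewrite /reps_like /repP /class_rep.
have uu : relP P u u by apply: (eq_refl_on eP).
split=> [[/andP[dv rv] e]|/and3P[dv rv /eqP e]].
  by rewrite dv rv; apply/eqP/equinum_cls => //; apply: (eq_refl_on eQ).
rewrite dv rv; split=> //; apply/equinum_cls => //; exact: (eq_refl_on eQ).
Qed.

(** A cardinality is either that of some class of [P] or [Q], and then it is named by a value of
    [cls], or it has no representatives on either side. Conversely, an [m] that no class attains
    gives empty sets in both structures. *)
Lemma iso_count P Q : equiv_on (domP P) (relP P) -> equiv_on (domP Q) (relP Q) ->
  pres_iso P Q <-> forall m, count_classes P m = count_classes Q m.
Proof.
move=> eP eQ; have tP := repP_transversal eP; have tQ := repP_transversal eQ.
rewrite pres_iso_on; split=> [iso m|h].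
  have cnt := equinum_of_iso eP eQ tP tQ iso; apply/equinum_count.
  have [[u cu]|nP] := pselect (exists u, class_rep P m u).
    have /and3P[du ru /eqP <-] := cu.
    by rewrite -(reps_like_cls eP eP du) -(reps_like_cls eP eQ du).
  have [[u cu]|nQ] := pselect (exists u, class_rep Q m u).
    have /and3P[du ru /eqP <-] := cu.
    by rewrite -(reps_like_cls eQ eP du) -(reps_like_cls eQ eQ du).
  move=> j; split=> -[l [ul sl le]]; exists l; split=> // x /le cx;
    [case: nP|case: nQ]; by exists x.
apply: (iso_of_equinum eP eQ tP tQ) => K.
have [[u [ru eu]]|nP] := pselect (exists u, reps_like (relP P) (repP P) K u).
  have du : domb P u by case/andP: ru.
  rewrite -(reps_like_eq _ _ eu) -(reps_like_eq _ _ eu).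
  by rewrite (reps_like_cls eP eP du) (reps_like_cls eP eQ du); apply/equinum_count.
have [[u [ru eu]]|nQ] := pselect (exists u, reps_like (relP Q) (repP Q) K u).
  have du : domb Q u by case/andP: ru.
  rewrite -(reps_like_eq _ _ eu) -(reps_like_eq _ _ eu).
  by rewrite (reps_like_cls eQ eP du) (reps_like_cls eQ eQ du); apply/equinum_count.
move=> j; split=> -[l [ul sl le]]; exists l; split=> // x /le cx;
  [case: nP|case: nQ]; by exists x.
Qed.

(** [EqIsoProblem] asks only the first presentation to be an equivalence structure; this is why
    testing both in [iso_check] loses nothing. *)
Lemma equiv_transfer P Q : equiv_on (domP P) (relP P) ->
  iso_on (domP P) (domP Q) (relP P) (relP Q) -> equiv_on (domP Q) (relP Q).
Proof.
move=> eP [f [g [fD [gD [gf [fg fE]]]]]].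
have dE u v : relP Q u v -> domP Q u /\ domP Q v by case/and3P.
have gE u v : domP Q u -> domP Q v -> relP Q u v <-> relP P (g u) (g v).
  by move=> du dv; have := fE _ _ (gD _ du) (gD _ dv); rewrite !fg // => h; split=> /h.
split=> //.
- by move=> x dx; apply/gE => //; apply: (eq_refl_on eP); apply: gD.
- move=> x y xy; have [dx dy] := dE _ _ xy; move: xy => /(gE _ _ dx dy) xy.
  by apply/gE => //; apply: (eq_sym_on eP).
- move=> x y z xy yz; have [dx dy] := dE _ _ xy; have [_ dz] := dE _ _ yz.
  move: xy yz => /(gE _ _ dx dy) xy /(gE _ _ dy dz) yz.
  by apply/gE => //; apply: (eq_trans_on eP xy).
Qed.

Definition equiv_check (P : presentation) (m : nat) : bool :=
  all (fun u => (domb P u ==> relb P u u) &&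
    all (fun v => (relb P u v ==> relb P v u) &&
      all (fun w => relb P u v && relb P v w ==> relb P u w) (words P.1.1 m))
    (words P.1.1 m)) (words P.1.1 m).

Lemma equiv_checkP P : equiv_on (domP P) (relP P) <-> forall m, equiv_check P m.
Proof.
split=> [[d r s t] m|h].
  apply/allP => u _; apply/andP; split; first by apply/implyP/r.
  apply/allP => v _; apply/andP; split; first by apply/implyP/s.
  by apply/allP => w _; apply/implyP => /andP[uv vw]; apply: t uv vw.
have inw m u : domb P u -> size u <= m -> u \in words P.1.1 m.
  by move=> /domb_word wu su; rewrite mem_words wu.
have dE u v : relP P u v -> domP P u /\ domP P v by case/and3P.
split=> //.
- move=> u du; have /allP/(_ u (inw _ u du (leqnn _))) := h (size u).
  by case/andP => /implyP/(_ du).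
- move=> u v uv; have [du dv] := dE _ _ uv; pose m := size u + size v.
  have /allP/(_ u (inw _ u du (leq_addr _ _)))/andP[_] := h m.
  by move=> /allP/(_ v (inw _ v dv (leq_addl _ _)))/andP[/implyP/(_ uv)].
- move=> u v w uv vw; have [du dv] := dE _ _ uv; have [_ dw] := dE _ _ vw.
  pose m := size u + size v + size w.
  have lu : size u <= m by rewrite /m -addnA leq_addr.
  have lv : size v <= m by rewrite /m addnAC leq_addl.
  have lw : size w <= m by rewrite /m leq_addl.
  have /allP/(_ u (inw m u du lu))/andP[_] := h m.
  move=> /allP/(_ v (inw m v dv lv))/andP[_].
  move=> /allP/(_ w (inw m w dw lw))/implyP; apply.
  by apply/andP.
Qed.

(** One [m] serves as the length bound for testing the axioms and as the class size compared;
    [m = 0] compares the infinite classes. *)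
Definition iso_check (PQ : presentation * presentation) (m : nat) : bool :=
  [&& equiv_check PQ.1 m, equiv_check PQ.2 m & count_classes PQ.1 m == count_classes PQ.2 m].

Lemma iso_checkP P Q :
  is_equiv_structure P /\ pres_iso P Q <-> forall m, iso_check (P, Q) m.
Proof.
rewrite equiv_onP; split=> [[eP iso] m|h].
  have eQ := equiv_transfer eP ((pres_iso_on _ _).1 iso).
  apply/and3P; split; [exact: (iffLR (equiv_checkP _) eP)|exact: (iffLR (equiv_checkP _) eQ)|].
  exact/eqP/(iffLR (iso_count eP eQ) iso).
have eP : equiv_on (domP P) (relP P) by apply/equiv_checkP => m; have /and3P[] := h m.
have eQ : equiv_on (domP Q) (relP Q) by apply/equiv_checkP => m; have /and3P[] := h m.
by split=> //; apply/iso_count => // m; have /and3P[_ _ /eqP] := h m.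
Qed.

(** * Computability of the check *)

(** The states from which the rest of the word is accepted. As a fold over the word this fits the
    closure properties of [cmp], unlike [nfa_run], which branches into recursive calls through
    [has]. *)
Definition backward (A : nfa) (w : seq letter) : seq nat :=
  foldr (fun a S => [seq t.1.1 | t <- [seq t <- A.2 | (t.1.2 == a) && (t.2 \in S)]]) A.1.2 w.

Lemma accepts_backward A w : nfa_accepts A w = (A.1.1 \in backward A w).
Proof.
rewrite /nfa_accepts /nfa_start /nfa_final /nfa_delta /backward; elim: w A.1.1 => //= a w IH q.
apply/hasP/mapP => [[t tA /and3P[/eqP <- ta]]|[t]].
  by rewrite IH => ht; exists t => //; rewrite mem_filter ta ht.
rewrite mem_filter -andbA => /and3P[ta tS tA] ->; exists t => //.
by rewrite eqxx ta IH.
Qed.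

Lemma cmp_backward : cmp (fun p : nfa * seq letter => backward p.1 p.2).
Proof. by rewrite /backward; cmp_tac. Qed.

Lemma cmp_accepts : cmp (fun p : nfa * seq letter => nfa_accepts p.1 p.2).
Proof.
apply: cmp_ext (fun p => esym (accepts_backward p.1 p.2)) _.
apply: cmp_mem; first by cmp_tac.
exact: cmp_backward.
Qed.

Lemma cmp_words : cmp (fun p : nat * nat => words p.1 p.2).
Proof. by rewrite /words /exact_words; cmp_tac. Qed.

Lemma cmp_domb : cmp (fun p : presentation * word => domb p.1 p.2).
Proof.
rewrite /domb /is_word.
apply: (@cmp_ext _ _ _ _ (fun p : presentation * word => all (fun a => a < p.1.1.1) p.2 &&
   nfa_accepts p.1.1.2 (map (fun a => [:: a.+1]) p.2))) => [p|]; first by rewrite conv1E.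
apply: cmp_and; first by cmp_tac.
by apply: (cmp_fun2 cmp_accepts); cmp_tac.
Qed.

Lemma cmp_relb : cmp (fun p : presentation * (word * word) => relb p.1 p.2.1 p.2.2).
Proof.
rewrite /relb.
apply: cmp_and; first by apply: (cmp_fun2 cmp_domb); cmp_tac.
apply: cmp_and; first by apply: (cmp_fun2 cmp_domb); cmp_tac.
apply: (cmp_fun2 cmp_accepts); first by cmp_tac.
apply: (@cmp_ext _ _ _ _ (fun p : presentation * (word * word) => conv2 p.2.1 p.2.2)) => [p|].
  by rewrite conv2E.
by rewrite /conv2; cmp_tac.
Qed.

Lemma cmp_state_bound : cmp state_bound.
Proof.
change (cmp (fun A : nfa => (foldr (fun t n => t.2 + n) A.1.1 A.2).+1)).
by cmp_tac.
Qed.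

Lemma cmp_num_states : cmp num_states.
Proof.
change (cmp (fun P : presentation => state_bound P.1.2 + state_bound P.2)).
by apply: cmp_add; apply: (cmp_comp cmp_state_bound); cmp_tac.
Qed.

Lemma cmp_gap : cmp gap.
Proof.
change (cmp (fun P => 2 ^ num_states P * 2 ^ num_states P)).
by have h := cmp_num_states; cmp_tac; apply: (cmp_comp h); cmp_tac.
Qed.

Lemma cmp_infb : cmp (fun p : presentation * word => infb p.1 p.2).
Proof.
rewrite /infb; have g := cmp_gap; cmp_step.
  cmp_step; last by apply: (cmp_fun3 cmp_relb); cmp_tac.
  by cmp_tac; apply: (cmp_comp g); cmp_tac.
by apply: (cmp_fun2 cmp_words); cmp_tac; apply: (cmp_comp g); cmp_tac.
Qed.

Lemma cmp_csize : cmp (fun p : presentation * word => csize p.1 p.2).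
Proof.
rewrite /csize; have g := cmp_gap; cmp_step; cmp_step.
  by apply: (cmp_fun3 cmp_relb); cmp_tac.
by apply: (cmp_fun2 cmp_words); cmp_tac; apply: (cmp_comp g); cmp_tac.
Qed.

Lemma cmp_cls : cmp (fun p : presentation * word => cls p.1 p.2).
Proof. by rewrite /cls; cmp_step; [exact: cmp_infb|cmp_tac|exact: cmp_csize]. Qed.

Lemma cmp_numeral : cmp (fun p : nat * word => numeral p.1 p.2).
Proof. by rewrite /numeral; cmp_tac. Qed.

Lemma cmp_repb : cmp (fun p : presentation * word => repb p.1 p.2).
Proof.
rewrite /repb; cmp_step; last by apply: (cmp_fun2 cmp_words); cmp_tac.
cmp_step; first by apply: (cmp_fun3 cmp_relb); cmp_tac.
by cmp_step; apply: (cmp_fun2 cmp_numeral); cmp_tac.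
Qed.

Lemma cmp_class_rep : cmp (fun p : presentation * (nat * word) => class_rep p.1 p.2.1 p.2.2).
Proof.
rewrite /class_rep; cmp_step; first by apply: (cmp_fun2 cmp_domb); cmp_tac.
cmp_step; first by apply: (cmp_fun2 cmp_repb); cmp_tac.
by cmp_step; [apply: (cmp_fun2 cmp_cls)|]; cmp_tac.
Qed.

Lemma cmp_rep_bound : cmp (fun p : presentation * nat => rep_bound p.1 p.2).
Proof.
rewrite /rep_bound; have h := cmp_num_states.
by cmp_tac; apply: (cmp_comp h); cmp_tac.
Qed.

Lemma cmp_count : cmp (fun p : presentation * nat => count_classes p.1 p.2).
Proof.
rewrite /count_classes.
have b := cmp_rep_bound.
have l : cmp (fun p : presentation * nat =>
    filter (fun u => class_rep p.1 p.2 u) (words p.1.1.1 (rep_bound p.1 p.2 + rep_bound p.1 p.2))).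
  cmp_step; first by apply: (cmp_fun3 cmp_class_rep); cmp_tac.
  by apply: (cmp_fun2 cmp_words); cmp_tac.
apply: cmp_if.
- cmp_step => //; cmp_step; first by apply: (cmp_fun2 b); cmp_tac.
  by cmp_tac.
- by cmp_tac.
- by cmp_step; [cmp_tac|cmp_step].
Qed.

Lemma cmp_equiv_check : cmp (fun p : presentation * nat => equiv_check p.1 p.2).
Proof.
rewrite /equiv_check; repeat first
  [apply: (cmp_fun3 cmp_relb)|apply: (cmp_fun2 cmp_domb)|apply: (cmp_fun2 cmp_words)|cmp_step].
Qed.

Lemma cmp_iso_check :
  cmp (fun p : (presentation * presentation) * nat => iso_check p.1 p.2).
Proof.
rewrite /iso_check; cmp_step; first by apply: (cmp_fun2 cmp_equiv_check); cmp_tac.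
cmp_step; first by apply: (cmp_fun2 cmp_equiv_check); cmp_tac.
by cmp_step; apply: (cmp_fun2 cmp_count); cmp_tac.
Qed.

(** * Recognizing the codes of presentations *)

Lemma cd_natseq (l : seq nat) : cd l = CodeSeq.code l.
Proof. by elim: l => //= x l ->. Qed.

(** Numbers that code nothing are outside [EqIsoProblem], so the decision procedure has to detect
    them. *)
Definition validates {T : Type} {cT : code T} (P : nat -> bool) : Prop :=
  cmp P /\ forall n, P n <-> exists x : T, cd x = n.

(** On codes, decoding is the identity, since a list of numbers is coded by [CodeSeq.code]. *)
Lemma cmp_decode : cmp CodeSeq.decode.
Proof.
exists id => [|n]; first by rewrite /tot1; apply: totk_proj.
by rewrite cd_natseq CodeSeq.decodeK.
Qed.

Lemma validates_nat : validates (T := nat) (fun=> true).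
Proof. by split=> [|n]; [exact: cmp_const|split=> // _; exists n]. Qed.

Lemma validates_seq (T : Type) (cT : code T) (P : nat -> bool) :
  validates (T := T) P -> validates (T := seq T) (fun n => all (fun x => P x) (CodeSeq.decode n)).
Proof.
move=> [cP hP]; split.
  have d := cmp_decode; apply: (@cmp_all _ _ _ _ (fun _ x => P x)) => //.
  by apply: (cmp_comp cP); cmp_tac.
move=> n; rewrite -{2}[n]CodeSeq.decodeK; elim: (CodeSeq.decode n) => [|x l IH] /=.
  by split=> // _; exists [::].
split=> [/andP[/hP[a <-] /IH[s <-]]|[[|a s]]]; first by exists (a :: s).
  by move=> e; have := cns_neq0 x (CodeSeq.code l); rewrite -[cns _ _]e.
move=> e; have := congr1 hd e; have := congr1 tl e.
rewrite -/(cns x (CodeSeq.code l)) /= !tl_cns !hd_cns => e1 e2.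
by apply/andP; split; [apply/hP; exists a|apply/IH; exists s].
Qed.

Lemma validates_prod (A B : Type) (cA : code A) (cB : code B) (P Q : nat -> bool) :
  validates (T := A) P -> validates (T := B) Q ->
  validates (T := (A * B)%type) (fun n => let l := CodeSeq.decode n in
    (size l == 2) && (P (head 0 l) && Q (head 0 (behead l)))).
Proof.
move=> [cP hP] [cQ hQ]; split.
  have d := cmp_decode; cbv zeta; cmp_step; first by cmp_tac.
  by cmp_step; [apply: (cmp_comp cP)|apply: (cmp_comp cQ)]; cmp_tac.
move=> n; cbv zeta; split=> [/andP[]|[[a b] <-]].
  have := CodeSeq.decodeK n; case: (CodeSeq.decode n) => [|x [|y []]] // <- _ /=.
  by move=> /andP[/hP[a ea] /hQ[b eb]]; exists (a, b); rewrite -ea -eb.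
have -> : cd (a, b) = CodeSeq.code [:: cd a; cd b] by [].
rewrite CodeSeq.codeK /=; apply/andP; split; first by apply/hP; exists a.
by apply/hQ; exists b.
Qed.

Lemma validates_presentations : exists P, validates (T := (presentation * presentation)%type) P.
Proof.
have [vn vs] := (validates_nat, @validates_seq).
have vsn := vs _ _ _ vn.
have vnfa := validates_prod (validates_prod vn vsn) (vs _ _ _ (validates_prod (validates_prod vn vsn) vn)).
have vp := validates_prod (validates_prod vn vnfa) vnfa.
by eexists; apply: (validates_prod vp vp).
Qed.

(** The problem is stated with [pickle], computability with [cd]. Both code a pair as a list of two
    numbers, so the changes of form in the proof hold by conversion. *)
Lemma pickle_cd (x : presentation * presentation) : pickle x = cd x.
Proof.
have en (l : seq nat) : pickle l = cd l by rewrite cd_natseq /pickle /= /pickle_seq map_id.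
have es (T : countType) (cT : code T) (l : seq T) : (forall x : T, pickle x = cd x) -> pickle l = cd l.
  by move=> e; rewrite /pickle /= /pickle_seq; elim: l => //= a l ->; rewrite e.
have et (t : nat * letter * nat) : pickle t = cd t.
  case: t => [[a l] b]; rewrite -[LHS]/(CodeSeq.code [:: CodeSeq.code [:: a; pickle l]; b]).
  by rewrite en.
have eA (A : nfa) : pickle A = cd A.
  case: A => [[a f] d]; rewrite -[LHS]/(CodeSeq.code [:: CodeSeq.code [:: a; pickle f]; pickle d]).
  by rewrite en es.
have eP (P : presentation) : pickle P = cd P.
  case: P => [[a f] d]; rewrite -[LHS]/(CodeSeq.code [:: CodeSeq.code [:: a; pickle f]; pickle d]).
  by rewrite !eA.
case: x => P Q; rewrite -[LHS]/(CodeSeq.code [:: pickle P; pickle Q]).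
by rewrite !eP.
Qed.

Lemma EqIso_Pi01 : Pi01 EqIsoProblem.
Proof.
have [V [[FV tV hV] Vv]] := validates_presentations.
have [F tF hF] := cmp_iso_check.
(* The value 0 means true, so the check is negated by [1 - _]; the product with the test for codes
   makes [f] positive on numbers that code nothing. *)
pose f n m := 1 - (FV n * F (cns n (cns m 0))).
have tf : tot2 f.
  rewrite /tot2 /f; have s := tot_sub; have m := tot_mul; have c := tot_cns.
  by apply: (totk_tot2 s); [exact: totk_const|apply: (totk_tot2 m);
    [apply: (totk_tot1 tV)|apply: (totk_tot1 tF)]; totk_tac].
case: tf => p hp; exists p; split=> [n m|n].
  by eexists; apply: (hp [:: n; m]).
have pE m : peval p [:: n; m] 0 <-> f n m = 0.
  have h := hp [:: n; m] erefl; split=> [h0|e]; last by rewrite -e; apply: h.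
  exact: peval_det h h0.
have eV : FV n = V n := hV n.
case vn : (V n); last first.
  split=> [|/(_ 0)/pE]; last by rewrite /f eV vn.
  rewrite /EqIsoProblem; case e : (pickle_inv n) => [x|] //.
  have := @pickle_invK (presentation * presentation)%type n; rewrite e /= => ex.
  by have : V n; [apply/Vv; exists x; rewrite -pickle_cd|rewrite vn].
have [[P Q] ePQ] := (Vv n).1 vn.
have -> : EqIsoProblem n <-> forall m, iso_check (P, Q) m.
  rewrite -iso_checkP /EqIsoProblem -{1}ePQ -pickle_cd.
  by rewrite pickleK_inv.
have fE m : f n m = 1 - iso_check (P, Q) m.
  rewrite /f eV vn mul1n -ePQ; congr (1 - _); exact: (hF ((P, Q), m)).
split=> h m; first by apply/pE; rewrite fE h.
by have /pE := h m; rewrite fE; case: iso_check.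
Qed.

(** * Register programs as regular expressions *)

Inductive regex : Type :=
  | Eps : regex
  | Chr : nat -> regex
  | Cat : regex -> regex -> regex
  | Alt : regex -> regex -> regex
  | Star : regex -> regex.

Fixpoint lang (e : regex) : seq nat -> Prop :=
  match e with
  | Eps => fun w => w = [::]
  | Chr a => fun w => w = [:: a]
  | Cat e1 e2 => fun w => exists u v, [/\ w = u ++ v, lang e1 u & lang e2 v]
  | Alt e1 e2 => fun w => lang e1 w \/ lang e2 w
  | Star e1 => fun w => exists ws : seq (seq nat), w = flatten ws /\
                 forall i, i < size ws -> lang e1 (nth [::] ws i)
  end.

(* Letters: 0 increments register 0 (it is reserved for the input), 1 to 4 leave the registers
   unchanged, and the others are the increments, decrements and zero tests of registers. *)
Definition Inc (r : nat) : nat := 5 + 3 * r.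
Definition Dec (r : nat) : nat := 6 + 3 * r.
Definition Zero (r : nat) : nat := 7 + 3 * r.

Definition incs (r a : nat) : bool := (a == Inc r) || (r == 0) && (a == 0).
Definition decs (r a : nat) : bool := a == Dec r.

(** Integers, because a decrement is always possible and may lead below zero. *)
Definition store : Type := nat -> int.


Definition act (a : nat) (s : store) : store :=
  fun r => (s r + (incs r a : nat)%:Z - (decs r a : nat)%:Z)%R.
Definition test (a : nat) (s : store) : bool := (7 <= a)%N && (a %% 3 == 1)%N ==> (s ((a - 7) %/ 3)%N == 0%R).

Fixpoint run (s : store) (w : seq nat) : option store :=
  if w is a :: w' then if test a s then run (act a s) w' else None else Some s.

Definition upd (s : store) (r : nat) (v : int) : store := fun x => if x == r then v else s x.

Lemma run_cat s u v : run s (u ++ v) = obind (fun s' => run s' v) (run s u).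
Proof. by elim: u s => //= a u IH s; case: ifP. Qed.

Definition sem (e : regex) (s s' : store) : Prop := exists2 w, lang e w & run s w = Some s'.

Lemma sem_eps s s' : sem Eps s s' <-> s' = s.
Proof. by split=> [[_ -> [->]]|->]; last by exists [::]. Qed.

Lemma sem_chr a s s' : sem (Chr a) s s' <-> test a s /\ s' = act a s.
Proof.
split=> [[_ -> /=]|[h ->]]; first by case: ifP => // _ [].
by exists [:: a] => //=; rewrite h.
Qed.

Lemma sem_cat e1 e2 s s' : sem (Cat e1 e2) s s' <-> exists2 t, sem e1 s t & sem e2 t s'.
Proof.
split=> [[_ [u [v [-> lu lv]]]]|[t [u lu ru] [v lv rv]]].
  rewrite run_cat; case e : (run s u) => [t|] //= rv.
  by exists t; [exists u|exists v].
by exists (u ++ v); [exists u, v|rewrite run_cat ru].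
Qed.

Inductive reach (R : store -> store -> Prop) : nat -> store -> store -> Prop :=
  | reach0 s : reach R 0 s s
  | reachS n s t u : R s t -> reach R n t u -> reach R n.+1 s u.

Lemma sem_star e s s' : sem (Star e) s s' <-> exists n, reach (sem e) n s s'.
Proof.
split=> [[_ [ws [-> h]]]|[n h]].
  elim: ws s h => [|w ws IH] s h /=; first by move=> [<-]; exists 0; apply: reach0.
  rewrite run_cat; case e1 : (run s w) => [t|] //= rv.
  have [n hn] := IH t (fun i => h i.+1) rv.
  by exists n.+1; apply: reachS hn; exists w => //; apply: (h 0).
elim: h => [{}s|{}n {}s t u [w lw rw] _ [_ [ws [-> h]] rws]].
  by exists [::] => //; exists [::].
exists (w ++ flatten ws); last by rewrite run_cat rw.
by exists (w :: ws); split=> // -[|i] //= /h.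
Qed.

Lemma incs_Inc r x : incs x (Inc r) = (x == r).
Proof. by rewrite /incs andbF orbF; apply/eqP/eqP; rewrite /Inc; lia. Qed.
Lemma incs_Dec r x : incs x (Dec r) = false.
Proof. by rewrite /incs andbF orbF; apply/eqP; rewrite /Inc /Dec; lia. Qed.
Lemma incs_Zero r x : incs x (Zero r) = false.
Proof. by rewrite /incs andbF orbF; apply/eqP; rewrite /Inc /Zero; lia. Qed.
Lemma decs_Inc r x : decs x (Inc r) = false.
Proof. by apply/eqP; rewrite /Inc /Dec; lia. Qed.
Lemma decs_Dec r x : decs x (Dec r) = (x == r).
Proof. by apply/eqP/eqP; rewrite /Dec; lia. Qed.
Lemma decs_Zero r x : decs x (Zero r) = false.
Proof. by apply/eqP; rewrite /Zero /Dec; lia. Qed.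

Lemma act_Inc r s : act (Inc r) s = upd s r (s r + 1)%R.
Proof. by apply/funext => x; rewrite /act /upd incs_Inc decs_Inc; case: eqP => [->|_] /=; lia. Qed.
Lemma act_Dec r s : act (Dec r) s = upd s r (s r - 1)%R.
Proof. by apply/funext => x; rewrite /act /upd incs_Dec decs_Dec; case: eqP => [->|_] /=; lia. Qed.
Lemma act_Zero r s : act (Zero r) s = s.
Proof. by apply/funext => x; rewrite /act incs_Zero decs_Zero /=; lia. Qed.
Lemma test_Inc r s : test (Inc r) s.
Proof. by apply/implyP => /andP[_ /eqP]; rewrite /Inc; lia. Qed.
Lemma test_Dec r s : test (Dec r) s.
Proof. by apply/implyP => /andP[_ /eqP]; rewrite /Dec; lia. Qed.
Lemma test_Zero r s : test (Zero r) s = (s r == 0%R).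
Proof.
have -> : r = ((Zero r - 7) %/ 3)%N by rewrite /Zero addKn mulKn.
rewrite /test /Zero (_ : (_ && _) = true) ?implyTb; last by apply/andP; split=> //; apply/eqP; lia.
by rewrite addKn mulKn // addKn mulKn.
Qed.

Lemma sem_Inc r s s' : sem (Chr (Inc r)) s s' <-> s' = upd s r (s r + 1)%R.
Proof. by rewrite sem_chr test_Inc act_Inc; split=> [[]|]. Qed.
Lemma sem_Dec r s s' : sem (Chr (Dec r)) s s' <-> s' = upd s r (s r - 1)%R.
Proof. by rewrite sem_chr test_Dec act_Dec; split=> [[]|]. Qed.
Lemma sem_Zero r s s' : sem (Chr (Zero r)) s s' <-> s r = 0%R /\ s' = s.
Proof. by rewrite sem_chr test_Zero act_Zero; split=> -[/eqP ? ?]. Qed.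

Lemma sem_cat_det e1 e2 s t s' : (forall u, sem e1 s u <-> u = t) ->
  sem (Cat e1 e2) s s' <-> sem e2 t s'.
Proof.
move=> h; rewrite sem_cat; split=> [[u /h ->] //|h']; exists t => //; exact/h.
Qed.

Definition Loop (r : nat) (e : regex) : regex := Cat (Star (Cat (Chr (Dec r)) e)) (Chr (Zero r)).

(* A loop whose body does not change its counter cannot terminate from a negative counter, so
   no positivity test is needed. *)
Lemma sem_loop r e (J : store -> Prop) s s' :
  (forall s s', J s -> sem (Cat (Chr (Dec r)) e) s s' -> s' r = (s r - 1)%R /\ J s') -> J s ->
  sem (Loop r e) s s' <-> exists n : nat, s r = n /\ reach (sem (Cat (Chr (Dec r)) e)) n s s'.
Proof.
move=> hJ Js; have inv n t t' : J t -> reach (sem (Cat (Chr (Dec r)) e)) n t t' -> t' r = (t r - n%:Z)%R.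
  move=> Jt h; elim: h Jt => [{}t|{}n {}t u v tu _ IH] Jt; first by lia.
  by have [e1 Ju] := hJ _ _ Jt tu; rewrite IH // e1; lia.
rewrite sem_cat; split=> [[t /sem_star[n hn] /sem_Zero[tr ->]]|[n [sr hn]]].
  by exists n; split=> //; have := inv _ _ _ Js hn; lia.
exists s'; first by apply/sem_star; exists n.
by apply/sem_Zero; split=> //; have := inv _ _ _ Js hn; lia.
Qed.

Lemma upd_same s r v : upd s r v r = v. Proof. by rewrite /upd eqxx. Qed.
Lemma upd_other s r v x : x != r -> upd s r v x = s x. Proof. by rewrite /upd => /negbTE ->. Qed.
Lemma upd_upd s r v v' : upd (upd s r v) r v' = upd s r v'.
Proof. by apply/funext => x; rewrite /upd; case: eqP. Qed.
Lemma upd_id s r : upd s r (s r) = s.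
Proof. by apply/funext => x; rewrite /upd; case: eqP => [->|]. Qed.

(** [f n] is a proposed closed form for the [n]-fold iterate of a loop body; the two equations are
    what the iterates satisfy. *)
Lemma reach_det R (f : nat -> store -> store) n s s' :
  (forall s, f 0%N s = s) -> (forall n s, f n.+1 s = f n (f 1%N s)) ->
  (forall s s', R s s' <-> s' = f 1%N s) -> reach R n s s' <-> s' = f n s.
Proof.
move=> f0 fS hR; split=> [h|->].
  elim: h => [{}s|{}n {}s t u /hR -> _ ->]; first by rewrite f0.
  by rewrite -fS.
elim: n s => [|n IH] s; first by rewrite f0; apply: reach0.
by rewrite fS; apply: reachS (IH _); apply/hR.
Qed.

Ltac store_tac := apply/funext => ?; rewrite /upd;
  repeat (match goal with
    | |- context [?a == ?b] => case: (altP (a =P b)) => ?; subst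
    end); try congruence;
  repeat (match goal with
    | H : is_true (?a != ?a) |- _ => by rewrite eqxx in H
    end); try lia.

Definition Clear (r : nat) : regex := Loop r Eps.
Definition Move (r t : nat) : regex := Loop r (Chr (Inc t)).
Definition Copy (r t u : nat) : regex :=
  Cat (Loop r (Cat (Chr (Inc t)) (Chr (Inc u)))) (Move u r).

(** Clearing succeeds only from a nonnegative value. Hence [Dec] followed by [Clear] is a test for
    positivity, which the programs for [PMu] and for [refuter] use. *)
Lemma sem_clear r s s' : sem (Clear r) s s' <-> exists n : nat, s r = n /\ s' = upd s r 0%R.
Proof.
have body t t' : sem (Cat (Chr (Dec r)) Eps) t t' <-> t' = upd t r (t r - 1)%R.
  by rewrite (sem_cat_det _ _ (sem_Dec r t)) sem_eps.
rewrite (sem_loop (J := fun=> True)) //; last by move=> t t' _ /body ->; rewrite upd_same.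
pose f (n : nat) (t : store) := upd t r (t r - n%:Z)%R.
have f0 t : f 0 t = t by rewrite /f subr0 upd_id.
have fS n t : f n.+1 t = f n (f 1 t).
  by rewrite /f upd_same upd_upd; congr upd; lia.
have fE (n : nat) : s r = n -> f n s = upd s r 0%R by move=> e; rewrite /f e subrr.
split=> -[n [sr e]]; exists n; split=> //.
  by move: e => /(reach_det _ _ _ f0 fS body) ->; apply: fE.
by apply/(reach_det _ _ _ f0 fS body); rewrite e fE.
Qed.

Lemma sem_move (r t : nat) (s s' : store) (n : nat) : r != t -> s r = n ->
  sem (Move r t) s s' <-> s' = upd (upd s r 0%R) t (s t + n%:Z)%R.
Proof.
move=> rt sr.
have body u u' : sem (Cat (Chr (Dec r)) (Chr (Inc t))) u u' <-> u' = upd (upd u r (u r - 1)%R) t (u t + 1)%R.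
  by rewrite (sem_cat_det _ _ (sem_Dec r u)) sem_Inc (upd_other _ _ (x := t)) // eq_sym.
rewrite (sem_loop (J := fun=> True)) //; last first.
  by move=> u u' _ /body ->; rewrite upd_other // upd_same.
have h m := @reach_det _ (fun n u => upd (upd u r (u r - n%:Z)%R) t (u t + n%:Z)%R) m s s' _ _ body.
have {h} h m : reach (sem (Cat (Chr (Dec r)) (Chr (Inc t)))) m s s' <->
    s' = upd (upd s r (s r - m%:Z)%R) t (s t + m%:Z)%R.
  apply: h => [u|k u]; apply/funext => x; rewrite /upd.
    by case: eqP => [->|_]; [lia|case: eqP => [->|_]; lia].
  rewrite (negbTE rt) !eqxx.
  by case: (x == t); [lia|case: (x == r); [lia|]].
split=> [[m [e /h ->]]|e].
  have -> : m = n by lia.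
  by rewrite sr subrr.
by exists n; split=> //; apply/h; rewrite sr subrr e.
Qed.

Lemma sem_copy (r t u : nat) (s s' : store) (n : nat) : r != t -> r != u -> t != u -> s r = n -> s u = 0%R ->
  sem (Copy r t u) s s' <-> s' = upd s t (s t + n%:Z)%R.
Proof.
move=> rt ru tu sr su.
pose f (m : nat) (v : store) : store := fun x => if x == r then (v r - m%:Z)%R else
  if x == t then (v t + m%:Z)%R else if x == u then (v u + m%:Z)%R else v x.
have body (v v' : store) : sem (Cat (Chr (Dec r)) (Cat (Chr (Inc t)) (Chr (Inc u)))) v v' <-> v' = f 1%N v.
  rewrite (sem_cat_det _ _ (sem_Dec r v)) (sem_cat_det _ _ (sem_Inc t _)) sem_Inc.
  have -> // : upd (upd (upd v r (v r - 1)%R) t (upd v r (v r - 1)%R t + 1)%R) u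
     (upd (upd v r (v r - 1)%R) t (upd v r (v r - 1)%R t + 1)%R u + 1)%R = f 1%N v.
  by rewrite /f; store_tac.
have f0 v : f 0%N v = v by rewrite /f; store_tac.
have fS m v : f m.+1 v = f m (f 1%N v) by rewrite /f; store_tac.
have loop (v v' : store) (m : nat) : v r = m ->
    sem (Loop r (Cat (Chr (Inc t)) (Chr (Inc u)))) v v' <-> v' = f m v.
  move=> vr; rewrite (sem_loop (J := fun=> True)) //; last first.
    by move=> w w' _ /body ->; rewrite /f eqxx.
  split=> [[k [e]]|e].
    by rewrite (reach_det _ _ _ f0 fS body) => ->; congr f; lia.
  by exists m; split=> //; apply/(reach_det _ _ _ f0 fS body).
rewrite (sem_cat_det _ _ (fun v => loop s v n sr)) (@sem_move _ _ _ _ n) 1?eq_sym //; last first.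
  by rewrite /f [u == r]eq_sym (negbTE ru) [u == t]eq_sym (negbTE tu) eqxx su; lia.
suff -> : upd (upd (f n s) u 0%R) r (f n s r + n%:Z)%R = upd s t (s t + n%:Z)%R by [].
by rewrite /f; store_tac.
Qed.

(** * Compiling recursive functions to register programs *)

(** Applied to a register that holds zero, it has no successful trace; it stands for an undefined
    result. *)
Definition Fail (r : nat) : regex := Cat (Chr (Inc r)) (Chr (Zero r)).
Definition clears (rs : seq nat) : regex := foldr (fun r e => Cat (Clear r) e) Eps rs.

(* The code reads the registers [ins], adds its result to [out], which initially holds zero, and
   uses as scratch the registers from [base] on, which it finds and leaves at zero. *)
Fixpoint compile (p : prf) (ins : seq nat) (out base : nat) : regex :=
  match p with
  | PZero => Eps
  | PSucc => if ins is r :: _ then Cat (Copy r out base) (Chr (Inc out)) else Fail out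
  | PProj i => if i < size ins then Copy (nth 0 ins i) out base else Fail out
  | PComp f gs =>
      let n := size gs in
      Cat ((fix comps gs tgt := if gs is g :: gs' then Cat (compile g ins tgt (base + n)) (comps gs' tgt.+1)
                                else Eps) gs base)
          (Cat (compile f (iota base n) out (base + n)) (clears (iota base n)))
  | PPrec f g =>
      if ins is n :: rest then
        let i := base in let r := base.+1 in let r2 := base.+2 in let k := base.+3 in
        let b := base.+4 in
        Cat (compile f rest r b) (Cat (Copy n k b)
          (Cat (Loop k (Cat (compile g (i :: r :: rest) r2 b)
                            (Cat (Clear r) (Cat (Move r2 r) (Chr (Inc i))))))
               (Cat (Clear i) (Move r out))))
      else Fail out
  | PMu f =>
      let i := base in let v := base.+1 in let b := base.+2 in
      Cat (Star (Cat (compile f (i :: ins) v b) (Cat (Chr (Dec v)) (Cat (Clear v) (Chr (Inc i))))))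
          (Cat (compile f (i :: ins) v b) (Cat (Chr (Zero v)) (Move i out)))
  end.

Definition pre (ins : seq nat) (out base : nat) (s : store) (xs : seq nat) : Prop :=
  [/\ all (fun r => r < base) ins, out < base /\ out \notin ins,
      forall i, base <= i -> s i = 0%R, s out = 0%R & map s ins = map Posz xs].

(** An equivalence, because where [p] has no value there must be no successful trace at all. The
    final store [upd s out y] includes that inputs are preserved and scratch registers are back at
    zero, so that code can be nested. *)
Definition correct (p : prf) : Prop :=
  forall ins out base (s : store) xs (s' : store), pre ins out base s xs ->
  sem (compile p ins out base) s s' <-> exists2 y : nat, peval p xs y & s' = upd s out y.

Lemma sem_fail r (s s' : store) : s r = 0%R -> ~ sem (Fail r) s s'.
Proof.
move=> sr; rewrite /Fail (sem_cat_det _ _ (sem_Inc r s)) sem_Zero upd_same sr.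
by case.
Qed.

Lemma pre_nth ins out base (s : store) xs i : pre ins out base s xs -> i < size ins ->
  [/\ size xs = size ins, nth 0 ins i < base, nth 0 ins i != out & s (nth 0 ins i) = nth 0 xs i].
Proof.
move=> [lt [_ no] _ _ e] h.
have sz : size xs = size ins by have := congr1 size e; rewrite !size_map.
split=> //; first by apply: (allP lt); apply: mem_nth.
  by apply: contra no => /eqP <-; apply: mem_nth.
by have := congr1 (fun l => nth 0%R l i) e; rewrite !(nth_map 0) ?sz.
Qed.

Lemma sem_clears (rs : seq nat) (s s' : store) : (forall r, r \in rs -> exists n : nat, s r = n) ->
  sem (clears rs) s s' <-> s' = (fun x => if x \in rs then 0%R else s x).
Proof.
elim: rs s => [|r rs IH] s h; first by rewrite sem_eps.
have [n sr] := h r (mem_head _ _).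
have hc t : sem (Clear r) s t <-> t = upd s r 0%R.
  by rewrite sem_clear; split=> [[m []] //|->]; exists n.
rewrite (sem_cat_det _ _ hc) IH => [|x xr]; last first.
  rewrite /upd; case: eqP => [_|_]; first by exists 0.
  by apply: h; rewrite inE xr orbT.
suff -> : (fun x => if x \in rs then 0%R else upd s r 0%R x) =
  (fun x => if x \in r :: rs then 0%R else s x) by [].
by apply/funext => x; rewrite inE /upd; case: (x == r) => //=; case: ifP.
Qed.

Fixpoint updl (s : store) (tgt : nat) (ys : seq nat) : store :=
  if ys is y :: ys' then updl (upd s tgt y) tgt.+1 ys' else s.

Lemma updlE (s : store) tgt ys x :
  updl s tgt ys x = if tgt <= x < tgt + size ys then Posz (nth 0 ys (x - tgt)) else s x.
Proof.
elim: ys s tgt => [|y ys IH] s tgt /=; first by case: ifP => //; lia.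
rewrite IH /upd addSnnS; case: (ltngtP tgt x) => [lt|lt|<-] /=.
- by have -> : x - tgt = (x - tgt.+1).+1 by lia.
- by [].
- by rewrite subnn addnS ltnS leq_addr.
Qed.

Lemma upd_zero (s : store) r : s r = 0%R -> upd s r (Posz 0) = s.
Proof. by move=> e; rewrite -[RHS](upd_id s r) e. Qed.

Lemma correct_zero : correct PZero.
Proof.
move=> ins out base s xs s' [_ _ _ so _]; rewrite sem_eps.
split=> [->|[y /peval_zeroP -> ->]]; last exact: upd_zero.
by exists 0; [exact/peval_zeroP|rewrite upd_zero].
Qed.

Lemma correct_succ : correct PSucc.
Proof.
move=> ins out base s xs s' h; case: ins h => [|r ins] h.
  have [_ _ _ so e] := h; split=> [/(sem_fail so)//|[y /peval_succP[]]].
  by case: xs e {h}.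
have [_ [ob _] z so _] := h; have [sz rb ro sr] := @pre_nth _ _ _ _ _ 0 h isT.
rewrite /= (sem_cat_det _ _ (fun t => @sem_copy r out base s t (nth 0 xs 0) _ _ _ sr (z _ (leqnn _)))) //;
  try by apply/eqP; move: rb ob => /=; lia.
rewrite sem_Inc upd_same upd_upd so.
have -> : (0 + (nth 0 xs 0)%:Z + 1 = (nth 0 xs 0).+1%:Z)%R by lia.
split=> [->|[y /peval_succP[_ ->] //]].
by exists (nth 0 xs 0).+1 => //; apply/peval_succP; rewrite sz.
Qed.

Lemma correct_proj i : correct (PProj i).
Proof.
move=> ins out base s xs s' h /=; have [_ [ob _] z so e] := h.
have sz : size xs = size ins by have := congr1 size e; rewrite !size_map.
case: ltnP => hi; last first.
  by split=> [/(sem_fail so)//|[y /peval_projP[]]]; rewrite sz ltnNge hi.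
have [_ rb ro sr] := pre_nth h hi.
rewrite (@sem_copy (nth 0 ins i) out base s _ (nth 0 xs i)) //; last first.
- exact: z.
- by apply/eqP; lia.
- by apply/eqP; lia.
rewrite so add0r; split=> [->|[y /peval_projP[_ ->] //]].
by exists (nth 0 xs i) => //; apply/peval_projP; rewrite sz.
Qed.

Lemma map_upd (s : store) r v ins : r \notin ins -> map (upd s r v) ins = map s ins.
Proof.
move=> h; apply/eq_in_map => x xi; apply: upd_other; apply: contra h => /eqP <- //.
Qed.

Lemma notin_lt (ins : seq nat) b r : all (fun x => x < b) ins -> b <= r -> r \notin ins.
Proof. by move=> /allP h br; apply/negP => /h; lia. Qed.

Lemma correct_comp f gs : correct f -> (forall i, i < size gs -> correct (nth PZero gs i)) ->
  correct (PComp f gs).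
Proof.
move=> Cf Cg ins out base s xs s' h /=; have [lt [ob no] z so e] := h.
set n := size gs; set comps := (X in Cat (X gs base) _).
have compsP gs' tgt (t t' : store) : base <= tgt -> tgt + size gs' <= base + n ->
    (forall i, i < size gs' -> correct (nth PZero gs' i)) ->
    map t ins = map Posz xs -> (forall i, tgt <= i -> t i = 0%R) ->
    sem (comps gs' tgt) t t' <-> exists2 ys, pevals gs' xs ys & t' = updl t tgt ys.
  elim: gs' tgt t t' => [|g gs' IH] tgt t t' bt tn C mt zt.
    rewrite sem_eps; split=> [->|[ys /pevalsP[/size0nil -> _] -> //]].
    by exists [::] => //; apply: evs_nil.
  have pg : pre ins tgt (base + n) t xs.
    split=> //; [by apply: sub_all lt => x; lia| | |exact: zt]; last first.
      by move=> i; rewrite /= in tn; move=> hi; apply: zt; lia.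
    by split; [move: tn => /=; lia|apply: notin_lt lt bt].
  have {}IH (y : nat) (u' : store) : sem (comps gs' tgt.+1) (upd t tgt y) u' <->
      exists2 ys, pevals gs' xs ys & u' = updl (upd t tgt y) tgt.+1 ys.
    apply: IH; [lia|by move: tn => /=; lia|by move=> i; apply: (C i.+1)| |].
    - by rewrite map_upd //; apply: notin_lt lt bt.
    - by move=> i ti; rewrite upd_other ?zt //; [lia|apply/eqP; lia].
  rewrite /= sem_cat; split=> [[u /(C 0 isT _ _ _ _ _ _ pg)[y py ->]]|[ys]].
    by move=> /IH[ys pys ->]; exists (y :: ys) => //; apply: evs_cons.
  move=> /pevalsP[]; case: ys => // y ys [sy] hy ->.
  exists (upd t tgt y); first by apply/(C 0 isT _ _ _ _ _ _ pg); exists y => //; apply: (hy 0).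
  by apply/IH; exists ys => //; apply/pevalsP; split=> // i /(hy i.+1).
have pf (ys : seq nat) : size ys = n -> pre (iota base n) out (base + n) (updl s base ys) ys.
  move=> sy; split.
  - by apply/allP => x; rewrite mem_iota; lia.
  - by split; [lia|rewrite mem_iota; apply/negP; lia].
  - by move=> i hi; rewrite updlE sy ifF ?z //; lia.
  - by rewrite updlE ifF //; lia.
  - apply: (@eq_from_nth _ 0%R); rewrite !size_map size_iota // => i hi.
    rewrite !(nth_map 0) ?size_iota ?sy // nth_iota // updlE sy addKn ifT //; lia.
have clr (ys : seq nat) (y : nat) t' : size ys = n ->
    sem (clears (iota base n)) (upd (updl s base ys) out y) t' <-> t' = upd s out y.
  move=> sy; rewrite sem_clears => [|r]; last first.
    rewrite mem_iota => hr; rewrite upd_other; last by apply/eqP; lia.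
    by rewrite updlE sy hr; eexists.
  suff -> : (fun x => if x \in iota base n then 0%R else upd (updl s base ys) out y x) = upd s out y by [].
  apply/funext => x; rewrite mem_iota /upd updlE sy.
  case: (boolP (base <= x < base + n)) => hx //.
  have xo : (x == out) = false by apply: contraTF hx => /eqP ->; rewrite leqNgt ob.
  by rewrite xo z //; case/andP: hx.
have cP u := compsP gs base s u (leqnn _) (leqnn _) Cg e z.
rewrite sem_cat; split=> [[u /cP[ys pys ->] /sem_cat[v]]|[y]].
  have [sy _] := (pevalsP _ _ _).1 pys.
  move=> /(Cf _ _ _ _ _ _ (pf ys sy))[y py ->] /(clr _ _ _ sy) ->.
  by exists y => //; apply/peval_compP; exists ys.
move=> /peval_compP[ys pys py] ->; have [sy _] := (pevalsP _ _ _).1 pys.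
exists (updl s base ys); first by apply/cP => //; exists ys.
apply/sem_cat; exists (upd (updl s base ys) out y); last exact/clr.
by apply/(Cf _ _ _ _ _ _ (pf ys sy)); exists y.
Qed.

Lemma reach_snoc (R : store -> store -> Prop) n s s' :
  reach R n.+1 s s' <-> exists2 t, reach R n s t & R t s'.
Proof.
elim: n s => [|n IH] s.
  split=> [h|[t h1 h2]].
    inversion h as [|? ? t ? st tu]; subst; inversion tu; subst.
    by exists s; [apply: reach0|].
  by inversion h1; subst; apply: reachS h2 (reach0 _ _).
split=> [h|[t h1 h2]].
  inversion h as [|? ? t ? st tu]; subst; move: tu => /IH[u tu us].
  by exists u => //; apply: reachS st tu.
inversion h1 as [|? ? u ? su ut]; subst; apply: reachS su _.
by apply/IH; exists t.
Qed.

Lemma correct_prec f g : correct f -> correct g -> correct (PPrec f g).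
Proof.
move=> Cf Cg ins out base s xs s' h; case: ins h => [|rn ins] h.
  have [_ _ _ so e] := h; split=> [/(sem_fail so)//|[y]].
  by case: xs e {h} => // _ /peval_prec_nil.
have [ltA [ob noA] z so eA] := h.
case: xs eA h => [|n xs] //= [srn e] h.
move: (ltA) => /= /andP[rnb lt]; move: (noA); rewrite inE negb_or => /andP[orn no].
set i := base; set r := base.+1; set r2 := base.+2; set k := base.+3; set b := base.+4.
have ib : base <= i by []. have rb : base <= r by rewrite /r; lia.
(* The stores between iterations: [a] iterations done, current value [c], and [d] iterations
   left. *)
pose st (a c : nat) (d : int) : store := upd (upd (upd s i a) r c) k d.
have stE a c d x : st a c d x =
    if x == k then d else if x == r then Posz c else if x == i then Posz a else s x.
  by [].
have ki : (k == i) = false by apply/eqP; lia.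
have kr : (k == r) = false by apply/eqP; lia.
have ri : (r == i) = false by apply/eqP; lia.
have ltx x : x < base -> [/\ (x == k) = false, (x == r) = false & (x == i) = false].
  by move=> xb; split; apply/eqP; lia.
have stlt a c d x : x < base -> st a c d x = s x.
  by move=> /ltx[e1 e2 e3]; rewrite stE e1 e2 e3.
have stge a c d x : r2 <= x -> x != k -> st a c d x = 0%R.
  move=> rx /negbTE xk; rewrite stE xk !ifF ?z //; try apply/eqP; lia.
have map_st a c d : map (st a c d) ins = map Posz xs.
  by rewrite -e; apply/eq_in_map => x /(allP lt) xb; rewrite stlt.
have pf : pre ins r b s xs.
  split=> //; [by apply: sub_all lt => x; lia| |by move=> x hx; apply: z; lia|by apply: z; lia].
  by split; [lia|apply: notin_lt lt _; lia].
have pg a c d : pre (i :: r :: ins) r2 b (st a c d) (a :: c :: xs).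
  split.
  - by rewrite /= !(fun h => sub_all h lt) ?andbT //; [lia|move=> x; lia].
  - split; first by lia.
    by rewrite !inE !negb_or (notin_lt lt) ?andbT; [apply/andP; split; apply/eqP; lia|lia].
  - by move=> x hx; apply: stge; [lia|apply/eqP; lia].
  - by apply: stge => //; apply/eqP; lia.
  - by rewrite /= map_st !stE [i == k]eq_sym ki [i == r]eq_sym ri [r == k]eq_sym kr !eqxx.
set body := Cat (compile g _ _ _) _.
have bodyP a c d t : sem (Cat (Chr (Dec k)) body) (st a c d) t <->
    exists2 c', peval g (a :: c :: xs) c' & t = st a.+1 c' (d - 1)%R.
  rewrite (sem_cat_det _ _ (sem_Dec k _)).
  have -> : upd (st a c d) k (st a c d k - 1)%R = st a c (d - 1)%R.
    by rewrite stE eqxx /st upd_upd.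
  set s1 := st a c _.
  have tail (c' : nat) (w : store) : sem (Cat (Clear r) (Cat (Move r2 r) (Chr (Inc i)))) (upd s1 r2 c') w <->
      w = st a.+1 c' (d - 1)%R.
    have r2r : (r2 == r) = false by apply/eqP; lia.
    have s1r : upd s1 r2 c' r = c.
      by rewrite /upd eq_sym r2r /s1 stE eq_sym kr eqxx.
    have hc u : sem (Clear r) (upd s1 r2 c') u <-> u = upd (upd s1 r2 c') r 0%R.
      by rewrite sem_clear; split=> [[m []] //|->]; exists c.
    rewrite (sem_cat_det _ _ hc).
    have hm u : sem (Move r2 r) (upd (upd s1 r2 c') r 0%R) u <-> u = st a c' (d - 1)%R.
      rewrite (@sem_move _ _ _ _ c') ?r2r //; last by rewrite /upd r2r eqxx.
      suff -> : upd (upd (upd (upd s1 r2 c') r 0%R) r2 0%R) r (upd (upd s1 r2 c') r 0%R r + c'%:Z)%R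
         = st a c' (d - 1)%R by [].
      apply/funext => x; rewrite /upd !eqxx add0r stE; case: (eqVneq x r) => [->|xr].
        by rewrite [r == k]eq_sym kr.
      case: (eqVneq x r2) => [->|xr2].
        by rewrite !ifF ?z //; try apply/eqP; lia.
      by rewrite /s1 stE (negbTE xr).
    rewrite (sem_cat_det _ _ hm) sem_Inc.
    suff -> : upd (st a c' (d - 1)%R) i (st a c' (d - 1)%R i + 1)%R = st a.+1 c' (d - 1)%R by [].
    apply/funext => x; rewrite /upd !stE eqxx [i == k]eq_sym ki [i == r]eq_sym ri.
    case: (eqVneq x i) => [->|_] //; rewrite [i == k]eq_sym ki [i == r]eq_sym ri; lia.
  rewrite /body sem_cat; split=> [[u /(Cg _ _ _ _ _ _ (pg a c _))[c' pc ->] /tail ->]|[c' pc ->]].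
    by exists c'.
  by exists (upd s1 r2 c'); [apply/(Cg _ _ _ _ _ _ (pg a c _)); exists c'|apply/tail].
have iterP N (d : int) t :
    (exists2 y, peval f xs y & reach (sem (Cat (Chr (Dec k)) body)) N (st 0 y d) t) <->
    exists2 y, peval (PPrec f g) (N :: xs) y & t = st N y (d - N%:Z)%R.
  elim: N t => [|N IH] t.
    rewrite subr0; split=> [[y py hr]|[y /peval_prec0P py ->]].
      by inversion hr; subst; exists y => //; apply/peval_prec0P.
    by exists y => //; apply: reach0.
  split=> [[y py /reach_snoc[u ru]]|[y' /peval_precSP[y py pg'] ->]].
    have /IH[y' py' ->] : exists2 y, peval f xs y & reach (sem (Cat (Chr (Dec k)) body)) N (st 0 y d) u.
      by exists y.
    move=> /bodyP[c' pc ->]; exists c'; first by apply/peval_precSP; exists y'.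
    by congr st; lia.
  have hr : exists2 y0, peval f xs y0 &
      reach (sem (Cat (Chr (Dec k)) body)) N (st 0 y0 d) (st N y (d - N%:Z)%R).
    by apply/IH; exists y.
  have [y1 py1 hr1] := hr; exists y1 => //; apply/reach_snoc; exists (st N y (d - N%:Z)%R) => //.
  by apply/bodyP; exists y' => //; congr st; lia.
have loopP (d : int) y t : sem (Loop k body) (st 0 y d) t <->
    exists N : nat, d = N /\ reach (sem (Cat (Chr (Dec k)) body)) N (st 0 y d) t.
  (* The body is controlled only on stores of the form [st], where the scratch registers are at
     zero; hence this invariant. *)
  rewrite (sem_loop (J := fun u => exists a c d, u = st a c d)); last by exists 0, y, d.
    by rewrite stE eqxx.
  move=> _ u [a [c [d' ->]]] /bodyP[c' _ ->]; rewrite !stE eqxx; split=> //.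
  by exists a.+1, c', (d' - 1)%R.
have copyP (y : nat) (t : store) : sem (Copy rn k b) (upd s r y) t <-> t = st 0 y n.
  have [e1 e2 e3] := ltx _ rnb.
  rewrite (@sem_copy _ _ _ _ _ n); last first.
  - by rewrite /upd ifF ?z //; try apply/eqP; lia.
  - by rewrite /upd e2 srn.
  - by apply/eqP; lia.
  - by apply/eqP; lia.
  - by apply/negbT.
  suff -> : upd (upd s r y) k (upd s r y k + n%:Z)%R = st 0 y n by [].
  apply/funext => x; rewrite stE /upd kr z ?add0r; last by lia.
  case: (x == k) => //; case: (x == r) => //; case: eqP => // ->.
  by rewrite z.
have endP (y : nat) t : sem (Cat (Clear i) (Move r out)) (st n y 0%R) t <-> t = upd s out y.
  have [e1 e2 e3] := ltx _ ob.
  have ir : (i == r) = false by rewrite eq_sym.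
  have ik : (i == k) = false by rewrite eq_sym.
  have rk : (r == k) = false by rewrite eq_sym.
  have hc u : sem (Clear i) (st n y 0%R) u <-> u = upd (st n y 0%R) i 0%R.
    rewrite sem_clear; split=> [[m []] //|->]; exists n.
    by rewrite stE ik ir eqxx.
  rewrite (sem_cat_det _ _ hc) (@sem_move _ _ _ _ y); last first.
  - by rewrite /upd ri stE rk eqxx.
  - by rewrite eq_sym e2.
  suff -> : upd (upd (upd (st n y 0%R) i 0%R) r 0%R) out (upd (st n y 0%R) i 0%R out + y%:Z)%R
    = upd s out y by [].
  apply/funext => x; rewrite /upd e3 stE e1 e2 e3 so add0r; case: (x == out) => //.
  case: (eqVneq x r) => [->|xr]; first by rewrite z.
  case: (eqVneq x i) => [->|xi]; first by rewrite z.
  by rewrite stE (negbTE xr) (negbTE xi); case: (eqVneq x k) => [->|//]; rewrite z //; lia.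
rewrite [compile _ _ _ _]/= -/i -/r -/r2 -/k -/b -/body.
split.
  move=> /sem_cat[u /(Cf _ _ _ _ _ _ pf)[y py ->]].
  rewrite (sem_cat_det _ _ (copyP y)) => /sem_cat[v /loopP[N [[<-] hr]]].
  have /iterP[y' py' ->] : exists2 y, peval f xs y & reach (sem (Cat (Chr (Dec k)) body)) n (st 0 y n) v.
    by exists y.
  by rewrite subrr => /endP ->; exists y'.
move=> [y py ->].
have [y1 py1 hr1] : exists2 y0, peval f xs y0 &
    reach (sem (Cat (Chr (Dec k)) body)) n (st 0 y0 n) (st n y (n%:Z - n%:Z)%R).
  by apply/iterP; exists y.
apply/sem_cat; exists (upd s r y1); first by apply/(Cf _ _ _ _ _ _ pf); exists y1.
apply/(sem_cat_det _ _ (copyP y1))/sem_cat; exists (st n y (n%:Z - n%:Z)%R).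
  by apply/loopP; exists n.
by rewrite subrr; apply/endP.
Qed.

(** The star guesses the number of iterations. An iteration passes only if the value of [f] is
    positive, since a value 0 is decremented below zero and cannot be cleared; leaving the loop
    requires the value 0. Thus only the right guess survives. *)
Lemma correct_mu f : correct f -> correct (PMu f).
Proof.
move=> Cf ins out base s xs s' h; have [lt [ob no] z so e] := h.
set i := base; set v := base.+1; set b := base.+2.
pose st (a : nat) : store := upd s i a.
have vi : (v == i) = false by apply/eqP; lia.
have stv a : st a v = 0%R by rewrite /st /upd vi z //; lia.
have pf a : pre (i :: ins) v b (st a) (a :: xs).
  split.
  - by rewrite /= (fun h => sub_all h lt) ?andbT //; move=> x; lia.
  - by split; [lia|rewrite inE vi (notin_lt lt) //; lia].
  - by move=> x hx; rewrite /st upd_other ?z //; [lia|apply/eqP; lia].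
  - exact: stv.
  - by rewrite /st /= upd_same map_upd ?e //; apply: (notin_lt lt).
rewrite [compile _ _ _ _]/= -/i -/v -/b; set body := Cat (compile f _ _ _) (Cat (Chr (Dec v)) _).
have bodyP a t : sem body (st a) t <-> (exists y, peval f (a :: xs) y.+1) /\ t = st a.+1.
  have tail (y : nat) (w : store) :
      sem (Cat (Chr (Dec v)) (Cat (Clear v) (Chr (Inc i)))) (upd (st a) v y) w <->
      0 < y /\ w = st a.+1.
    rewrite (sem_cat_det _ _ (sem_Dec v _)) upd_upd upd_same.
    have fin (w' : store) : sem (Chr (Inc i)) (st a) w' <-> w' = st a.+1.
      by rewrite sem_Inc /st upd_upd upd_same -addn1 PoszD.
    have cl u : sem (Clear v) (upd (st a) v (y%:Z - 1)%R) u <-> 0 < y /\ u = st a.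
      rewrite sem_clear upd_same upd_upd -{1}(stv a) upd_id.
      by split=> [[m [e1 ->]]|[y0 ->]]; [split=> //; lia|exists y.-1; split=> //; lia].
    rewrite sem_cat; split=> [[u /cl[y0 ->] /fin]|[y0 ->]] //.
    by exists (st a); [apply/cl|apply/fin].
  rewrite /body sem_cat; split=> [[u /(Cf _ _ _ _ _ _ (pf a))[y py ->] /tail[y0 ->]]|[[y py] ->]].
    by split=> //; exists y.-1; rewrite prednK.
  by exists (upd (st a) v y.+1); [apply/(Cf _ _ _ _ _ _ (pf a)); exists y.+1|apply/tail].
have iterP N t : reach (sem body) N (st 0) t <->
    (forall m, m < N -> exists y, peval f (m :: xs) y.+1) /\ t = st N.
  elim: N t => [|N IH] t.
    by split=> [hr|[_ ->]]; [inversion hr|apply: reach0].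
  rewrite reach_snoc; split=> [[u /IH[h1 ->] /bodyP[h2 ->]]|[h1 ->]].
    by split=> // m; rewrite ltnS leq_eqVlt => /orP[/eqP ->|/h1].
  exists (st N); last by apply/bodyP; split=> //; apply: h1.
  by apply/IH; split=> // m mN; apply: h1; apply: ltnW.
have s0 : st 0 = s by apply: upd_zero; apply: z.
have endP (N : nat) t : sem (Cat (compile f (i :: ins) v b) (Cat (Chr (Zero v)) (Move i out))) (st N) t <->
    peval f (N :: xs) 0 /\ t = upd s out N.
  have io : i != out by apply/eqP; lia.
  have mv u : sem (Move i out) (st N) u <-> u = upd s out N.
    rewrite (@sem_move _ _ _ _ N) //; last by rewrite /st upd_same.
    rewrite /st upd_upd (upd_zero (z i (leqnn _))) upd_other; last by rewrite eq_sym.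
    by rewrite so add0r.
  rewrite sem_cat; split=> [[u /(Cf _ _ _ _ _ _ (pf N))[y py ->] /sem_cat[w /sem_Zero[]]]|[py ->]].
    rewrite upd_same => -[y0] ->; rewrite y0 in py *.
    by rewrite upd_zero // => /mv.
  exists (upd (st N) v (Posz 0)); first by apply/(Cf _ _ _ _ _ _ (pf N)); exists 0.
  rewrite upd_zero //; apply/sem_cat; exists (st N); last exact/mv.
  exact/sem_Zero.
rewrite sem_cat -s0; split=> [[u /sem_star[N /iterP[h1 ->]] /endP[h2 ->]]|[N /peval_muP[h2 h1] ->]].
  by exists N; [apply/peval_muP|rewrite s0].
exists (st N); first by apply/sem_star; exists N; apply/iterP.
by apply/endP; rewrite s0.
Qed.

Theorem compile_correct p : correct p.
Proof.
elim/prf_nested_ind: p => [||i|f gs|f g|f].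
- exact: correct_zero.
- exact: correct_succ.
- exact: correct_proj.
- exact: correct_comp.
- exact: correct_prec.
- exact: correct_mu.
Qed.

(* The register 1 is given an arbitrary value, and the result must be positive. *)
Definition refuter (p : prf) : regex :=
  Cat (Star (Chr (Inc 1))) (Cat (compile p [:: 0; 1] 2 3) (Cat (Chr (Dec 2)) (Clear 2))).

Definition input (n : nat) : store := fun r => if r == 0 then Posz n else 0%R.

Lemma refuterP p n : (exists s, sem (refuter p) (input n) s) <->
  exists m y, peval p [:: n; m] y.+1.
Proof.
pose st (m : nat) := upd (input n) 1 m.
have s0 : st 0 = input n by apply: upd_zero.
have starP m t : reach (sem (Chr (Inc 1))) m (st 0) t <-> t = st m.
  elim: m t => [|m IH] t; first by split=> [h|->]; [inversion h|apply: reach0].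
  have inc u : sem (Chr (Inc 1)) (st m) u <-> u = st m.+1.
    by rewrite sem_Inc /st upd_upd upd_same (_ : (m%:Z + 1)%R = m.+1); last lia.
  rewrite reach_snoc; split=> [[u /IH -> /inc]|->] //.
  by exists (st m); [apply/IH|apply/inc].
have pp m : pre [:: 0; 1] 2 3 (st m) [:: n; m].
  by split=> // i hi; rewrite /st /upd /input; case: i hi => [|[|]].
have tail m (y : nat) (t : store) : sem (Cat (Chr (Dec 2)) (Clear 2)) (upd (st m) 2 y) t <->
    0 < y /\ t = st m.
  rewrite (sem_cat_det _ _ (sem_Dec 2 _)) sem_clear !upd_same !upd_upd upd_zero //.
  by split=> [[k [e ->]]|[y0 ->]]; [split=> //; lia|exists y.-1; split=> //; lia].
split=> [[s /sem_cat[u /sem_star[m]]]|[m [y py]]].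
  rewrite -s0 => /starP -> /sem_cat[v /(@compile_correct p _ _ _ _ _ _ (pp m))[y py ->] /tail[y0 _]].
  by exists m, y.-1; rewrite prednK.
exists (st m); apply/sem_cat; exists (st m).
  by apply/sem_star; exists m; rewrite -s0; apply/starP.
apply/sem_cat; exists (upd (st m) 2 y.+1); last by apply/tail.
by apply/(@compile_correct p _ _ _ _ _ _ (pp m)); exists y.+1.
Qed.

(** * Deterministic automata for regular expressions *)

(** Mere existence is enough: the automaton depends on the recursive function but not on its input,
    so it enters the reduction as a constant. *)
Definition regular (L : seq nat -> Prop) : Prop :=
  exists (Q : finType) (q0 : Q) (d : Q -> nat -> Q) (F : pred Q),
    forall w, L w <-> F (foldl d q0 w).

Lemma regular_eps : regular (fun w => w = [::]).
Proof.
exists bool, true, (fun _ _ => false), id => w; case/lastP: w => [|w a] //.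
by rewrite foldl_rcons; split=> //; case: w.
Qed.

Lemma regular_chr a : regular (fun w => w = [:: a]).
Proof.
pose d (q : option bool) b := if q is None then Some (a == b) else Some false.
exists (option bool), None, d, (fun q => q == Some true) => w.
have dead (q : bool) b w' : foldl d (Some q) (b :: w') = Some false.
  by rewrite /=; elim: w'.
case: w => [|b [|c w]]; first by [].
  by rewrite /=; split=> [[->]|/eqP[/eqP ->]]; rewrite ?eqxx.
have -> : foldl d None [:: b, c & w] = Some false by apply: (dead (a == b)).
by [].
Qed.

Lemma regular_alt L1 L2 : regular L1 -> regular L2 -> regular (fun w => L1 w \/ L2 w).
Proof.
move=> [Q1 [q1 [d1 [F1 h1]]]] [Q2 [q2 [d2 [F2 h2]]]].
pose d (q : Q1 * Q2) a := (d1 q.1 a, d2 q.2 a).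
exists (Q1 * Q2)%type, (q1, q2), d, (fun q => F1 q.1 || F2 q.2) => w.
have -> : foldl d (q1, q2) w = (foldl d1 q1 w, foldl d2 q2 w).
  by elim: w q1 q2 {h1 h2} => //= a w IH q1 q2; rewrite IH.
rewrite /= h1 h2; split=> [[-> //|->]|/orP]; by rewrite ?orbT.
Qed.

Lemma cat_rcons_split (w u v : seq nat) a : rcons w a = u ++ v ->
  (v = [::] /\ u = rcons w a) \/ exists2 v', v = rcons v' a & w = u ++ v'.
Proof.
case/lastP: v => [|v b]; first by rewrite cats0 => ->; left.
by rewrite -rcons_cat => /rcons_inj[-> ->]; right; exists v.
Qed.

Lemma regular_cat L1 L2 : regular L1 -> regular L2 ->
  regular (fun w => exists u v, [/\ w = u ++ v, L1 u & L2 v]).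
Proof.
move=> [Q1 [q1 [d1 [F1 h1]]]] [Q2 [q2 [d2 [F2 h2]]]].
(* The set collects the runs of the second automaton for all ways to split the word; [new] starts
   one at every prefix that the first automaton accepts. *)
pose new q := if F1 q then [set q2] else set0.
pose d (q : Q1 * {set Q2}) a := (d1 q.1 a, [set d2 x a | x in q.2] :|: new (d1 q.1 a)).
exists (Q1 * {set Q2})%type, (q1, new q1), d, (fun q : Q1 * {set Q2} => [exists x in q.2, F2 x]) => w.
have inNew q x : x \in new q <-> F1 q /\ x = q2.
  rewrite /new; case: (F1 q); rewrite ?inE; last by split=> // -[].
  by split=> [/eqP ->|[_ ->]].
have st : (foldl d (q1, new q1) w).1 = foldl d1 q1 w.
  by elim/last_ind: w => // w a IH; rewrite !foldl_rcons /= IH.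
have inS x : x \in (foldl d (q1, new q1) w).2 <->
    exists u v, [/\ w = u ++ v, L1 u & x = foldl d2 q2 v].
  elim/last_ind: w x st => [|w a IH] x st.
    split=> [/inNew[f1 ->]|[u [v []]]]; first by exists [::], [::]; split=> //; apply/h1.
    case: u => [|//]; case: v => // _ l1 ->; apply/inNew; split=> //; exact: (iffLR (h1 _) l1).
  have st' : (foldl d (q1, new q1) w).1 = foldl d1 q1 w.
    by elim/last_ind: w {IH st} => // w b IH; rewrite !foldl_rcons /= IH.
  rewrite foldl_rcons inE; split=> [/orP[/imsetP[y /(IH _ st')[u [v [-> lu ->]]] ->]|]|].
  - by exists u, (rcons v a); rewrite rcons_cat foldl_rcons.
  - move=> /inNew[f1 ->]; exists (rcons w a), [::]; rewrite cats0; split=> //.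
    by apply/h1; rewrite foldl_rcons -st'.
  move=> [u [v [e lu ->]]]; apply/orP; case: (cat_rcons_split e) => [[-> eu]|[v' -> ew]].
    right; apply/inNew; split=> //; move: lu; rewrite eu => /(iffLR (h1 _)).
    by rewrite foldl_rcons -st'.
  left; rewrite foldl_rcons; apply: imset_f.
  by apply/(IH _ st'); exists u, v'.
split=> [[u [v [e lu /h2 lv]]]|/exists_inP[x /inS[u [v [-> lu ->]]] f2]].
  by apply/exists_inP; exists (foldl d2 q2 v) => //; apply/inS; exists u, v.
by exists u, v; split=> //; apply/h2.
Qed.

Definition star (L : seq nat -> Prop) (w : seq nat) : Prop :=
  exists ws : seq (seq nat), w = flatten ws /\ forall i, i < size ws -> L (nth [::] ws i).

Lemma star_snoc L u v : star L u -> L v -> star L (u ++ v).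
Proof.
move=> [ws [-> h]] lv; exists (rcons ws v); rewrite flatten_rcons; split=> // i.
rewrite size_rcons nth_rcons ltnS leq_eqVlt; case: ltnP => [lt _|_]; first exact: h.
by rewrite orbF => ->.
Qed.

Lemma star_last L w a : star L (rcons w a) ->
  exists u v, [/\ w = u ++ v, star L u & L (rcons v a)].
Proof.
move=> [ws []]; elim/last_ind: ws => [|ws v IH] /=; first by case: w.
rewrite flatten_rcons => e h.
have h' i : i < size ws -> L (nth [::] ws i).
  by move=> iw; have := h i; rewrite size_rcons nth_rcons iw ltnS ltnW // => /(_ isT).
case: (cat_rcons_split e) => [[_ ew]|[v' ev ->]]; first by apply: IH.
exists (flatten ws), v'; split=> //; first by exists ws.
by rewrite -ev; have := h (size ws); rewrite size_rcons nth_rcons ltnn eqxx ; apply.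
Qed.

(** The set tracks the runs on the last, possibly incomplete, factor over all factorizations. The
    flag tells that the whole word lies in the star, and then a new factor may start. *)
Lemma regular_star L : regular L -> regular (star L).
Proof.
move=> [Q [q0 [d0 [F h]]]].
pose d (q : {set Q} * bool) a := let S := [set d0 x a | x in q.1] in
  let b := [exists x in S, F x] in ((if b then S :|: [set q0] else S), b).
exists ({set Q} * bool)%type, ([set q0], true), d, snd => w.
suff inv : (forall x, x \in (foldl d ([set q0], true) w).1 <->
     exists u v, [/\ w = u ++ v, star L u & x = foldl d0 q0 v]) /\
     ((foldl d ([set q0], true) w).2 <-> star L w) by rewrite inv.2.
have nil : star L [::] by exists [::].
elim/last_ind: w => [|w a [IH _]].
  split=> [x|//]; rewrite inE; split=> [/eqP ->|[u [v []]]]; first by exists [::], [::].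
  by case: u => [|//]; case: v => // _ _ ->.
rewrite foldl_rcons; set q := foldl d _ w in IH *.
have inS x : x \in [set d0 y a | y in q.1] <->
    exists u v, [/\ w = u ++ v, star L u & x = foldl d0 q0 (rcons v a)].
  split=> [/imsetP[y /IH[u [v [e su ->]]] ->]|[u [v [e su ->]]]].
    by exists u, v; rewrite foldl_rcons.
  by rewrite foldl_rcons; apply: imset_f; apply/IH; exists u, v.
have bE : [exists x in [set d0 y a | y in q.1], F x] <-> star L (rcons w a).
  split=> [/exists_inP[x /inS[u [v [-> su ->]]] /h lv]|/star_last[u [v [e su /h lv]]]].
    by rewrite rcons_cat; apply: star_snoc.
  by apply/exists_inP; exists (foldl d0 q0 (rcons v a)) => //; apply/inS; exists u, v.
split=> [x|]; last exact: bE.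
rewrite /d /=; case: ifP => b; last first.
  rewrite inS; split=> [[u [v [-> su ->]]]|[u [v [e su ->]]]].
    by exists u, (rcons v a); rewrite rcons_cat.
  case: (cat_rcons_split e) => [[_ eu]|[v' -> ew]]; last by exists u, v'.
  by move: su; rewrite eu => /bE; rewrite b.
rewrite inE; split=> [/orP[/inS[u [v [-> su ->]]]|]|].
- by exists u, (rcons v a); rewrite rcons_cat.
- by rewrite inE => /eqP ->; exists (rcons w a), [::]; rewrite cats0; split=> //; apply/bE.
move=> [u [v [e su ->]]]; apply/orP; case: (cat_rcons_split e) => [[-> _]|[v' -> ew]].
  by right; rewrite inE.
by left; apply/inS; exists u, v'.
Qed.

Lemma regular_lang e : regular (lang e).
Proof.
elim: e => [|a|e1 h1 e2 h2|e1 h1 e2 h2|e h] /=.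
- exact: regular_eps.
- exact: regular_chr.
- exact: regular_cat.
- exact: regular_alt.
- exact: regular_star.
Qed.

(** * Rational series *)

(** A weighted automaton over the naturals with final weights [c] and initial weights [fam i [::]];
    [m a i j] weighs the transition from [j] to [i]. As a recurrence between functions it makes the
    closure properties direct computations. *)
Definition rational (F : seq nat -> nat) : Prop :=
  exists (I : finType) (c : I -> nat) (fam : I -> seq nat -> nat) (m : nat -> I -> I -> nat),
    (forall w, F w = \sum_i c i * fam i w) /\
    (forall a i w, fam i (rcons w a) = \sum_j m a i j * fam j w).

Lemma rational_ext F G : F =1 G -> rational F -> rational G.
Proof. by move=> e [I [c [fam [m [h1 h2]]]]]; exists I, c, fam, m; split=> // w; rewrite -e. Qed.

Lemma rational_one : rational (fun=> 1).
Proof.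
exists unit, (fun=> 1), (fun _ _ => 1), (fun _ _ _ => 1).
by split=> *; rewrite (bigD1 tt) //= big1 // => -[].
Qed.

Lemma rational_zero : rational (fun=> 0).
Proof.
exists unit, (fun=> 0), (fun _ _ => 0), (fun _ _ _ => 1).
by split=> *; rewrite big1.
Qed.

Lemma rational_add F G : rational F -> rational G -> rational (fun w => F w + G w).
Proof.
move=> [I [c [f [m [h1 h2]]]]] [J [c' [f' [m' [h1' h2']]]]].
exists (I + J)%type, (fun x => match x with inl i => c i | inr j => c' j end),
  (fun x => match x with inl i => f i | inr j => f' j end),
  (fun a x y => match x, y with inl i, inl i' => m a i i' | inr j, inr j' => m' a j j' | _, _ => 0 end).
split=> [w|a [i|j] w]; rewrite big_sumType /=.
- by rewrite h1 h1'.
- by rewrite h2 [X in _ + X]big1 ?addn0.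
- by rewrite h2' [X in X + _]big1.
Qed.

Lemma rational_mul F G : rational F -> rational G -> rational (fun w => F w * G w).
Proof.
move=> [I [c [f [m [h1 h2]]]]] [J [c' [f' [m' [h1' h2']]]]].
exists (I * J)%type, (fun x => c x.1 * c' x.2), (fun x w => f x.1 w * f' x.2 w),
  (fun a x y => m a x.1 y.1 * m' a x.2 y.2).
split=> [w|a [i j] w] /=.
  rewrite h1 h1' big_distrlr pair_big; apply: eq_bigr => -[i j] _ /=; exact: mulnACA.
rewrite h2 h2' big_distrlr pair_big; apply: eq_bigr => -[i' j'] _ /=; exact: mulnACA.
Qed.

Lemma rational_sum (s : seq nat) (F : nat -> seq nat -> nat) :
  (forall r, rational (F r)) -> rational (fun w => \sum_(r <- s) F r w).
Proof.
move=> h; elim: s => [|r s IH].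
  by apply: rational_ext rational_zero => w; rewrite big_nil.
by apply: rational_ext (rational_add (h r) IH) => w; rewrite big_cons.
Qed.

Lemma rational_regular L : regular L -> rational (fun w => `[<L w>] : nat).
Proof.
move=> [Q [q0 [d [F h]]]].
exists Q, (fun q => F q : nat), (fun q w => (foldl d q0 w == q) : nat), (fun a q q' => (d q' a == q) : nat).
split=> [w|a q w].
  rewrite (bigD1 (foldl d q0 w)) //= eqxx muln1 big1 ?addn0 => [|q]; last first.
    by rewrite eq_sym => /negbTE ->; rewrite muln0.
  by congr nat_of_bool; apply/asboolP/idP => /h.
rewrite (bigD1 (foldl d q0 w)) //= eqxx muln1 big1 ?addn0 => [|q']; last first.
  by rewrite eq_sym => /negbTE ->; rewrite muln0.
by rewrite foldl_rcons.
Qed.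

(* Sum of [F] over the prefixes that a letter of [l] follows. *)
Fixpoint accum_rev (l : pred nat) (F : seq nat -> nat) (w : seq nat) : nat :=
  if w is a :: w' then accum_rev l F w' + l a * F (rev w') else 0.
Definition accum l F (w : seq nat) : nat := accum_rev l F (rev w).

Lemma accum_rcons l F w a : accum l F (rcons w a) = accum l F w + l a * F w.
Proof. by rewrite /accum rev_rcons /= revK. Qed.

(** One new state carries the running sum, which each letter of [l] increases by the combination of
    the family that gives [F]. *)
Lemma rational_accum l F : rational F -> rational (accum l F).
Proof.
move=> [I [c [f [m [h1 h2]]]]].
exists (unit + I)%type, (fun x => if x is inl _ then 1 else 0),
  (fun x => if x is inr i then f i else accum l F),
  (fun a x y => match x, y with inl _, inl _ => 1 | inl _, inr j => l a * c j
                | inr i, inr j => m a i j | inr _, inl _ => 0 end).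
split=> [w|a [x|i] w]; rewrite big_sumType /=.
- by rewrite (bigD1 tt) //= !big1 ?addn0 ?mul1n // => -[].
- rewrite (bigD1 tt) //= big1 ?addn0 ?mul1n => [|[]] //; rewrite accum_rcons h1 big_distrr.
  by congr (_ + _); apply: eq_bigr => i _; rewrite /= mulnA.
- by rewrite h2 [X in X + _]big1.
Qed.

(** * Counting the failures of a trace *)

Fixpoint letters (e : regex) : seq nat :=
  match e with
  | Eps => [::]
  | Chr a => [:: a]
  | Cat e1 e2 | Alt e1 e2 => letters e1 ++ letters e2
  | Star e1 => letters e1
  end.

Lemma lang_letters e w a : lang e w -> a \in w -> a \in letters e.
Proof.
elim: e w => [|b|e1 IH1 e2 IH2|e1 IH1 e2 IH2|e IH] w /=.
- by move=> ->.
- by move=> ->.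
- move=> [u [v [-> lu lv]]]; rewrite !mem_cat => /orP[/(IH1 _ lu) ->|/(IH2 _ lv) ->] //.
  by rewrite orbT.
- by rewrite mem_cat => -[/IH1 h /h ->|/IH2 h /h ->]; rewrite ?orbT.
- move=> [ws [-> h]] /flattenP[u /(nthP [::])[i iw <-]]; exact: IH (h i iw).
Qed.

Lemma compile_letters p ins out base : all (leq 5) (letters (compile p ins out base)).
Proof.
have cl rs : all (leq 5) (letters (clears rs)) by elim: rs => //= r rs ->.
elim/prf_nested_ind: p ins out base => [||i|f gs IHf IHg|f g IHf IHg|f IHf] ins out base //.
- by case: ins.
- by rewrite /=; case: ifP.
- rewrite /= !all_cat IHf cl !andbT; set comps := (X in letters (X gs base)).
  have h gs' tgt : (forall i, i < size gs' -> forall ins out base,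
      all (leq 5) (letters (compile (nth PZero gs' i) ins out base))) ->
      all (leq 5) (letters (comps gs' tgt)).
    elim: gs' tgt => //= g gs' IH tgt IHg'; rewrite all_cat (IHg' 0) //=.
    by apply: IH => i; apply: (IHg' i.+1).
  exact: h.
- by case: ins => //= n rest; do 4!rewrite ?(all_cat, IHf, IHg) /=.
- by do 4!rewrite ?(all_cat, IHf) /=.
Qed.

Lemma refuter_letters p : all (leq 5) (letters (refuter p)).
Proof. by rewrite /refuter /= all_cat compile_letters. Qed.

Lemma lang_star_chr a w : lang (Star (Chr a)) w <-> exists n, w = nseq n a.
Proof.
split=> [[ws [-> h]]|[n ->]].
  exists (size ws); elim: ws h => //= u ws IH h.
  by rewrite (h 0 isT : u = [:: a]) IH // => i; apply: (h i.+1).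
exists (nseq n [:: a]); split; first by elim: n => //= n ->.
by rewrite size_nseq => i lt; rewrite nth_nseq lt.
Qed.

Definition total_inc (r : nat) : seq nat -> nat := accum (incs r) (fun=> 1).
Definition total_dec (r : nat) : seq nat -> nat := accum (decs r) (fun=> 1).

(* Sums over the zero tests of a word, whose register has been incremented x times and decremented
   y times: x^2 + y^2 for the first and 2xy for the second. *)
Definition test_sq (K : nat) (w : seq nat) : nat := \sum_(r <- iota 0 K)
  accum (pred1 (Zero r)) (fun w => total_inc r w * total_inc r w + total_dec r w * total_dec r w) w.
Definition test_prod (K : nat) (w : seq nat) : nat := \sum_(r <- iota 0 K)
  accum (pred1 (Zero r)) (fun w => total_inc r w * total_dec r w + total_inc r w * total_dec r w) w.

Lemma sq_prod x y : x * y + x * y <= x * x + y * y.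
Proof. by rewrite addnn -mul2n; have := nat_Cauchy x y; rewrite !expnS !expn0 !muln1 => -[]. Qed.

Lemma sq_prod_eq x y : (x * x + y * y == x * y + x * y) = (x == y).
Proof.
rewrite [_ * y + _]addnn -mul2n; have := nat_Cauchy x y.
by rewrite !expnS !expn0 !muln1 => -[_ <-]; rewrite eq_sym.
Qed.

Lemma accum_le l F G w : (forall w, F w <= G w) -> accum l F w <= accum l G w.
Proof.
move=> h; elim/last_ind: w => // w a IH; rewrite !accum_rcons leq_add // leq_mul //.
Qed.

Lemma test_prod_le K w : test_prod K w <= test_sq K w.
Proof. by apply: leq_sum => r _; apply: accum_le => u; apply: sq_prod. Qed.

Lemma run_rcons s w a :
  run s (rcons w a) = obind (fun s' => if test a s' then Some (act a s') else None) (run s w).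
Proof. by rewrite -cats1 run_cat. Qed.

Definition zero_store : store := fun=> 0%R.

Lemma run_total w s r : run zero_store w = Some s ->
  s r = ((total_inc r w)%:Z - (total_dec r w)%:Z)%R.
Proof.
elim/last_ind: w s => [|w a IH] s; first by move=> [<-].
rewrite run_rcons; case E : (run _ w) => [t|] //=; case: ifP => // _ [<-].
rewrite /act (IH t E) /total_inc /total_dec !accum_rcons !muln1; lia.
Qed.

Lemma sum_test K (f : nat -> nat) a :
  \sum_(r <- iota 0 K) (pred1 (Zero r) a) * f r =
  if [&& 7 <= a, a %% 3 == 1 & (a - 7) %/ 3 < K] then f ((a - 7) %/ 3) else 0.
Proof.
case: ifP => [/and3P[a7 /eqP a3 aK]|h].
  rewrite (bigD1_seq ((a - 7) %/ 3)) ?iota_uniq ?mem_iota //= big1 => [|r].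
    rewrite (_ : (a == _) = true) ?mul1n ?addn0 //; apply/eqP; rewrite /Zero; lia.
  move=> rn; rewrite (_ : (a == _) = false) //; apply: contraNF rn => /eqP ->.
  by rewrite /Zero; apply/eqP; lia.
rewrite big_seq big1 // => r; rewrite mem_iota => /andP[_ rK] /=.
rewrite (_ : (a == _) = false) //; apply: contraFF h => /eqP ->.
by rewrite /Zero; lia.
Qed.

Lemma sum_accum_rcons K (F : nat -> seq nat -> nat) w a :
  \sum_(r <- iota 0 K) accum (pred1 (Zero r)) (F r) (rcons w a) =
  \sum_(r <- iota 0 K) accum (pred1 (Zero r)) (F r) w +
  if [&& 7 <= a, a %% 3 == 1 & (a - 7) %/ 3 < K] then F ((a - 7) %/ 3) w else 0.
Proof.
rewrite -(sum_test K (fun r => F r w)) -big_split; apply: eq_bigr => r _.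
exact: accum_rcons.
Qed.

(** The bound [K] ensures that every tested register is summed over. Up to the first failing test
    the store is the difference of the two totals; a failing test makes [test_sq] exceed
    [test_prod], and no later letter can undo this. *)
Lemma run_testE K w : all (fun a => a < K) w ->
  run zero_store w <> None <-> test_sq K w = test_prod K w.
Proof.
elim/last_ind: w => [|w a IH].
  by rewrite /test_sq /test_prod !big1.
rewrite all_rcons => /andP[aK wK]; rewrite run_rcons.
rewrite /test_sq /test_prod !sum_accum_rcons -/(test_sq K w) -/(test_prod K w).
have le := test_prod_le K w; set b := [&& _, _ & _]; set r := (a - 7) %/ 3.
have tE s : run zero_store w = Some s -> test a s <->
    (if b then total_inc r w * total_inc r w + total_dec r w * total_dec r w else 0) =
    (if b then total_inc r w * total_dec r w + total_inc r w * total_dec r w else 0).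
  move=> rs; rewrite /test.
  have -> : (7 <= a)%N && (a %% 3 == 1) = b by rewrite /b; lia.
  case: b => //=; rewrite (run_total _ rs) -/r.
  by split=> [/eqP h|/eqP]; [apply/eqP|]; rewrite sq_prod_eq => *; apply/eqP; lia.
have le2 : (if b then total_inc r w * total_dec r w + total_inc r w * total_dec r w else 0) <=
           (if b then total_inc r w * total_inc r w + total_dec r w * total_dec r w else 0).
  by case: ifP => // _; apply: sq_prod.
move: (IH wK); case E : (run zero_store w) tE => [s|] tE /=; last first.
  by move=> h; split=> // e; apply/h; lia.
move=> [h _]; have e0 := h ltac:(by []); have ts := tE s erefl; rewrite e0.
split=> [|/addnI/ts ->] //; case: ifP => // t _; congr (_ + _); exact/ts.
Qed.

Lemma run_nseq0 n s : run s (nseq n 0) = Some (upd s 0 (s 0%N + n%:Z)%R).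
Proof.
elim: n s => [|n IH] s /=; first by rewrite addr0 upd_id.
rewrite IH; congr Some; apply/funext => x; rewrite /upd /act /incs /decs /=.
by rewrite andbT; case: (x == 0) => /=; lia.
Qed.

Lemma incs1 r : incs r 1 = false.
Proof. by rewrite /incs andbF orbF; apply/eqP; rewrite /Inc; lia. Qed.

Lemma decs1 r : decs r 1 = false.
Proof. by apply/eqP; rewrite /Dec; lia. Qed.

Lemma run_nseq1 n s : run s (nseq n 1) = Some s.
Proof.
elim: n s => [|n IH] s //=; rewrite IH; congr Some; apply/funext => x.
rewrite /act incs1 decs1 /=; lia.
Qed.

Lemma run_prefix n j t : run zero_store (nseq n 0 ++ nseq j 1 ++ t) = run (input n) t.
Proof.
by rewrite run_cat run_nseq0 /= run_cat run_nseq1 /=; congr run.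
Qed.

(** * The two series of the reduction *)

(** Letter 2 raises both counts, 3 only the left one and 4 only the right one. Traces of the program
    avoid these letters, so on them only the test sums remain. *)
Definition left_count (K : nat) (w : seq nat) : nat :=
  test_sq K w + accum (fun a => (a == 2) || (a == 3)) (fun=> 1) w.
Definition right_count (K : nat) (w : seq nat) : nat :=
  test_prod K w + accum (fun a => (a == 2) || (a == 4)) (fun=> 1) w.

(** Twice the Cantor pairing, plus one: the doubling clears the denominator, so the coefficients are
    natural and rational series are preserved; the one reserves size 0 for words outside the
    language. *)
Definition pairing (x y : nat) : nat := ((x + y) * (x + y) + (x + x + x) + y) + 1.

Lemma pairing_inj x y x' y' : pairing x y = pairing x' y' -> x = x' /\ y = y'.
Proof.
rewrite /pairing => e; have es : x + y = x' + y'.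
  by case: (ltngtP (x + y) (x' + y')) => // h; nia.
by move: e; rewrite es; lia.
Qed.

Definition comp_regex (p : prf) : regex := Cat (Star (Chr 0)) (Cat (Star (Chr 1)) (refuter p)).
(** The block of 3 or of 4 is not empty, so the two counts always differ, and together with the
    block of 2 they range over all pairs of distinct numbers. *)
Definition err_regex : regex := Cat (Star (Chr 0)) (Cat (Star (Chr 1))
  (Cat (Star (Chr 2)) (Alt (Cat (Chr 3) (Star (Chr 3))) (Cat (Chr 4) (Star (Chr 4)))))).

Definition letter_bound (p : prf) : nat := (\max_(a <- letters (refuter p)) a).+1 + 5.

Definition size_series (p : prf) (e : regex) (w : seq nat) : nat :=
  `[<lang e w>] * pairing (left_count (letter_bound p) w) (right_count (letter_bound p) w).

(** This is how the input enters: the series is the same for all inputs, and the structure for [n]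
    keeps the words with exactly [n] zeros, all of them in front. *)
Definition leading_zeros (n : nat) (w : seq nat) : Prop := exists2 t, w = nseq n 0 ++ t & 0 \notin t.

Lemma rational_size_series p e : rational (size_series p e).
Proof.
have rc l : rational (accum l (fun=> 1)) by apply/rational_accum/rational_one.
have ri r : rational (total_inc r) by apply: rc.
have rd r : rational (total_dec r) by apply: rc.
have rl : rational (left_count (letter_bound p)).
  apply: rational_add => //; apply: rational_sum => r; apply: rational_accum.
  by apply: rational_add; apply: rational_mul.
have rr : rational (right_count (letter_bound p)).
  apply: rational_add => //; apply: rational_sum => r; apply: rational_accum.
  by apply: rational_add; apply: rational_mul.
apply: rational_mul; first exact/rational_regular/regular_lang.
have rs := rational_add rl rr; have r3 := rational_add (rational_add rl rl) rl.
exact: (rational_add (rational_add (rational_add (rational_mul rs rs) r3) rr) rational_one).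
Qed.

(* The letter 1 is invisible to both counts; it makes every class size occur infinitely often. *)
Lemma accum_erase (l : pred nat) F u n v : ~~ l 1 ->
  (forall u n v, F (u ++ nseq n 1 ++ v) = F (u ++ v)) ->
  accum l F (u ++ nseq n 1 ++ v) = accum l F (u ++ v).
Proof.
move=> /negbTE l1 hF; elim/last_ind: v => [|v a IH].
  rewrite !cats0; elim: n => [|n IH]; first by rewrite cats0.
  by rewrite -addn1 nseqD catA cats1 accum_rcons IH l1 mul0n addn0.
by rewrite -!rcons_cat !accum_rcons IH hF.
Qed.

Lemma counts_erase K u n v :
  left_count K (u ++ nseq n 1 ++ v) = left_count K (u ++ v) /\
  right_count K (u ++ nseq n 1 ++ v) = right_count K (u ++ v).
Proof.
have c l : ~~ l 1 -> forall u n v, accum l (fun=> 1) (u ++ nseq n 1 ++ v) = accum l (fun=> 1) (u ++ v).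
  by move=> l1 u' n' v'; apply: accum_erase.
have i1 r : ~~ incs r 1 by rewrite incs1.
have d1 r : ~~ decs r 1 by rewrite decs1.
have z1 r : ~~ pred1 (Zero r) 1 by apply/eqP; rewrite /Zero; lia.
split; rewrite /left_count /right_count c //; congr (_ + _); apply: eq_bigr => r _;
  by apply: accum_erase => // u' n' v'; rewrite /total_inc /total_dec !c.
Qed.

Lemma accum_count l w : accum l (fun=> 1) w = count l w.
Proof.
elim/last_ind: w => // w a IH; rewrite accum_rcons IH -cats1 count_cat /= muln1.
by rewrite addn0.
Qed.

Lemma accum_eq0 (l : pred nat) F w : ~~ has l w -> accum l F w = 0.
Proof.
elim/last_ind: w => // w a IH; rewrite has_rcons negb_or => /andP[/negbTE la hw].
by rewrite accum_rcons IH // la.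
Qed.

Lemma sq_prod_eq0 K w : all (geq 6) w -> test_sq K w = 0 /\ test_prod K w = 0.
Proof.
move=> /allP h; have z r : ~~ has (pred1 (Zero r)) w.
  by apply/hasPn => a /h /= a6; apply/eqP; rewrite /Zero; lia.
by split; rewrite /test_sq /test_prod big1 // => r _; apply: accum_eq0.
Qed.

Definition padded (n j : nat) (t : seq nat) : seq nat := nseq n 0 ++ nseq j 1 ++ t.

Definition clean (t : seq nat) : Prop := 0 \notin t /\ 1 \notin t.

Lemma clean_geq2 t : all (leq 2) t -> clean t.
Proof. by move=> /allP h; split; apply/negP => /h. Qed.

Lemma leading_zeros_padded n j t : clean t -> leading_zeros n (padded n j t).
Proof. by move=> [h0 h1]; exists (nseq j 1 ++ t) => //; rewrite mem_cat mem_nseq andbF. Qed.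

Lemma leading_zeros_uniq n w n' j t : clean t -> w = padded n' j t -> leading_zeros n w -> n' = n.
Proof.
move=> [t0 _] -> [t' e t'0]; have := congr1 (count_mem 0) e.
rewrite !count_cat !count_nseq /= (count_memPn t0) (count_memPn t'0); lia.
Qed.

Lemma lang_cat e1 e2 w : lang (Cat e1 e2) w <-> exists u v, [/\ w = u ++ v, lang e1 u & lang e2 v].
Proof. by []. Qed.

Lemma lang_prefix e w : lang (Cat (Star (Chr 0)) (Cat (Star (Chr 1)) e)) w <->
  exists n j t, w = padded n j t /\ lang e t.
Proof.
split=> [/lang_cat[u [v [-> lu /lang_cat[u' [t [-> lu' le]]]]]]|[n [j [t [-> le]]]]].
  have [n ->] := (lang_star_chr _ _).1 lu; have [j ->] := (lang_star_chr _ _).1 lu'.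
  by exists n, j, t.
apply/lang_cat; exists (nseq n 0), (nseq j 1 ++ t); split=> //; first by apply/lang_star_chr; exists n.
by apply/lang_cat; exists (nseq j 1), t; split=> //; apply/lang_star_chr; exists j.
Qed.

Lemma lang_star1 a w : lang (Cat (Chr a) (Star (Chr a))) w <-> exists d, w = nseq d.+1 a.
Proof.
split=> [/lang_cat[u [v [-> -> lv]]]|[d ->]].
  by have [d ->] := (lang_star_chr _ _).1 lv; exists d.
by apply/lang_cat; exists [:: a], (nseq d a); split=> //; apply/lang_star_chr; exists d.
Qed.

Definition err_tail (i d : nat) (b : bool) : seq nat := nseq i 2 ++ nseq d.+1 (if b then 3 else 4).

Lemma lang_err w : lang err_regex w <->
  exists n j i d b, w = padded n j (err_tail i d b).
Proof.
rewrite lang_prefix; split=> [[n [j [t [-> /lang_cat[u [v [-> lu]]]]]]]|[n [j [i [d [b ->]]]]]].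
  have [i ->] := (lang_star_chr _ _).1 lu.
  by case=> /lang_star1[d ->]; exists n, j, i, d; [exists true|exists false].
exists n, j, (err_tail i d b); split=> //.
apply/lang_cat; exists (nseq i 2), (nseq d.+1 (if b then 3 else 4)); split=> //.
  by apply/lang_star_chr; exists i.
by case: b; [left|right]; apply/lang_star1; exists d.
Qed.

Lemma err_clean i d (b : bool) : clean (err_tail i d b).
Proof. by apply: clean_geq2; rewrite all_cat !all_nseq; case: b; rewrite !orbT. Qed.

Definition err_word n j i d b : seq nat := padded n j (err_tail i d b).

Lemma err_counts K n j i d b :
  left_count K (err_word n j i d b) = i + (if b then d.+1 else 0) /\
  right_count K (err_word n j i d b) = i + (if b then 0 else d.+1).
Proof.
have h : all (geq 6) (err_word n j i d b) by rewrite !all_cat !all_nseq; case: b; rewrite !orbT.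
have [e1 e2] := sq_prod_eq0 K h; rewrite /left_count /right_count e1 e2.
by rewrite !accum_count !count_cat !count_nseq; case: b {h e1 e2}; split=> /=; lia.
Qed.

Lemma comp_clean p t : lang (refuter p) t -> all (leq 5) t.
Proof.
by move=> lt; apply/allP => a /(lang_letters lt); apply: (allP (refuter_letters p)).
Qed.

Lemma comp_counts p n j t (K := letter_bound p) (w := padded n j t) : lang (refuter p) t ->
  left_count K w = test_sq K w /\ right_count K w = test_prod K w /\ all (fun a => a < K) w.
Proof.
move=> lt; have t5 := comp_clean lt.
have c (l : pred nat) : (forall a, l a -> 1 < a < 5) -> accum l (fun=> 1) w = 0.
  move=> h; apply: accum_eq0; rewrite !has_cat !has_nseq !negb_or.
  have -> : l 0 = false by apply/negP => /h.
  have -> : l 1 = false by apply/negP => /h.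
  by rewrite !andbF /=; apply/hasPn => a /(allP t5) a5; apply/negP => /h; lia.
rewrite /left_count /right_count !c ?addn0; try by move=> a /orP[] /eqP ->.
have K5 : 5 < K by rewrite /K /letter_bound addSn ltnS leq_addl.
do 2!split=> //; rewrite !all_cat !all_nseq !(leq_trans _ K5) // !orbT /=.
apply/allP => a /(lang_letters lt) al.
by rewrite /K /letter_bound addSn ltnS (leq_trans _ (leq_addr _ _)) // (big_rem a) //= leq_maxl.
Qed.

Lemma comp_valid p n j t (K := letter_bound p) : lang (refuter p) t ->
  left_count K (padded n j t) = right_count K (padded n j t) <-> run (input n) t <> None.
Proof.
move=> lt; have [-> [-> wK]] := comp_counts n j lt.
by rewrite -(run_testE wK) run_prefix.
Qed.

Definition full_regex (p : prf) : regex := Alt err_regex (comp_regex p).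

Lemma lang_comp p w : lang (comp_regex p) w <->
  exists n j t, w = padded n j t /\ lang (refuter p) t.
Proof. exact: lang_prefix. Qed.

Lemma lang_full p w : lang (full_regex p) w <-> lang err_regex w \/ lang (comp_regex p) w.
Proof. by []. Qed.

Definition of_size (F : seq nat -> nat) (n s : nat) (w : seq nat) : Prop := leading_zeros n w /\ F w = s.

Lemma pairing_gt0 x y : 0 < pairing x y. Proof. by rewrite /pairing addn1. Qed.

Lemma size_series_gt0 p e w : 0 < size_series p e w -> lang e w /\
  size_series p e w = pairing (left_count (letter_bound p) w) (right_count (letter_bound p) w).
Proof. by rewrite /size_series; case: asboolP => // le; rewrite mul1n. Qed.

Lemma size_seriesE p e w : lang e w ->
  size_series p e w = pairing (left_count (letter_bound p) w) (right_count (letter_bound p) w).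
Proof. by move=> le; rewrite /size_series asboolT // mul1n. Qed.

Lemma err_padded w : lang err_regex w ->
  exists n j t, [/\ w = padded n j t, clean t & forall n j, lang err_regex (padded n j t)].
Proof.
case/lang_err=> n [j [i [d [b ->]]]].
exists n, j, (err_tail i d b); split=> //; first exact: err_clean.
by move=> n' j'; apply/lang_err; exists n', j', i, d, b.
Qed.

Lemma of_size_infinite p e n s w :
  (forall w, lang e w ->
    exists n j t, [/\ w = padded n j t, clean t & forall n j, lang e (padded n j t)]) ->
  0 < s -> of_size (size_series p e) n s w -> forall k, size_ge (of_size (size_series p e) n s) k.
Proof.
move=> hp s0 [sh es] k; move: s0; rewrite -es => /size_series_gt0[lw _].
have [n' [j [t [ew ct lt]]]] := hp w lw.
have en := leading_zeros_uniq ct ew sh; subst n'.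
exists (map (fun i => padded n i t) (iota 0 k)); split.
- rewrite map_inj_uniq ?iota_uniq // => i i' /(congr1 (count_mem 1)).
  by rewrite /padded !count_cat !count_nseq /=; lia.
- by rewrite size_map size_iota.
move=> _ /mapP[i _ ->]; split; first exact: leading_zeros_padded.
have [el er] := counts_erase (letter_bound p) (nseq n 0) i t.
have [el' er'] := counts_erase (letter_bound p) (nseq n 0) j t.
by rewrite ew !size_seriesE // /padded el er el' er'.
Qed.

Lemma err_realizes p n x y : x <> y -> exists w, of_size (size_series p err_regex) n (pairing x y) w.
Proof.
move=> xy; pose b := y < x.
(* The common part [minn x y] is spelled by 2 and the difference by 3 or 4; the form [.-1.+1]
   matches [err_tail], and the difference is positive as [x <> y]. *)
pose w := padded n 0 (nseq (minn x y) 2 ++ nseq (maxn x y - minn x y).-1.+1 (if b then 3 else 4)).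
exists w; split; first exact/leading_zeros_padded/err_clean.
rewrite size_seriesE; last by apply/lang_err; do 5!eexists; reflexivity.
have [-> ->] := err_counts (letter_bound p) n 0 (minn x y) (maxn x y - minn x y).-1 b.
by rewrite /b; case: ltnP => h; congr pairing; lia.
Qed.

Lemma err_distinct K w : lang err_regex w -> left_count K w <> right_count K w.
Proof.
case/lang_err => n [j [i [d [b ->]]]]; have [-> ->] := err_counts K n j i d b.
by case: b; lia.
Qed.

(** Without a positive value of [p], every trace for the input [n] fails a test, so its counts
    differ and its size already occurs among the error words, infinitely often. *)
Lemma of_size_equinum p n s : ~ (exists m y, peval p [:: n; m] y.+1) -> 0 < s ->
  equinum (of_size (size_series p (full_regex p)) n s) (of_size (size_series p err_regex) n s).
Proof.
move=> np s0.
have h12 w : of_size (size_series p (full_regex p)) n s w ->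
    exists w', of_size (size_series p err_regex) n s w'.
  move=> [sh es]; move: (s0); rewrite -es => /size_series_gt0[lw ->].
  apply: err_realizes; case/lang_full: lw => [/err_distinct //|/lang_comp[n' [j [t [ew lt]]]]].
  have ct : clean t by apply: clean_geq2; apply: sub_all (comp_clean lt) => a; lia.
  have en := leading_zeros_uniq ct ew sh; subst n'; rewrite ew => /(comp_valid n j lt) rn; apply: np.
  apply/refuterP; case er : (run (input n) t) rn => [st|] // _.
  by exists st; exists t.
have h21 w : of_size (size_series p err_regex) n s w -> of_size (size_series p (full_regex p)) n s w.
  move=> [sh es]; split=> //; move: (s0); rewrite -es => /size_series_gt0[lw ->].
  by apply: size_seriesE; apply/lang_full; left.
move=> k; split=> [hk|[l [ul sl hl]]]; last by exists l; split=> // x /hl /h21.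
case: k hk => [|k] [l [ul sl hl]]; first by exists [::].
case: l ul sl hl => // w l _ _ hl; have [w' hw'] := h12 w (hl w (mem_head _ _)).
exact: (of_size_infinite err_padded s0 hw').
Qed.

(** A genuine trace has equal counts, and by injectivity of [pairing] no error word has the size of
    a diagonal pair. *)
Lemma of_size_separated p n m y : peval p [:: n; m] y.+1 ->
  exists s w, [/\ 0 < s, of_size (size_series p (full_regex p)) n s w &
    forall w', ~ of_size (size_series p err_regex) n s w'].
Proof.
move=> py; have [st [t lt rt]] : exists s, sem (refuter p) (input n) s.
  by apply/refuterP; exists m, y.
have ct : clean t by apply: clean_geq2; apply: sub_all (comp_clean lt) => a; lia.
have lf : lang (full_regex p) (padded n 0 t) by apply/lang_full; right; apply/lang_comp; exists n, 0, t.
have ev : left_count (letter_bound p) (padded n 0 t) = right_count (letter_bound p) (padded n 0 t).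
  by apply/comp_valid => //; rewrite rt.
exists (size_series p (full_regex p) (padded n 0 t)), (padded n 0 t); split.
- by rewrite size_seriesE // pairing_gt0.
- by split=> //; apply: leading_zeros_padded.
move=> w' [_ e']; have : 0 < size_series p err_regex w' by rewrite e' size_seriesE // pairing_gt0.
move=> /size_series_gt0[lw' ew']; move: e'; rewrite ew' size_seriesE // => /pairing_inj[e1 e2].
by apply: (err_distinct lw' (K := letter_bound p)); rewrite e1 e2.
Qed.

Lemma size_series_letters p e w : e = full_regex p \/ e = err_regex -> size_series p e w <> 0 ->
  w <> [::] /\ all (fun a => a < letter_bound p) w.
Proof.
have herr v : lang err_regex v -> v <> [::] /\ all (fun a => a < letter_bound p) v.
  case/lang_err => n [j [i [d [b ->]]]]; split.
    by move=> /(congr1 size); rewrite /padded !size_cat !size_nseq /=; lia.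
  by rewrite !all_cat !all_nseq /letter_bound; case: b; rewrite !orbT /=; lia.
move=> he /eqP; rewrite -lt0n => /size_series_gt0[lw _]; case: he lw => -> //; last exact: herr.
case/lang_full=> [|/lang_comp[n [j [t [-> lt]]]]]; first exact: herr.
have [_ [_ ->]] := comp_counts n j lt; split=> // e0.
(* Every trace of [refuter] contains the letter [Dec 2], hence is not empty. *)
have [u [v [et _ lv]]] := lt; have [u' [v' [ev _ lv']]] := lv; have [x [z [ez ex _]]] := lv'.
have : size (padded n j t) = 0 by rewrite e0.
by rewrite /padded et ev ez ex !size_cat /=; lia.
Qed.

(** * Automatic equivalence structures with prescribed class sizes *)

(** Initial weights are moved into the transitions for the first letter and the weights [c] into
    those for the last one, leaving a single start and a single final state. This takes at least one
    letter, whence [F [::] = 0]. *)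
Lemma rational_normal F : rational F -> F [::] = 0 ->
  exists (J : finType) (st fi : J) (fam : J -> seq nat -> nat) (m : nat -> J -> J -> nat),
    [/\ forall w, fam fi w = F w, forall x, fam x [::] = (x == st)
      & forall a x w, fam x (rcons w a) = \sum_y m a x y * fam y w].
Proof.
move=> [I [c [f [m [h1 h2]]]]] F0.
pose fam (x : bool + I) (w : seq nat) := match x with
  | inl true => (w == [::]) : nat | inl false => F w | inr i => if w == [::] then 0 else f i w end.
pose n a (x y : bool + I) := match x, y with
  | inl false, inl true => F [:: a]
  | inl false, inr j => \sum_i c i * m a i j
  | inr i, inl true => \sum_j m a i j * f j [::]
  | inr i, inr j => m a i j
  | _, _ => 0 end.
have ne (w : seq nat) a : (rcons w a == [::]) = false by case: w.
exists (bool + I)%type, (inl true), (inl false), fam, n; split=> //.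
- by move=> [[]|i] //=; rewrite F0.
move=> a x w; rewrite big_sumType /= big_bool /=.
case: x => [[]|i] /=; rewrite ?ne ?muln0 ?mul0n ?addn0.
- by rewrite big1.
- have [->|wn] := eqVneq w [::]; first by rewrite muln1 big1 ?addn0 // => j _; rewrite muln0.
  rewrite muln0 add0n h1.
  under eq_bigr => i _ do rewrite h2 big_distrr.
  rewrite exchange_big; apply: eq_bigr => j _ /=; rewrite big_distrl; apply: eq_bigr => i _.
  by rewrite mulnA.
- have [->|wn] := eqVneq w [::]; last by rewrite muln0 add0n h2.
  by rewrite muln1 [X in _ + X]big1 ?addn0 ?h2 // => j _; rewrite muln0.
Qed.

Section Runs.
Variables (J : finType) (st fi : J) (fam : J -> seq nat -> nat) (m : nat -> J -> J -> nat) (K : nat).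
Hypothesis fam_nil : forall x, fam x [::] = (x == st).
Hypothesis fam_rcons : forall a x w, fam x (rcons w a) = \sum_y m a x y * fam y w.

(* Transitions (source, label, target), listed with multiplicity; runs are words of positions in
   this list. *)
Definition trans : seq (J * nat * J) :=
  flatten [seq flatten [seq flatten [seq nseq (m a x y) (y, a, x) | y <- enum J] | x <- enum J]
          | a <- iota 0 K].

Definition tr (t : nat) : J * nat * J := nth (st, 0, st) trans t.
Definition src t := (tr t).1.1.
Definition lbl t := (tr t).1.2.
Definition tgt t := (tr t).2.

Lemma sum_trans (G : J * nat * J -> nat) :
  \sum_(t <- iota 0 (size trans)) G (tr t) =
  \sum_(a <- iota 0 K) \sum_x \sum_y m a x y * G (y, a, x).
Proof.
have -> : iota 0 (size trans) = index_iota 0 (size trans) by rewrite /index_iota subn0.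
rewrite /tr.
rewrite -(big_nth (st, 0, st) xpredT G) /trans big_flatten big_map; apply: eq_bigr => a _.
rewrite big_flatten big_map big_enum; apply: eq_bigr => x _.
rewrite big_flatten big_map big_enum; apply: eq_bigr => y _.
by rewrite big_nseq iter_addn_0 mulnC.
Qed.

Lemma lbl_lt t : t < size trans -> lbl t < K.
Proof.
move=> h; have : tr t \in trans by apply: mem_nth.
rewrite /lbl => /flatten_mapP[a]; rewrite mem_iota => /= aK /flatten_mapP[x _] /flatten_mapP[y _].
by rewrite mem_nseq => /andP[_ /eqP ->].
Qed.

Fixpoint runs_rev (wr : seq nat) (x : J) : seq word :=
  if wr is a :: wr' then
    flatten [seq [seq rcons v t | v <- runs_rev wr' (src t)]
            | t <- iota 0 (size trans) & (lbl t == a) && (tgt t == x)]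
  else if x == st then [:: [::]] else [::].

Definition runs (w : seq nat) : seq word := runs_rev (rev w) fi.

Lemma size_runs_rev wr x : all (fun a => a < K) wr -> size (runs_rev wr x) = fam x (rev wr).
Proof.
elim: wr x => [|a wr IH] x /=; first by rewrite fam_nil; case: eqP.
move=> /andP[aK wK]; rewrite rev_cons fam_rcons size_flatten /shape -map_comp sumnE big_map.
rewrite big_filter big_mkcond.
pose g (e : J * nat * J) := ((e.1.2 == a) && (e.2 == x)) * fam e.1.1 (rev wr).
rewrite (eq_bigr (fun t => g (tr t))); last first.
  move=> t _; rewrite /g -/(src t) -/(lbl t) -/(tgt t); case: ifP => _ /=; last by rewrite mul0n.
  by rewrite size_map IH // mul1n.
rewrite (sum_trans g) (bigD1_seq a) ?iota_uniq ?mem_iota //= [X in _ + X]big1 ?addn0; last first.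
  move=> b /negbTE ba; rewrite big1 // => y _; rewrite big1 // => z _.
  by rewrite /g /= ba mul0n muln0.
rewrite (bigD1 x) //= [X in _ + X]big1 ?addn0; last first.
  by move=> y /negbTE yx; rewrite big1 // => z _; rewrite /g /= yx andbF mul0n muln0.
by apply: eq_bigr => y _; rewrite /g /= !eqxx mul1n.
Qed.

Definition move_run (o : option J) (t : nat) : option J :=
  if (t < size trans) && (o == Some (src t)) then Some (tgt t) else None.

Lemma mem_runs_rev wr x v :
  v \in runs_rev wr x <-> foldl move_run (Some st) v = Some x /\ map lbl v = rev wr.
Proof.
elim: wr x v => [|a wr IH] x v /=.
  have -> : (v \in (if x == st then [:: [::]] else [::])) = (v == [::]) && (x == st).
    by case: (x == st); rewrite ?andbT ?andbF ?inE.
  split=> [/andP[/eqP -> /eqP ->]|[]] //.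
  by case: v => //= [[->]] _; rewrite eqxx.
rewrite rev_cons; split=> [/flatten_mapP[t]|[]].
  rewrite mem_filter mem_iota => /andP[/andP[/eqP la /eqP tx] /= ts] /mapP[u /IH[e1 e2] ->].
  by rewrite foldl_rcons e1 map_rcons la e2 /move_run ts eqxx tx.
case/lastP: v => [|v t]; first by move=> _ /(congr1 size); rewrite size_rcons.
rewrite foldl_rcons map_rcons {1}/move_run; case: ifP => // /andP[ts /eqP ev] [tx] /rcons_inj[e la].
apply/flatten_mapP; exists t; first by rewrite mem_filter mem_iota la tx !eqxx ts.
by apply: map_f; apply/IH.
Qed.

Lemma uniq_runs_rev wr x : uniq (runs_rev wr x).
Proof.
elim: wr x => [|a wr IH] x /=; first by case: ifP.
have : uniq [seq t <- iota 0 (size trans) | (lbl t == a) && (tgt t == x)].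
  by rewrite filter_uniq ?iota_uniq.
elim: (filter _ _) => //= t l IHl /andP[tl ul]; rewrite cat_uniq IHl // andbT.
rewrite map_inj_uniq ?IH => [|u v /rcons_inj[] //]; apply/hasPn => u.
move=> /flatten_mapP[t' t'l /mapP[v _ ->]]; apply/mapP => -[v' _ /rcons_inj[_ e]].
by rewrite -e t'l in tl.
Qed.

Lemma move_run_none v : foldl move_run None v = None.
Proof. by elim: v => //= t v; rewrite /move_run andbF. Qed.

Lemma move_run_lt o x v : foldl move_run o v = Some x -> all (fun t => t < size trans) v.
Proof.
elim: v o => //= t v IH o; rewrite [move_run o t]/move_run; case: ifP => [/andP[-> _]|_]; first exact: IH.
by rewrite move_run_none.
Qed.

Lemma runsP w v : v \in runs w <-> foldl move_run (Some st) v = Some fi /\ map lbl v = w.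
Proof. by rewrite /runs mem_runs_rev revK. Qed.

Lemma size_runs w : (fam fi w <> 0 -> all (fun a => a < K) w) -> size (runs w) = fam fi w.
Proof.
move=> h; have [wK|wK] := boolP (all (fun a => a < K) w).
  by rewrite /runs size_runs_rev ?revK // all_rev.
have -> : fam fi w = 0 by apply/eqP/negPn/negP => /eqP/h; rewrite (negbTE wK).
apply/eqP; rewrite size_eq0; apply/negPn/negP => /eqP; case E : (runs w) => [//|v l] _.
have /runsP[ev ew] : v \in runs w by rewrite E mem_head.
move/negP: wK; apply; rewrite -ew all_map; apply: sub_all (move_run_lt ev) => t; exact: lbl_lt.
Qed.

Definition rk (x : J) : nat := enum_rank x.
Definition card_states : nat := #|J|.

Lemma rk_lt x : rk x < card_states. Proof. exact: ltn_ord. Qed.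
Lemma rk_inj x y : rk x = rk y -> x = y. Proof. by move=> /val_inj/enum_rank_inj. Qed.

(** A pair of a level and a state is coded by quotient and remainder modulo the number of states. *)
Lemma level_eq l l' x y : l * card_states + rk x = l' * card_states + rk y -> l = l' /\ x = y.
Proof.
move=> e; have := congr1 (fun i => i %/ card_states) e.
have c0 : 0 < card_states by apply: leq_ltn_trans (rk_lt x).
rewrite !divnMDl // !divn_small ?rk_lt // !addn0 => el; split=> //.
by apply: rk_inj; move: e; rewrite el => /addnI.
Qed.

Definition edges (p : pred nat) : seq (nat * letter * nat) :=
  [seq (rk (src t), [:: t.+1], rk (tgt t)) | t <- iota 0 (size trans) & p (lbl t)].

(* Reading the first zeros lowers the level; other letters are read at level 0 only. *)
Definition level_delta (n : nat) : seq (nat * letter * nat) :=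
  edges (fun a => a != 0) ++
  flatten [seq [seq (l.+1 * card_states + d.1.1, d.1.2, l * card_states + d.2) | d <- edges (pred1 0)]
          | l <- iota 0 n].

Definition level_nfa (n : nat) : nfa := (n * card_states + rk st, [:: rk fi], level_delta n).

Lemma edgesP p d : d \in edges p -> exists2 t, (t < size trans) && p (lbl t) &
  d = (rk (src t), [:: t.+1], rk (tgt t)).
Proof.
move=> /mapP[t]; rewrite mem_filter mem_iota => /andP[pt /= ts] ->; exists t => //.
by rewrite ts.
Qed.

Lemma leading_zeros_nil l : leading_zeros l [::] <-> l = 0.
Proof.
by split=> [[t]|->]; [case: l|exists [::]].
Qed.

Lemma leading_zeros0 w : leading_zeros 0 w <-> 0 \notin w.
Proof. by split=> [[t ->]|h]; last exists w. Qed.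

Lemma leading_zeros_cons l a w : leading_zeros l (a :: w) <->
  if a == 0 then exists2 l', l = l'.+1 & leading_zeros l' w else l = 0 /\ leading_zeros 0 w.
Proof.
case: eqP => [->|a0].
  split=> [[t]|[l' -> [t -> t0]]]; last by exists t.
  by case: l => [/= <-|l [->]] t0; [rewrite inE in t0|exists l => //; exists t].
rewrite leading_zeros0; split=> [[t]|[-> w0]].
  by case: l => [/= <-|l [] //]; rewrite inE negb_or => /andP[].
by apply/leading_zeros0; rewrite inE negb_or w0 andbT; apply/eqP => /esym.
Qed.

Lemma level_run n l x v : l <= n ->
  nfa_run [:: rk fi] (level_delta n) (l * card_states + rk x) (map (fun a => [:: a.+1]) v) <->
  foldl move_run (Some x) v = Some fi /\ leading_zeros l (map lbl v).
Proof.
elim: v l x => [|t v IH] l x ln /=.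
  rewrite inE leading_zeros_nil; split=> [/eqP|[[->] ->]]; last by rewrite mul0n.
  by rewrite -[rk fi]add0n -(mul0n card_states) => /level_eq[-> ->].
have IH0 y : nfa_run [:: rk fi] (level_delta n) (rk y) (map (fun a => [:: a.+1]) v) <->
    foldl move_run (Some y) v = Some fi /\ leading_zeros 0 (map lbl v) by exact: (IH 0 y (leq0n n)).
rewrite leading_zeros_cons; split=> [/hasP[d]|[e z]].
  rewrite mem_cat => /orP[/edgesP[t' /andP[ts tl] ->]|/flatten_mapP[l']] /=.
    move=> /and3P[/eqP e1 /eqP[<-]] r; rewrite (negbTE tl) /move_run ts.
    have [e0 <-] : 0 = l /\ src t' = x by apply: level_eq; rewrite mul0n.
    by rewrite eqxx; move: r => /IH0[-> lz].
  rewrite mem_iota => /= l'n /mapP[d' /edgesP[t' /andP[ts tl] ->] ->] /=.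
  move=> /and3P[/eqP/level_eq[e1 e2] /eqP[<-]]; rewrite IH; last exact: ltnW.
  by move=> [r lz]; rewrite (tl : (lbl t' == 0) = true) /move_run ts e2 eqxx; split=> //; exists l'.
move: e z; rewrite [move_run _ t]/move_run; case: ifP; last by rewrite move_run_none.
move=> /andP[ts /eqP[->]] e z.
have [t0|t0] := eqVneq (lbl t) 0.
  move: z; rewrite t0 eqxx => -[l' el lz]; rewrite el in ln *.
  apply/hasP; exists (l'.+1 * card_states + rk (src t), [:: t.+1], l' * card_states + rk (tgt t)).
    rewrite mem_cat; apply/orP; right; apply/flatten_mapP; exists l'; first by rewrite mem_iota.
    apply/mapP; exists (rk (src t), [:: t.+1], rk (tgt t)) => //.
    by apply/mapP; exists t => //; rewrite mem_filter mem_iota ts /= t0.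
  by rewrite !eqxx /=; apply/IH => //; apply: ltnW.
move: z; rewrite (negbTE t0) => -[-> lz].
apply/hasP; exists (rk (src t), [:: t.+1], rk (tgt t)).
  rewrite mem_cat; apply/orP; left; apply/mapP; exists t => //.
  by rewrite mem_filter mem_iota ts t0.
by rewrite mul0n !eqxx /=; apply/IH0.
Qed.

(** Equality of labels is checked position by position, so one state suffices; padding has no
    transition, which forces equal lengths. *)
Definition same_nfa : nfa :=
  (0, [:: 0], [seq (0, [:: e.1.+1; e.2.+1], 0)
     | e <- [seq (i, j) | i <- iota 0 (size trans), j <- iota 0 (size trans)] & lbl e.1 == lbl e.2]).

Lemma conv2_nil_cons b v : conv2 [::] (b :: v) = [:: 0; b.+1] :: conv2 [::] v.
Proof. by rewrite /conv2 /= !max0n /= -[1]addn0 iotaDl -map_comp. Qed.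
Lemma conv2_cons_nil a u : conv2 (a :: u) [::] = [:: a.+1; 0] :: conv2 u [::].
Proof. by rewrite /conv2 /= !maxn0 /= -[1]addn0 iotaDl -map_comp. Qed.
Lemma conv2_cons a u b v : conv2 (a :: u) (b :: v) = [:: a.+1; b.+1] :: conv2 u v.
Proof. by rewrite /conv2 /= maxnSS /= -[1]addn0 iotaDl -map_comp. Qed.

Lemma same_accepts u v : all (fun t => t < size trans) u -> all (fun t => t < size trans) v ->
  nfa_accepts same_nfa (conv [:: u; v]) <-> map lbl u = map lbl v.
Proof.
rewrite conv2E -[nfa_accepts _ _]/(nfa_run [:: 0] same_nfa.2 0 (conv2 u v)).
elim: u v => [|a u IH] [|b v]; first by [].
- move=> _ _; rewrite conv2_nil_cons; split=> // /hasP[d /mapP[e _ ->] /=].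
  by rewrite ?eqseq_cons ?andbF.
- move=> _ _; rewrite conv2_cons_nil; split=> // /hasP[d /mapP[e _ ->] /=].
  by rewrite ?eqseq_cons ?andbF /= ?andbF.
move=> /andP[aT uT] /andP[bT vT]; rewrite conv2_cons; split=> [/hasP[d]|[lab luv]].
  move=> /mapP[e]; rewrite mem_filter => /andP[/eqP le _] -> /= /andP[/eqP[e1 e2]].
  by move=> /(IH _ uT vT) ->; rewrite -e1 -e2 le.
apply/hasP; exists (0, [:: a.+1; b.+1], 0); last by rewrite !eqxx /=; apply/IH.
apply/mapP; exists (a, b) => //; rewrite mem_filter /= lab eqxx.
by apply/allpairsP; exists (a, b); rewrite !mem_iota.
Qed.

Definition level_pres (n : nat) : presentation := (size trans, level_nfa n, same_nfa).

Lemma level_dom n v : pres_dom (level_pres n) v <->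
  v \in runs (map lbl v) /\ leading_zeros n (map lbl v).
Proof.
rewrite /pres_dom conv1E runsP /nfa_accepts /nfa_start /nfa_final /nfa_delta /=.
rewrite level_run //; split=> [[_ [-> lz]]|[[e _] lz]] //.
by split=> //; apply: move_run_lt e.
Qed.

Lemma level_rel n u v : pres_rel (level_pres n) u v <->
  [/\ pres_dom (level_pres n) u, pres_dom (level_pres n) v & map lbl u = map lbl v].
Proof.
split=> [[du [dv e]]|[du dv e]].
  by split=> //; apply/same_accepts => //; [case: du|case: dv].
by do 2!split=> //; apply/same_accepts => //; [case: du|case: dv].
Qed.

(** Only the number of levels varies with [n]; the transitions and [same_nfa] are constants, so no
    construction of automata has to be computed. *)
Lemma cmp_level_pres : cmp level_pres.
Proof. by rewrite /level_pres /level_nfa /level_delta; cmp_tac. Qed.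

End Runs.

Definition realizes (F : seq nat -> nat) (G : nat -> presentation) (lab : nat -> nat)
    (rn : seq nat -> seq word) : Prop :=
  [/\ cmp G,
      forall w, uniq (rn w) /\ size (rn w) = F w,
      forall w v, v \in rn w -> map lab v = w,
      forall n v, pres_dom (G n) v <-> v \in rn (map lab v) /\ leading_zeros n (map lab v)
    & forall n u v, pres_rel (G n) u v <->
        [/\ pres_dom (G n) u, pres_dom (G n) v & map lab u = map lab v]].

Lemma rational_realizes F K : rational F -> (forall w, F w <> 0 -> w <> [::] /\ all (fun a => a < K) w) ->
  exists G lab rn, realizes F G lab rn.
Proof.
move=> rF hF; have F0 : F [::] = 0 by apply/eqP/negPn/negP => /eqP/hF[].
have [J [st [fi [fam [m [h1 h2 h3]]]]]] := rational_normal rF F0.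
exists (level_pres st fi m K), (lbl st m K), (runs st fi m K); split.
- exact: cmp_level_pres.
- move=> w; split; first exact: uniq_runs_rev.
  by rewrite (size_runs h2 h3) ?h1 // => /hF[].
- by move=> w v /runsP[].
- exact: level_dom.
- exact: level_rel.
Qed.

(** * The reduction *)

Section Realized.
Variables (F : seq nat -> nat) (G : nat -> presentation) (lab : nat -> nat) (rn : seq nat -> seq word).
Hypothesis real : realizes F G lab rn.
Variable n : nat.

Let D := pres_dom (G n).
Let E := pres_rel (G n).

Let uniq_rn w : uniq (rn w). Proof. by case: real => _ /(_ w)[]. Qed.
Let size_rn w : size (rn w) = F w. Proof. by case: real => _ /(_ w)[]. Qed.
Let lab_rn w v : v \in rn w -> map lab v = w. Proof. by case: real => _ _ h _ _; apply: h. Qed.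
Let domE v : D v <-> v \in rn (map lab v) /\ leading_zeros n (map lab v).
Proof. by case: real => _ _ _ h _; apply: h. Qed.
Let relE u v : E u v <-> [/\ D u, D v & map lab u = map lab v].
Proof. by case: real => _ _ _ _ h; apply: h. Qed.

Lemma realized_equiv : equiv_on D E.
Proof.
split=> [x y /relE[]|x dx|x y /relE[dx dy e]|x y z /relE[dx _ e] /relE[_ dz e']].
- by [].
- exact/relE.
- exact/relE.
- by apply/relE; rewrite e e'.
Qed.

Lemma realized_structure : is_equiv_structure (G n).
Proof.
have [_ r s t] := realized_equiv.
by split; [exact: r|split; [exact: s|exact: t]].
Qed.

Definition first_run (v : word) : Prop := D v /\ v = head [::] (rn (map lab v)).

Let head_run w : 0 < F w -> leading_zeros n w ->
  first_run (head [::] (rn w)) /\ map lab (head [::] (rn w)) = w.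
Proof.
move=> fw lz; have hw : head [::] (rn w) \in rn w.
  by have := size_rn w; case: (rn w) => [e|v l _]; [rewrite -e in fw|rewrite mem_head].
have e := lab_rn hw; split=> //; split; last by rewrite e.
by apply/domE; rewrite e.
Qed.

Let dom_gt0 v : D v -> 0 < F (map lab v).
Proof. by move=> /domE[h _]; rewrite -size_rn; case: (rn _) h. Qed.

Lemma realized_transversal : transversal_of D E first_run.
Proof.
split=> [v []//|v dv|u v [du eu] [dv ev] /relE[_ _ e]]; last by rewrite eu ev e.
have [r e] := head_run (dom_gt0 dv) (proj2 (proj1 (domE v) dv)).
by exists (head [::] (rn (map lab v))) => //; apply/relE; split=> //; case: r.
Qed.

Lemma class_runs u v : D u -> v \in rn (map lab u) <-> E u v.
Proof.
move=> du; split=> [h|/relE[_ /domE[h _] ->] //].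
have e := lab_rn h; apply/relE; split=> //; apply/domE; rewrite e; split=> //.
by have /domE[] := du.
Qed.

(** A representative is the first run of its label, so passing to the label and taking the first run
    are injections in the two directions. *)
Lemma reps_of_size (K : word -> Prop) l : uniq l -> (forall v, v \in l <-> K v) -> 0 < size l ->
  equinum (reps_like E first_run K) (of_size F n (size l)).
Proof.
move=> ul lK l0.
have sizeE r : D r -> equinum (E r) K <-> F (map lab r) = size l.
  move=> dr; rewrite -size_rn; apply: equinum_seq => // v; exact: class_runs.
move=> k; split.
  apply: (@size_ge_inj _ _ _ (map lab)) => [r [[dr er] h]|r r' [[dr er] _] [[dr' er'] _] e].
    by split; [have /domE[] := dr|apply/sizeE].
  by rewrite er er' e.
apply: (@size_ge_inj _ _ _ (fun w => head [::] (rn w))) => [w [lz fw]|w w' [lz fw] [lz' fw'] e].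
  have w0 : 0 < F w by rewrite fw.
  have [r ew] := head_run w0 lz; split=> //; apply/sizeE; first by case: r.
  by rewrite ew.
have w0 : 0 < F w by rewrite fw.
have w0' : 0 < F w' by rewrite fw'.
by have [_ <-] := head_run w0 lz; have [_ <-] := head_run w0' lz'; rewrite e.
Qed.

(** All classes of a realized structure are finite and nonempty, so no other cardinality has to be
    compared. *)
Lemma reps_size (K : word -> Prop) r : reps_like E first_run K r ->
  exists l, [/\ uniq l, 0 < size l & equinum K (fun v => v \in l)].
Proof.
move=> [[dr _] h]; exists (rn (map lab r)); split=> //; first by rewrite size_rn dom_gt0.
apply: equinum_trans (equinum_sym h) _ => k.
by rewrite (size_ge_seq k (uniq_rn (map lab r)) (fun v => class_runs v dr))
           (size_ge_seq k (uniq_rn (map lab r)) (fun v => conj id id)).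
Qed.

End Realized.

Lemma realized_iso F1 G1 lab1 rn1 F2 G2 lab2 rn2 n :
  realizes F1 G1 lab1 rn1 -> realizes F2 G2 lab2 rn2 ->
  pres_iso (G1 n) (G2 n) <-> forall s, 0 < s -> equinum (of_size F1 n s) (of_size F2 n s).
Proof.
move=> R1 R2.
pose r1 := reps_like (pres_rel (G1 n)) (first_run G1 lab1 rn1 n).
pose r2 := reps_like (pres_rel (G2 n)) (first_run G2 lab2 rn2 n).
have isoE := conj (iso_of_equinum (realized_equiv R1 n) (realized_equiv R2 n)
    (realized_transversal R1 n) (realized_transversal R2 n))
  (equinum_of_iso (realized_equiv R1 n) (realized_equiv R2 n)
    (realized_transversal R1 n) (realized_transversal R2 n)).
have reps l : uniq l -> 0 < size l ->
    equinum (r1 (fun v => v \in l)) (of_size F1 n (size l)) /\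
    equinum (r2 (fun v => v \in l)) (of_size F2 n (size l)).
  by move=> ul l0; split; [apply: (reps_of_size R1)|apply: (reps_of_size R2)].
split=> [/isoE.2 h s s0|h].
  (* Any list of [s] distinct words would do as a set of cardinality [s]. *)
  pose l := map (fun i => nseq i 0) (iota 0 s).
  have ul : uniq l.
    by rewrite map_inj_uniq ?iota_uniq // => i j /(congr1 size); rewrite !size_nseq.
  have sl : size l = s by rewrite size_map size_iota.
  have [e1 e2] := reps l ul ltac:(by rewrite sl); rewrite -sl.
  exact: equinum_trans (equinum_sym e1) (equinum_trans (h _) e2).
apply: isoE.1 => K.
have fromL l : uniq l -> 0 < size l -> equinum K (fun v => v \in l) ->
    equinum (r1 K)
            (r2 K).
  move=> ul l0 eK; rewrite /r1 /r2 !(reps_like_eq _ _ eK); have [e1 e2] := reps l ul l0.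
  exact: equinum_trans e1 (equinum_trans (h _ l0) (equinum_sym e2)).
have [[r hr]|n1] := pselect (exists r, r1 K r).
  by have [l [ul l0 eK]] := reps_size R1 hr; apply: fromL eK.
have [[r hr]|n2] := pselect (exists r, r2 K r).
  by have [l [ul l0 eK]] := reps_size R2 hr; apply: fromL eK.
move=> k; split=> -[l [ul sl hl]]; exists l; split=> // x /hl hx; [case: n1|case: n2]; by exists x.
Qed.

Lemma EqIso_pickle P Q : EqIsoProblem (pickle (P, Q)) <-> is_equiv_structure P /\ pres_iso P Q.
Proof. by rewrite /EqIsoProblem pickleK_inv. Qed.

Lemma EqIso_hard (B : nat -> Prop) : Pi01 B -> m_reducible B EqIsoProblem.
Proof.
move=> [p [tot hB]].
have realize e (he : e = full_regex p \/ e = err_regex) :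
    exists G lab rn, realizes (size_series p e) G lab rn.
  apply: (rational_realizes (K := letter_bound p)); first exact: rational_size_series.
  by move=> w; apply: size_series_letters.
have [G1 [lab1 [rn1 R1]]] := realize _ (or_introl erefl).
have [G2 [lab2 [rn2 R2]]] := realize _ (or_intror erefl).
have [c1 _ _ _ _] := R1; have [c2 _ _ _ _] := R2.
have cG : cmp (fun n => (G1 n, G2 n)) by apply: cmp_pair.
exists (fun n => pickle (G1 n, G2 n)); split.
  have [H [q hq] hH] := cG; exists q => n; rewrite pickle_cd -hH.
  exact: (hq [:: n]).
move=> n; rewrite EqIso_pickle (realized_iso n R1 R2).
have nB : B n <-> ~ exists m y, peval p [:: n; m] y.+1.
  rewrite hB; split=> [h [m [y py]]|h m]; first by have := peval_det (h m) py.
  by have [[|y] py] := tot n m => //; case: h; exists m, y.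
rewrite nB; split=> [np|[_ h] [m [y py]]].
  by split=> [|s s0]; [exact: (realized_structure R1 n)|apply: of_size_equinum].
have [s [w [s0 hw no]]] := of_size_separated py.
have [] := h s s0 1; case=> [|l [_ sl hl] _]; first by exists [:: w]; split=> // x; rewrite inE => /eqP ->.
by case: l sl hl => // w' l _ hl; case: (no w'); apply: hl; rewrite mem_head.
Qed.

Theorem theorem2 : Pi01_complete EqIsoProblem.
Proof. by split; [exact: EqIso_Pi01|exact: EqIso_hard]. Qed.
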